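(* Let $M$ be a complex manifold with $\dim M\geq 2$. Then there exists a quasi-plurisubharmonic function $\varphi$ on $M$ such that there is no quasi-plurisubharmonic function $\varphi_{A}$ on $M$ with logarithmic poles satisfying both $\varphi_{A}\geq\varphi$ and $\mathcal{I}(\varphi_{A})=\mathcal{I}(\varphi)$. Consequently, for this $\varphi$ there is no sequence $(\varphi_{A,j})_{j\geq 1}$ of quasi-plurisubharmonic functions on $M$ with logarithmic poles such that $\mathcal{I}(\varphi_{A,j})=\mathcal{I}(\varphi)$ for all $j$ and $\varphi_{A,j}$ decreases to $\varphi$ as $j\to\infty$.
   Context: Plurisubharmonic functions take values in $[-\infty,+\infty)$ and are not identically $-\infty$ on any connected component. A function on a complex manifold is quasi-plurisubharmonic if locally it can be written as $\psi+v$ with $\psi$ plurisubharmonic and $v$ smooth. For a quasi-plurisubharmonic function $\varphi$, the multiplier ideal sheaf $\mathcal{I}(\varphi)$ is the sheaf of germs of holomorphic functions $f$ such that $|f|^{2}e^{-2\varphi}$ is locally integrable. A quasi-plurisubharmonic function $\varphi_{A}$ has logarithmic poles if, locally near every point, there exist a real number $c\in\mathbb{R}$ and finitely many holomorphic functions $g_{1},\dots,g_{N}$ such that $\varphi_{A}=c\log\sum_{k=1}^{N}|g_{k}|^{2}+O(1)$, where $O(1)$ denotes a bounded function. *)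

(* Defs.v *)
From HB Require Import structures.
From mathcomp Require Import all_boot all_order all_algebra.
From mathcomp Require Import complex.
From mathcomp Require Import all_classical all_reals all_analysis.

Set Implicit Arguments.
Unset Strict Implicit.
Unset Printing Implicit Defensive.

Import Order.TTheory GRing.Theory Num.Theory.
Import numFieldNormedType.Exports.

Local Open Scope classical_set_scope.
Local Open Scope complex_scope.
Local Open Scope ring_scope.

(* The topology of the norm; over itself as a normed module, C is R[i]^o. *)
HB.instance Definition _ (R : rcfType) := PseudoPointedMetric.copy R[i] R[i]^o.

Section tuple_cons_measure.
Context d (T : measurableType d) (R : realType) (n : nat).

Definition tuple_cons (p : T * n.-tuple T) : n.+1.-tuple T :=
  [tuple of p.1 :: p.2].

Lemma measurable_tuple_cons : measurable_fun setT tuple_cons.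
Proof. exact: (@measurable_cons _ _ (T * n.-tuple T)%type T fst n snd). Qed.

Variables (mu : {sigma_finite_measure set T -> \bar R}).
Variable nu : {sigma_finite_measure set (n.-tuple T) -> \bar R}.

Definition tuple_cons_measure : set (n.+1.-tuple T) -> \bar R :=
  pushforward (mu \x nu)%E tuple_cons.

Let mf := measurable_tuple_cons.

Let m0 : tuple_cons_measure set0 = 0%E.
Proof. exact: measure0. Qed.

Let mge0 A : (0 <= tuple_cons_measure A)%E.
Proof. exact: measure_ge0. Qed.

Let msigma : semi_sigma_additive tuple_cons_measure.
Proof. exact: measure_semi_sigma_additive. Qed.

HB.instance Definition _ := isMeasure.Build _ _ _ tuple_cons_measure
  m0 mge0 msigma.

Let uncons (t : n.+1.-tuple T) : T * n.-tuple T :=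
  (tnth t ord0, [tuple of behead t]).

Let munc : measurable_fun setT uncons.
Proof.
apply/measurable_fun_pair; [exact: measurable_tnth|exact: measurable_behead].
Qed.

Let tuple_consK : cancel tuple_cons uncons.
Proof.
by move=> [x t]; rewrite /uncons /tuple_cons; congr pair => //; exact: val_inj.
Qed.

Let sf : sigma_finite setT tuple_cons_measure.
Proof.
have /sigma_finiteP[F [FT ndF Foo]] := sigma_finiteT mu.
have /sigma_finiteP[G [GT ndG Goo]] := sigma_finiteT nu.
exists (fun k => uncons @^-1` (F k `*` G k)).
  apply/esym; rewrite -subTset => t _.
  have : (\bigcup_i F i) (tnth t ord0) by rewrite -FT.
  have : (\bigcup_i G i) [tuple of behead t] by rewrite -GT.
  move=> [j _ Gj] [i _ Fi]; exists (maxn i j) => //; split => /=.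
    by move: Fi; apply/subsetPset/ndF/leq_maxl.
  by move: Gj; apply/subsetPset/ndG/leq_maxr.
move=> k; have [mF Fk] := Foo k; have [mG Gk] := Goo k; split.
  by rewrite -[X in measurable X]setTI; apply: munc => //; exact: measurableX.
rewrite /tuple_cons_measure /pushforward -comp_preimage.
rewrite (_ : uncons \o tuple_cons = id) ?preimage_id; last exact/funext.
by rewrite product_measure1E// lte_mul_pinfty// ge0_fin_numE.
Qed.

HB.instance Definition _ := Measure_isSigmaFinite.Build _ _ _
  tuple_cons_measure sf.

End tuple_cons_measure.

(* The n-fold product measure mu \x ... \x mu on n.-tuple T. *)
Fixpoint tuple_measure d (T : measurableType d) (R : realType)
    (mu : {sigma_finite_measure set T -> \bar R}) (n : nat) :
    {sigma_finite_measure set (n.-tuple T) -> \bar R} :=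
  match n return {sigma_finite_measure set (n.-tuple T) -> \bar R} with
  | 0 => \d_([tuple] : 0.-tuple T)
  | m.+1 => tuple_cons_measure mu (tuple_measure mu m)
  end.

(* Points of C^n from 2n real coordinates: z_j = t_j + i t_(n+j). *)
Definition cvec (R : realType) n (t : (n + n).-tuple R) : 'rV[R[i]]_n :=
  \row_j (tnth t (lshift n j) +i* tnth t (rshift n j)).

(* Lebesgue measure of R^(2n), carried by the coordinate tuples of C^n. *)
Definition lebesgue_Cn (R : realType) n :
    {sigma_finite_measure set ((n + n).-tuple (measurableTypeR R)) -> \bar R} :=
  tuple_measure (@lebesgue_measure R) (n + n).

Section Cn.
Context (R : realType) (n : nat).
Implicit Types (U : set 'rV[R[i]]_n) (z w : 'rV[R[i]]_n).

(* Real directional differentiability: w ranges over all vectors of C^n,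
   seen as the real vector space R^(2n). *)
Fixpoint Ck_on (k : nat) U (f : 'rV[R[i]]_n -> R) : Prop :=
  (forall z, U z -> {for z, continuous f}) /\
  match k with
  | 0 => True
  | l.+1 => forall w,
      (forall z, U z -> derivable (fun t : R => f (z + t%:C *: w)) 0 1) /\
      Ck_on l U (fun z => derive1 (fun t : R => f (z + t%:C *: w)) 0)
  end.

Definition smooth_Cn U (f : 'rV[R[i]]_n -> R) := forall k, Ck_on k U f.

(* Upper semicontinuity and the sub-mean value inequality on closed discs of
   complex lines. The condition of not being identically -oo is imposed on
   the manifold, see psh_on. *)
Definition psh_Cn U (u : 'rV[R[i]]_n -> \bar R) :=
  [/\ forall z, U z -> (u z < +oo)%E,
      forall z (a : R), U z -> (u z < a%:E)%E ->
        \forall y \near z, (u y < a%:E)%E &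
      forall z w, (forall zeta : R[i], `|zeta| <= 1 -> U (z + zeta *: w)) ->
        (u z <= ((2 * pi)^-1)%:E *
           \int[@lebesgue_measure R]_(t in `[0%R, (2 * pi)%R])
             u (z + (cos t +i* sin t)%C *: w)%R)%E].

End Cn.

(* [chart_inv] is only meaningful on the image of [chart_dom]. *)
Record chart (R : realType) (n : nat) (M : topologicalType) := Chart {
  chart_dom : set M ;
  chart_map :> M -> 'rV[R[i]]_n ;
  chart_inv : 'rV[R[i]]_n -> M ;
  chart_dom_open : open chart_dom ;
  chart_img_open : open (chart_map @` chart_dom) ;
  chartK : forall x, chart_dom x -> chart_inv (chart_map x) = x ;
  chart_continuous : forall x, chart_dom x -> {for x, continuous chart_map} ;
  chart_inv_continuous : forall x, chart_dom x ->
    {for chart_map x, continuous chart_inv}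
}.

(* Complex manifolds of pure dimension n, nonempty, possibly disconnected.
   Since 'rV[R[i]]_n is a normed module over R[i], differentiable is complex
   Frechet differentiability, so that transition maps are holomorphic. *)
Record complexManifold (R : realType) (n : nat) := ComplexManifold {
  carrier :> topologicalType ;
  atlas : set (chart R n carrier) ;
  atlas_cover : forall x, exists2 c, atlas c & chart_dom c x ;
  atlas_compat : forall c c', atlas c -> atlas c' ->
    forall x, chart_dom c x -> chart_dom c' x ->
      differentiable (c' \o chart_inv c : 'rV[R[i]]_n -> 'rV[R[i]]_n) (c x) ;
  manifold_hausdorff : hausdorff_space carrier ;
  manifold_second_countable : @second_countable carrier ;
  manifold_nonempty : [set: carrier] !=set0
}.

Section manifold.
Context (R : realType) (n : nat) (M : complexManifold R n).
Implicit Types (V : set M) (phi psi : M -> \bar R).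

Definition holomorphic_on V (f : M -> R[i]) :=
  forall c, atlas c -> forall x, V x -> chart_dom c x ->
    differentiable (f \o chart_inv c : 'rV[R[i]]_n -> R[i]^o) (c x).

Definition smooth_on V (v : M -> R) :=
  forall c : chart R n M, atlas c ->
    smooth_Cn (c @` (V `&` chart_dom c)) (v \o chart_inv c).

Definition psh_on V psi :=
  (forall c : chart R n M, atlas c ->
     psh_Cn (c @` (V `&` chart_dom c)) (psi \o chart_inv c)) /\
  (forall x, V x -> exists2 y, connected_component V x y & psi y != -oo%E).

Definition quasi_psh phi :=
  forall p, exists V psi (v : M -> R),
    [/\ open_nbhs p V, psh_on V psi, smooth_on V v &
        forall x, V x -> phi x = (psi x + (v x)%:E)%E].

Definition locally_integrable_near (F : M -> \bar R) (p : M) :=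
  forall c : chart R n M, atlas c -> chart_dom c p ->
    exists W : set 'rV[R[i]]_n,
      [/\ open_nbhs (c p) W, W `<=` c @` chart_dom c &
          (lebesgue_Cn R n).-integrable (@cvec R n @^-1` W)
            (F \o chart_inv c \o @cvec R n)].

(* The sheaf is given by its sections over each open set V; the values of a
   section outside V are irrelevant. *)
Definition multiplier_ideal phi (V : set M) : set (M -> R[i]) :=
  [set f | [/\ open V, holomorphic_on V f &
    forall p, V p -> locally_integrable_near
      (fun x => ((Normc.normc (f x) ^+ 2)%:E * expeR (- (2%:E * phi x)))%E) p]].

(* With c = 0 the formula reads phi = O(1), since 0 * -oo = 0. *)
Definition log_poles phi :=
  forall p, exists V (c : R) (N : nat) (g : 'I_N -> M -> R[i]) (b : M -> R),
    [/\ open_nbhs p V,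
        forall k, holomorphic_on V (g k),
        exists B : R, forall x, V x -> `|b x| <= B &
        forall x, V x -> phi x =
          (c%:E * lne (\sum_(k < N) Normc.normc (g k x) ^+ 2)%R%:E + (b x)%:E)%E].

End manifold.

(* Main.v *)
(* In a chart centred at [x0], with coordinates [z], let [w] be positive weights
   of sum 1 for which [m |-> m.w] is injective on exponents, and let [phi] be
   [max_i (2 w_i)^-1 log |z_i|^2] near [x0], modified so as to vanish away from
   [x0]. The polydiscs [|z_i| < e^(-k w_i)] have volume of order [e^(-2k)] and
   [phi <= - k] on them, so [e^(-2 phi)] is not integrable near [x0].

   Let [phiA = c log (sum_k |g_k|^2) + O(1)] be above [phi], with [c > 0]. Among
   the monomials in the Taylor expansions of the [g_k] there is a unique
   exponent [m] of least weight. Along the curve [|z_i| = e^(-u w_i)] the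
   inequality [phiA >= phi] gives [2 c m.w <= 1]. Making one coordinate decay
   slightly faster does not change [phi] there, since the dimension is at least
   2 and another coordinate realises the maximum; this gives [2 c m.w < 1].
   Therefore [{phiA < - k}] lies in finitely many polydiscs of volume
   [O(e^(-2k (1 + delta)))], and [e^(-2 phiA)] is integrable: the constant 1 is a
   section of the multiplier ideal sheaf of [phiA] but not of that of [phi].

   Plurisubharmonicity of [phi], up to a smooth term, follows from Jensen's
   inequality for [log |h|]. *)
Require Import Defs.
From HB Require Import structures.
From mathcomp Require Import all_boot all_order all_algebra.
From mathcomp Require Import complex.
From mathcomp Require Import all_classical all_reals all_analysis.
From mathcomp Require Import measurable_realfun ring lra.

Set Implicit Arguments.
Unset Strict Implicit.
Unset Printing Implicit Defensive.

Import Order.TTheory GRing.Theory Num.Theory.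
Import numFieldNormedType.Exports.

Local Open Scope classical_set_scope.
Local Open Scope ring_scope.

(** With t_i = |z_i|^2 in coordinates rescaled to the unit polydisc and A_i = (2 w_i)^-1, the
    function is max_i A_i (k(t_i) - t_i), where k(t) is 1 + ln t up to t = 1 and t beyond. The terms
    are nonpositive, and a single t_i >= 1 makes the maximum 0, so it extends by 0; adding the
    smooth sum of all A_j t_j turns each term into a sum of convex increasing functions of the ln
    t_j. The definitions ask for plurisubharmonicity and integrability in every chart. The model is
    therefore composed with arbitrary holomorphic maps, and volumes are carried to another chart by
    covering Lipschitz images of boxes with cubes, which replaces the change of variables formula.
    Holomorphy is differentiability at each point, with no continuity of the derivative: Goursat's
    theorem for s + i t |-> F(e^(s + i t)) gives the maximum principle, from which come both
    Jensen's inequality and the Cauchy estimates behind smoothness and Taylor expansion. *)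

Local Notation nc := Normc.normc.

(** * Functions of one complex variable *)

Section complex_derivative.
Variable R : realType.
Implicit Types (x y z a d h : R[i]) (F G : R[i] -> R[i]).

Lemma ncE z : nc z = Num.sqrt (complex.Re z ^+ 2 + complex.Im z ^+ 2).
Proof. by case: z. Qed.

Lemma nc0 : nc 0 = 0 :> R.
Proof. exact: Normc.normc0. Qed.

Lemma nc1 : nc 1 = 1 :> R.
Proof. exact: Normc.normc1. Qed.

Lemma nc_ge0 z : 0 <= nc z.
Proof. by rewrite ncE sqrtr_ge0. Qed.

Lemma nc_le0 z : (nc z <= 0) = (z == 0).
Proof.
apply/idP/eqP => [z0|->]; last by rewrite nc0.
by apply: Normc.eq0_normc; apply/eqP; rewrite eq_le z0 nc_ge0.
Qed.

Lemma nc_gt0 z : (0 < nc z) = (z != 0).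
Proof. by rewrite ltNge nc_le0. Qed.

Lemma ncD x y : nc (x + y) <= nc x + nc y.
Proof. exact: le_normcD. Qed.

Lemma ncB x y : nc (x - y) <= nc x + nc y.
Proof. by rewrite -[nc y]normcN ncD. Qed.

Lemma ncBC x y : nc (x - y) = nc (y - x).
Proof. by rewrite -normcN opprB. Qed.

Lemma ncM x y : nc (x * y) = nc x * nc y.
Proof. exact: Normc.normcM. Qed.

Lemma nc_real (x : R) : nc (x%:C)%C = `|x|.
Proof. by rewrite ncE /= expr0n addr0 sqrtr_sqr. Qed.

Lemma nc_sqr z : nc z ^+ 2 = complex.Re z ^+ 2 + complex.Im z ^+ 2.
Proof. by rewrite ncE sqr_sqrtr// addr_ge0 ?sqr_ge0. Qed.

Lemma nc_Re z : `|complex.Re z| <= nc z.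
Proof. by rewrite ncE -sqrtr_sqr ler_wsqrtr// lerDl sqr_ge0. Qed.

Lemma nc_Im z : `|complex.Im z| <= nc z.
Proof. by rewrite ncE -sqrtr_sqr ler_wsqrtr// lerDr sqr_ge0. Qed.

Lemma nc_le_ReIm z : nc z <= `|complex.Re z| + `|complex.Im z|.
Proof.
rewrite -ler_sqr ?nnegrE ?nc_ge0 ?addr_ge0// nc_sqr sqrrD !real_normK ?num_real//.
by rewrite lerD2r lerDl mulr2n addr_ge0 ?mulr_ge0.
Qed.

Lemma ReD x y : complex.Re (x + y) = complex.Re x + complex.Re y.
Proof. by case: x; case: y. Qed.

Lemma ImD x y : complex.Im (x + y) = complex.Im x + complex.Im y.
Proof. by case: x; case: y. Qed.

Lemma ReN x : complex.Re (- x) = - complex.Re x.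
Proof. by case: x. Qed.

Lemma ImN x : complex.Im (- x) = - complex.Im x.
Proof. by case: x. Qed.

Lemma ReM x y : complex.Re (x * y) =
  complex.Re x * complex.Re y - complex.Im x * complex.Im y.
Proof. by case: x; case: y. Qed.

Lemma ImM x y : complex.Im (x * y) =
  complex.Re x * complex.Im y + complex.Im x * complex.Re y.
Proof. by case: x; case: y. Qed.

(** Turns bounds on real parts into bounds on the modulus: a real-variable argument is applied to
    the real part of [u * F]. *)
Lemma nc_rotate z : exists2 u, nc u = 1 & complex.Re (u * z) = nc z.
Proof.
have [->|z0] := eqVneq z 0.
  by exists 1; rewrite ?mulr0 ?nc1 ?nc0.
have nz : nc z != 0 by rewrite gt_eqF// nc_gt0.
exists ((complex.Re z / nc z) -i* (complex.Im z / nc z))%C.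
  rewrite ncE /= sqrrN !exprMn -mulrDl -nc_sqr -exprMn divff// expr1n.
  by rewrite sqrtr1.
rewrite ReM /= mulNr opprK mulrAC [X in _ + X]mulrAC -mulrDl -!expr2 -nc_sqr.
by rewrite expr2 mulfK.
Qed.

Lemma nc_prod (I : Type) (r : seq I) (f : I -> R[i]) :
  nc (\prod_(i <- r) f i) = \prod_(i <- r) nc (f i).
Proof.
apply: (big_morph (fun z => nc z)) => [x y|]; [exact: ncM|].
exact: nc1.
Qed.

Lemma ncX z k : nc (z ^+ k) = nc z ^+ k.
Proof.
by elim: k => [|k ih]; rewrite ?expr0 ?nc1// !exprS ncM ih.
Qed.

Lemma ncV z : nc z^-1 = (nc z)^-1.
Proof. exact: Normc.normcV. Qed.

Lemma nc_sum (I : Type) (r : seq I) (P : pred I) (f : I -> R[i]) :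
  nc (\sum_(i <- r | P i) f i) <= \sum_(i <- r | P i) nc (f i).
Proof.
elim/big_rec2 : _ => [|i u v _ h]; first by rewrite nc0.
by rewrite (le_trans (ncD _ _))// lerD2l.
Qed.

Definition ccont F a := forall e : R, 0 < e -> exists2 r : R, 0 < r &
  forall h, nc h < r -> nc (F (a + h) - F a) <= e.

(** Multiplied out by [nc h], so that [h = 0] needs no exclusion and error terms simply add up. *)
Definition cder F a d := forall e : R, 0 < e -> exists2 r : R, 0 < r &
  forall h, nc h < r -> nc (F (a + h) - F a - d * h) <= e * nc h.

Lemma cder_lip F a d : cder F a d -> exists2 r : R, 0 < r &
  forall h, nc h < r -> nc (F (a + h) - F a) <= (nc d + 1) * nc h.
Proof.
move=> /(_ 1 ltr01)[r r0 hr]; exists r => // h /hr.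
rewrite mul1r => hh.
rewrite -[X in nc X](subrK (d * h)) mulrDl mul1r [leRHS]addrC.
by rewrite (le_trans (ncD _ _))// lerD// ncM.
Qed.

Lemma cder_cont F a d : cder F a d -> ccont F a.
Proof.
move=> /cder_lip[r r0 hr] e e0.
have D0 : 0 < nc d + 1 by rewrite ltr_wpDl ?nc_ge0.
exists (Num.min r (e / (nc d + 1))); first by rewrite lt_min r0 divr_gt0.
move=> h; rewrite lt_min => /andP[/hr hh he].
by rewrite (le_trans hh)// mulrC -ler_pdivlMr// ltW.
Qed.

Lemma cder_cst c a : cder (fun=> c) a 0.
Proof.
move=> e e0; exists 1 => // h _; rewrite subrr mul0r subr0 nc0.
by rewrite mulr_ge0 ?nc_ge0// ltW.
Qed.

Lemma cder_id a : cder id a 1.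
Proof.
move=> e e0; exists 1 => // h _; rewrite /= mul1r addrAC addrK subrr nc0.
by rewrite mulr_ge0 ?nc_ge0// ltW.
Qed.

Lemma cderD F G a d d' : cder F a d -> cder G a d' ->
  cder (fun x => F x + G x) a (d + d').
Proof.
move=> hF hG e e0; have e2 : 0 < e / 2 by rewrite divr_gt0.
have [r r0 hr] := hF _ e2; have [s s0 hs] := hG _ e2.
exists (Num.min r s); first by rewrite lt_min r0 s0.
move=> h; rewrite lt_min => /andP[/hr h1 /hs h2].
rewrite (_ : _ - _ = (F (a + h) - F a - d * h) + (G (a + h) - G a - d' * h)); last by ring.
by rewrite (splitr e) mulrDl (le_trans (ncD _ _))// lerD.
Qed.

Lemma cderM F G a d d' : cder F a d -> cder G a d' ->
  cder (fun x => F x * G x) a (d * G a + F a * d').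
Proof.
move=> hF hG e e0.
(* [K - 1] is the total coefficient of the three error terms of the decomposition below, each a
   multiple of [e / K * nc h]. *)
pose K := nc (G a) + nc (F a) + 1 + (nc d + 1) * (nc d' + 1).
have K0 : 0 < K.
  by rewrite /K ltr_wpDr ?mulr_ge0 ?addr_ge0 ?nc_ge0// ltr_wpDl// addr_ge0 ?nc_ge0.
have eK : 0 < e / K by rewrite divr_gt0.
have [r r0 hr] := hF _ eK; have [s s0 hs] := hG _ eK.
have [r' r'0 hr'] := cder_lip hF; have [s' s'0 hs'] := cder_lip hG.
exists (Num.min (Num.min r s) (Num.min (Num.min r' s') (e / K))).
  by rewrite !lt_min r0 s0 r'0 s'0 eK.
move=> h; rewrite !lt_min => /andP[/andP[/hr h1 /hs h2] /andP[/andP[/hr' h3 /hs' h4] h5]].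
rewrite (_ : _ - _ = (F (a + h) - F a - d * h) * G a +
   F a * (G (a + h) - G a - d' * h) +
   (F (a + h) - F a) * (G (a + h) - G a)); last by ring.
rewrite (le_trans (ncD _ _))// (@le_trans _ _ (e / K * nc h * nc (G a) +
   nc (F a) * (e / K * nc h) + (nc d + 1) * nc h * ((nc d' + 1) * (e / K))))//.
  rewrite lerD//; last first.
    rewrite ncM ler_pM ?nc_ge0// (le_trans h4)// ler_wpM2l ?addr_ge0 ?nc_ge0//.
    exact: ltW.
  rewrite (le_trans (ncD _ _))// lerD// ncM.
    by rewrite ler_wpM2r ?nc_ge0.
  by rewrite ler_wpM2l ?nc_ge0.
rewrite (_ : _ + _ = (e / K) * nc h * (K - 1)); last by rewrite /K; ring.
rewrite mulrAC ler_wpM2r ?nc_ge0// mulrAC ler_pdivrMr// ler_wpM2l ?ltW//.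
by rewrite gtrBl.
Qed.

Lemma cderZ c F a d : cder F a d -> cder (fun x => c * F x) a (c * d).
Proof.
by move=> hF; have := cderM (cder_cst c a) hF; rewrite mul0r add0r.
Qed.

Lemma cderB F G a d d' : cder F a d -> cder G a d' ->
  cder (fun x => F x - G x) a (d - d').
Proof.
move=> hF hG; have := cderD hF (cderZ (- 1) hG).
by rewrite mulN1r; under eq_fun do rewrite mulN1r.
Qed.

Lemma cder_affine b c F a d : cder F (b + c * a) d ->
  cder (fun x => F (b + c * x)) a (d * c).
Proof.
move=> hF e e0; have c0 : 0 < nc c + 1 by rewrite ltr_wpDl ?nc_ge0.
have ec : 0 < e / (nc c + 1) by rewrite divr_gt0.
have [r r0 hr] := hF _ ec.
exists (r / (nc c + 1)); first by rewrite divr_gt0.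
move=> h; rewrite ltr_pdivlMr// => hh.
have /hr : nc (c * h) < r.
  rewrite ncM (le_lt_trans _ hh)// mulrC ler_wpM2l ?nc_ge0//.
  by rewrite lerDl.
rewrite mulrDr addrA mulrA => /le_trans; apply.
rewrite ncM mulrA ler_wpM2r ?nc_ge0// mulrAC ler_pdivrMr// ler_wpM2l ?ltW//.
by rewrite ltrDl.
Qed.

Lemma cderV a : a != 0 -> cder (fun x => x^-1) a (- a^-2).
Proof.
move=> a0 e e0; have na : 0 < nc a by rewrite nc_gt0.
pose r := Num.min (nc a / 2) (e * nc a ^+ 3 / 2).
exists r; first by rewrite lt_min !divr_gt0// mulr_gt0// exprn_gt0.
move=> h; rewrite lt_min => /andP[h1 h2].
have ah : nc a / 2 <= nc (a + h).
  have := ncB (a + h) h; rewrite addrK => hh.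
  rewrite -(lerD2r (nc h)) (le_trans _ hh)//.
  by rewrite {2}(splitr (nc a)) lerD2l ltW.
have ah0 : 0 < nc (a + h) by rewrite (lt_le_trans _ ah)// divr_gt0.
have ah1 : a + h != 0 by rewrite -nc_gt0.
rewrite (_ : _ - _ = h * h / (a ^+ 2 * (a + h))); last first.
  by field; rewrite a0 ah1.
rewrite !ncM ncV ncM mulrAC ler_wpM2r ?nc_ge0// ncX.
rewrite ler_pdivrMr ?mulr_gt0 ?exprn_gt0//.
apply: (le_trans (ltW h2)); rewrite -mulrA ler_wpM2l ?(ltW e0)//.
by rewrite exprSr -mulrA ler_wpM2l// exprn_ge0// nc_ge0.
Qed.

End complex_derivative.

(** * Continuity and integration on a segment *)

Section segment_integral.
Variable R : realType.
Notation mu := (@lebesgue_measure R).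
Implicit Types (a b c x y e : R) (f g : R -> R).

Definition rcont a b f := forall x, a <= x <= b -> forall e, 0 < e ->
  exists2 d : R, 0 < d &
    forall y, a <= y <= b -> `|y - x| < d -> `|f y - f x| <= e.

Definition Int a b f := \int[mu]_(x in `[a, b]) f x.

Lemma rcont_within a b f : rcont a b f -> {within `[a, b], continuous f}.
Proof.
move=> cf; apply/subspace_continuousP => x /=; rewrite in_itv/= => xab.
apply/cvgrPdist_le => e e0; have [d d0 hd] := cf x xab e e0.
rewrite /within/= -nbhs_nearE; apply/nbhs_ballP; exists d => //= y.
by rewrite /ball/= => yx; rewrite in_itv/= => yab; rewrite distrC hd// distrC.
Qed.

Lemma rcont_integrable a b f : rcont a b f ->
  mu.-integrable `[a, b] (EFin \o f).
Proof.
move=> /rcont_within cf; apply: continuous_compact_integrable => //.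
exact: segment_compact.
Qed.

Lemma rcont_sub a b c d f : a <= c -> d <= b -> rcont a b f -> rcont c d f.
Proof.
move=> ac db cf x /andP[cx xd] e e0.
have ab y : c <= y <= d -> a <= y <= b.
  by move=> /andP[cy yd]; rewrite (le_trans ac cy) (le_trans yd db).
have /cf/(_ e e0)[r r0 hr] : a <= x <= b by rewrite ab// cx.
by exists r => // y /ab yab; exact: hr.
Qed.

Lemma rcontD a b f g : rcont a b f -> rcont a b g ->
  rcont a b (fun x => f x + g x).
Proof.
move=> cf cg x xab e e0; have e2 : 0 < e / 2 by rewrite divr_gt0.
have [r r0 hr] := cf x xab _ e2; have [s s0 hs] := cg x xab _ e2.
exists (Num.min r s); first by rewrite lt_min r0.
move=> y yab; rewrite lt_min => /andP[/(hr _ yab) h1 /(hs _ yab) h2].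
rewrite opprD addrACA (splitr e) (le_trans (ler_normD _ _))//.
exact: lerD.
Qed.

Lemma rcontN a b f : rcont a b f -> rcont a b (fun x => - f x).
Proof.
move=> cf x xab e e0; have [d d0 hd] := cf x xab e e0.
by exists d => // y yab /(hd _ yab); rewrite -opprD normrN.
Qed.

Lemma rcontB a b f g : rcont a b f -> rcont a b g ->
  rcont a b (fun x => f x - g x).
Proof. by move=> cf cg; exact/rcontD/rcontN. Qed.

Lemma rcont_cst a b (k : R) : rcont a b (fun=> k).
Proof.
by move=> x _ e e0; exists 1 => // y _ _; rewrite subrr normr0 ltW.
Qed.

Lemma Int_split a b c f : a <= c <= b -> rcont a b f ->
  Int a b f = Int a c f + Int c b f.
Proof.
move=> /andP[ac cb] /rcont_integrable fi.
have := Rintegral_itvB fi; move=> /(_ c).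
rewrite !bnd_simp => /(_ ac cb) h.
rewrite /Int -[LHS](subrK (\int[mu]_(x in `[a, c]) f x)) h addrC; congr (_ + _).
rewrite Rintegral_itv_obnd_cbnd//; apply: integrableS fi => //.
by apply: subset_itvr; rewrite bnd_simp.
Qed.

Lemma IntD a b f g : rcont a b f -> rcont a b g ->
  Int a b (fun x => f x + g x) = Int a b f + Int a b g.
Proof. by move=> cf cg; apply: RintegralD => //; exact: rcont_integrable. Qed.

Lemma IntB a b f g : rcont a b f -> rcont a b g ->
  Int a b (fun x => f x - g x) = Int a b f - Int a b g.
Proof. by move=> cf cg; apply: RintegralB => //; exact: rcont_integrable. Qed.

Lemma IntZ a b k f : rcont a b f -> Int a b (fun x => k * f x) = k * Int a b f.
Proof. by move=> cf; apply: RintegralZl => //; exact: rcont_integrable. Qed.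

Lemma Int_cst a b k : a <= b -> Int a b (fun=> k) = k * (b - a).
Proof.
move=> ab; rewrite /Int Rintegral_cst//= lebesgue_measure_itv/= lte_fin.
move: ab; rewrite le_eqVlt => /predU1P[->|->]; last by rewrite -EFinD.
by rewrite ltxx subrr.
Qed.

Lemma le_Int a b f g : rcont a b f -> rcont a b g ->
  (forall x, a <= x <= b -> f x <= g x) -> Int a b f <= Int a b g.
Proof.
move=> cf cg fg; apply: le_Rintegral => //; exact: rcont_integrable.
Qed.

Lemma Int_near a b f k e : a <= b -> rcont a b f ->
  (forall x, a <= x <= b -> `|f x - k| <= e) ->
  `|Int a b f - k * (b - a)| <= e * (b - a).
Proof.
move=> ab cf fk; rewrite ler_distl; apply/andP; split.
  rewrite -mulrBl -Int_cst//; apply: le_Int => // [|x xab].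
    exact: rcont_cst.
  by have := fk x xab; rewrite ler_distl => /andP[].
rewrite -mulrDl -Int_cst//; apply: le_Int => // [|x xab].
  exact: rcont_cst.
by have := fk x xab; rewrite ler_distl => /andP[].
Qed.

Lemma eq_Int a b f g : (forall x, a <= x <= b -> f x = g x) ->
  Int a b f = Int a b g.
Proof.
by move=> fg; apply: eq_Rintegral => x; rewrite inE/= in_itv/=; exact: fg.
Qed.

End segment_integral.

Lemma nested_segments (R : realType) (u v : nat -> R) :
  (forall k, u k <= u k.+1) -> (forall k, v k.+1 <= v k) ->
  (forall k, u k <= v k) -> exists x, forall k, u k <= x <= v k.
Proof.
move=> uS vS uv.
have um : {homo u : i j / (i <= j)%N >-> i <= j}.
  by apply: homo_leq => // x y z; exact: le_trans.
have vm : {homo v : i j / (i <= j)%N >-> i >= j}.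
  by apply: (@homo_leq _ v (fun x y => y <= x)) => // x y z h1 h2; exact: le_trans h2 h1.
have uv' i j : u i <= v j.
  have [ij|/ltnW ji] := leqP i j; first by rewrite (le_trans (um _ _ ij)).
  by rewrite (le_trans (uv _))// vm.
have hs : has_sup (range u).
  by split; [exists (u 0%N), 0%N|exists (v 0%N) => _ [i _ <-]].
exists (sup (range u)) => k; apply/andP; split.
  by apply: ub_le_sup; [case: hs|exists k].
by apply: ge_sup; [case: hs|move=> _ [i _ <-]].
Qed.

(** * Goursat's theorem on rectangles *)

Section goursat.
Variables (R : realType) (P Q : R -> R -> R) (S0 T0 L1 L2 : R).
Hypotheses (L1_ge0 : 0 <= L1) (L2_ge0 : 0 <= L2).
Implicit Types s t a b e : R.

(** The same [p] is the derivative of [P] in [s] and of [Q] in [t]: the form [Q ds + P dt] is closed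
    pointwise, while nothing is assumed on the continuity of the derivatives. *)
Hypothesis diffPQ : forall s t, S0 <= s <= S0 + L1 -> T0 <= t <= T0 + L2 ->
  exists p p' q : R, forall e : R, 0 < e -> exists2 d : R, 0 < d &
    forall x y, `|x| < d -> `|y| < d ->
    `|P (s + x) (t + y) - P s t - (p * x + p' * y)| <= e * (`|x| + `|y|) /\
    `|Q (s + x) (t + y) - Q s t - (q * x + p * y)| <= e * (`|x| + `|y|).

Let cont1 (F : R -> R -> R) (d0 e k l : R) s t : 0 < e -> 0 < d0 ->
  (forall x y, `|x| < d0 -> `|y| < d0 ->
    `|F (s + x) (t + y) - F s t - (k * x + l * y)| <= 1 * (`|x| + `|y|)) ->
  exists2 d : R, 0 < d & forall x y, `|x| < d -> `|y| < d ->
    `|F (s + x) (t + y) - F s t| <= e.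
Proof.
move=> e0 d00 h; pose K := 1 + `|k| + `|l|.
have K0 : 0 < K by rewrite /K -addrA ltr_wpDr// addr_ge0.
exists (Num.min d0 (e / (2 * K))); first by rewrite lt_min d00 divr_gt0 ?mulr_gt0.
move=> x y; rewrite !lt_min => /andP[x1 x2] /andP[y1 y2].
have := h x y x1 y1; rewrite mul1r => h1.
rewrite -[X in `|X|](subrK (k * x + l * y)).
rewrite (le_trans (ler_normD _ _))//.
apply: (@le_trans _ _ ((`|x| + `|y|) * K)).
  have -> : (`|x| + `|y|) * K = (`|x| + `|y|) + (`|x| + `|y|) * (`|k| + `|l|).
    by rewrite /K; ring.
  rewrite lerD// (le_trans (ler_normD _ _))//.
  by rewrite !normrM mulrDr lerD// mulrC ler_wpM2r// ?lerDl ?lerDr.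
rewrite -ler_pdivlMr// (splitr (e / K)) lerD//; apply: ltW.
  by rewrite (lt_le_trans x2)// invfM mulrA mulrAC.
by rewrite (lt_le_trans y2)// invfM mulrA mulrAC.
Qed.

Lemma rcont_rect s : S0 <= s <= S0 + L1 -> rcont T0 (T0 + L2) (P s).
Proof.
move=> hs t ht e' e'0; have [p [p' [q hpq]]] := diffPQ hs ht.
have [d0 d00 hd0] := hpq 1 ltr01.
have [|d d1 hd] := @cont1 P d0 e' p p' s t e'0 d00.
  by move=> x y hx hy; case: (hd0 x y hx hy).
exists d => // y _ yt; have := hd 0 (y - t).
by rewrite normr0 addr0 [t + _]addrC subrK; apply.
Qed.

Let contQ t : T0 <= t <= T0 + L2 -> rcont S0 (S0 + L1) (Q ^~ t).
Proof.
move=> ht s hs e' e'0; have [p [p' [q hpq]]] := diffPQ hs ht.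
have [d0 d00 hd0] := hpq 1 ltr01.
have [|d d1 hd] := @cont1 Q d0 e' q p s t e'0 d00.
  by move=> x y hx hy; case: (hd0 x y hx hy).
exists d => // x _ xs; have := hd (x - s) 0.
by rewrite normr0 addr0 [s + _]addrC subrK; apply.
Qed.

(** The integral of the form [Q ds + P dt] along the boundary of the rectangle with corner [(s, t)]
    and sides [a] and [b]. *)
Definition rect_defect s t a b :=
  Int t (t + b) (fun y => P (s + a) y - P s y) -
  Int s (s + a) (fun x => Q x (t + b) - Q x t).
Local Notation J := rect_defect.

Let inrect s t a b :=
  [/\ S0 <= s, s + a <= S0 + L1, T0 <= t & t + b <= T0 + L2].

Let cP s t a b : 0 <= a -> 0 <= b -> inrect s t a b ->
  rcont t (t + b) (P s) /\ rcont t (t + b) (P (s + a)).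
Proof.
move=> a0 b0 [h1 h2 h3 h4]; split; apply: (@rcont_sub _ T0 (T0 + L2)) => //.
  by apply: rcont_rect => //; rewrite h1 (le_trans _ h2)// lerDl.
by apply: rcont_rect => //; rewrite h2 (le_trans h1)// lerDl.
Qed.

Let cQ s t a b : 0 <= a -> 0 <= b -> inrect s t a b ->
  rcont s (s + a) (Q ^~ t) /\ rcont s (s + a) (Q ^~ (t + b)).
Proof.
move=> a0 b0 [h1 h2 h3 h4]; split; apply: (@rcont_sub _ S0 (S0 + L1)) => //.
  by apply: contQ => //; rewrite h3 (le_trans _ h4)// lerDl.
by apply: contQ => //; rewrite h4 (le_trans h3)// lerDl.
Qed.

Let J_splits s t a1 a2 b : 0 <= a1 -> 0 <= a2 -> 0 <= b ->
  inrect s t (a1 + a2) b ->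
  J s t (a1 + a2) b = J s t a1 b + J (s + a1) t a2 b.
Proof.
move=> a10 a20 b0 r; have r1 : inrect s t a1 b.
  case: r => h1 h2 h3 h4; split => //.
  by rewrite (le_trans _ h2)// addrA lerDl.
have r2 : inrect (s + a1) t a2 b.
  case: r => h1 h2 h3 h4; split => //; first by rewrite (le_trans h1)// lerDl.
  by rewrite -addrA.
have [p1 p2] := cP a10 b0 r1; have [p3 p4] := cP a20 b0 r2.
have [q1 q2] := cQ (addr_ge0 a10 a20) b0 r.
rewrite /J (@Int_split _ s _ (s + a1)); last 2 first.
  by rewrite !lerD2l !lerDl a10 a20.
  exact: rcontB.
rewrite [s + (a1 + a2)]addrA (@eq_Int _ t (t + b) _ (fun y =>
   (P (s + a1) y - P s y) + (P (s + a1 + a2) y - P (s + a1) y))); last first.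
  by move=> x _; rewrite [RHS]addrC addrA subrK.
rewrite IntD; try exact: rcontB.
by rewrite opprD addrACA.
Qed.

Let J_splitt s t a b1 b2 : 0 <= b1 -> 0 <= b2 -> 0 <= a ->
  inrect s t a (b1 + b2) ->
  J s t a (b1 + b2) = J s t a b1 + J s (t + b1) a b2.
Proof.
move=> a10 a20 b0 r; have r1 : inrect s t a b1.
  case: r => h1 h2 h3 h4; split => //.
  by rewrite (le_trans _ h4)// addrA lerDl.
have r2 : inrect s (t + b1) a b2.
  case: r => h1 h2 h3 h4; split => //; first by rewrite (le_trans h3)// lerDl.
  by rewrite -addrA.
have [p1 p2] := cQ b0 a10 r1; have [p3 p4] := cQ b0 a20 r2.
have [q1 q2] := cP b0 (addr_ge0 a10 a20) r.
rewrite /J (@Int_split _ t _ (t + b1)); last 2 first.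
  by rewrite !lerD2l !lerDl a10 a20.
  exact: rcontB.
rewrite [t + (b1 + b2)]addrA (@eq_Int _ s (s + a) (fun x => Q x (t + b1 + b2) - Q x t)
   (fun x => (Q x (t + b1) - Q x t) + (Q x (t + b1 + b2) - Q x (t + b1)))); last first.
  by move=> x _; rewrite [RHS]addrC addrA subrK.
rewrite (@IntD _ s (s + a)); try exact: rcontB.
by rewrite opprD addrACA.
Qed.

(** The linear parts contribute [p * a * b] to both integrals of the defect and cancel; the
    increments between opposite sides differ from them by at most [2 * e * (a + b)]. *)
Let J_near s t e : S0 <= s <= S0 + L1 -> T0 <= t <= T0 + L2 -> 0 < e ->
  exists2 d : R, 0 < d & forall s' t' a b, 0 <= a < d -> 0 <= b < d ->
    inrect s' t' a b -> s' <= s <= s' + a -> t' <= t <= t' + b ->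
    `|J s' t' a b| <= 2 * e * (a + b) ^+ 2.
Proof.
move=> hs ht e0; have [p [p' [q hpq]]] := diffPQ hs ht.
have [d d0 hd] := hpq _ e0; exists d => // s' t' a b /andP[a0 ad] /andP[b0 bd].
move=> r /andP[s1 s2] /andP[t1 t2].
have [P1 P2] := cP a0 b0 r; have [Q1 Q2] := cQ a0 b0 r.
have hP : `|Int t' (t' + b) (fun y => P (s' + a) y - P s' y) - p * a * (t' + b - t')|
    <= 2 * e * (a + b) * (t' + b - t').
  apply: Int_near; rewrite ?lerDl//; first exact: rcontB.
  move=> y /andP[y1 y2].
  have yt : `|y - t| <= b by rewrite ler_norml; apply/andP; split; lra.
  have sa : `|s' + a - s| <= a by rewrite ler_norml; apply/andP; split; lra.
  have sb : `|s' - s| <= a by rewrite ler_norml; apply/andP; split; lra.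
  have [h1 _] := hd (s' + a - s) (y - t) (le_lt_trans sa ad) (le_lt_trans yt bd).
  have [h2 _] := hd (s' - s) (y - t) (le_lt_trans sb ad) (le_lt_trans yt bd).
  move: h1 h2; rewrite ![s + _]addrC ![t + _]addrC !subrK => h1 h2.
  rewrite (_ : _ - _ = (P (s' + a) y - P s t - (p * (s' + a - s) + p' * (y - t)))
    - (P s' y - P s t - (p * (s' - s) + p' * (y - t)))); last by ring.
  rewrite (le_trans (ler_normB _ _))// -mulrA mulr_natl mulr2n lerD//.
    by rewrite (le_trans h1)// ler_wpM2l ?(ltW e0)// lerD.
  by rewrite (le_trans h2)// ler_wpM2l ?(ltW e0)// lerD.
have hQ : `|Int s' (s' + a) (fun x => Q x (t' + b) - Q x t') - p * b * (s' + a - s')|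
    <= 2 * e * (a + b) * (s' + a - s').
  apply: Int_near; rewrite ?lerDl//; first exact: rcontB.
  move=> x /andP[x1 x2].
  have xs : `|x - s| <= a by rewrite ler_norml; apply/andP; split; lra.
  have sa : `|t' + b - t| <= b by rewrite ler_norml; apply/andP; split; lra.
  have sb : `|t' - t| <= b by rewrite ler_norml; apply/andP; split; lra.
  have [_ h1] := hd (x - s) (t' + b - t) (le_lt_trans xs ad) (le_lt_trans sa bd).
  have [_ h2] := hd (x - s) (t' - t) (le_lt_trans xs ad) (le_lt_trans sb bd).
  move: h1 h2; rewrite ![s + _]addrC ![t + _]addrC !subrK => h1 h2.
  rewrite (_ : _ - _ = (Q x (t' + b) - Q s t - (q * (x - s) + p * (t' + b - t)))
    - (Q x t' - Q s t - (q * (x - s) + p * (t' - t)))); last by ring.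
  rewrite (le_trans (ler_normB _ _))// -mulrA mulr_natl mulr2n lerD//.
    by rewrite (le_trans h1)// ler_wpM2l ?(ltW e0)// lerD.
  by rewrite (le_trans h2)// ler_wpM2l ?(ltW e0)// lerD.
rewrite /J; move: hP hQ; set X := Int _ _ _; set Y := Int _ _ _ => hP hQ.
rewrite (_ : X - Y = (X - p * a * (t' + b - t')) - (Y - p * b * (s' + a - s'))); last by ring.
rewrite (le_trans (ler_normB _ _))// (le_trans (lerD hP hQ))//.
by rewrite le_eqVlt; apply/orP; left; apply/eqP; ring.
Qed.

Let bad e (k : nat) (st : R * R) :=
  inrect st.1 st.2 (L1 / 2 ^+ k) (L2 / 2 ^+ k) /\
  e * (L1 / 2 ^+ k + L2 / 2 ^+ k) ^+ 2 < `|J st.1 st.2 (L1 / 2 ^+ k) (L2 / 2 ^+ k)|.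

Let sub e k (st st' : R * R) := bad e k st -> [/\ bad e k.+1 st',
  st.1 <= st'.1, st'.1 + L1 / 2 ^+ k.+1 <= st.1 + L1 / 2 ^+ k,
  st.2 <= st'.2 & st'.2 + L2 / 2 ^+ k.+1 <= st.2 + L2 / 2 ^+ k].

(** The defect is additive and the threshold quadratic in the sides, so if all four quarters met it
    the whole rectangle would too. For a rectangle that is not bad any successor will do, which
    makes the iteration total. *)
Let subdivide e k st : exists st', sub e k st st'.
Proof.
have [b|nb] := pselect (bad e k st); last by exists st => /nb.
case: st b => s t [r hJ].
pose a' := L1 / 2 ^+ k.+1; pose b' := L2 / 2 ^+ k.+1.
have a'0 : 0 <= a' by rewrite divr_ge0// exprn_ge0.
have b'0 : 0 <= b' by rewrite divr_ge0// exprn_ge0.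
have ea : L1 / 2 ^+ k = a' + a'.
  by rewrite /a' exprS invfM mulrCA [2^-1 * _]mulrC -splitr.
have eb : L2 / 2 ^+ k = b' + b'.
  by rewrite /b' exprS invfM mulrCA [2^-1 * _]mulrC -splitr.
move: r hJ; rewrite /= ea eb => r.
rewrite J_splits ?addr_ge0//.
have r1 : inrect s t a' (b' + b').
  by case: r => h1 h2 h3 h4; split => //; lra.
have r2 : inrect (s + a') t a' (b' + b').
  by case: r => h1 h2 h3 h4; split => //; lra.
rewrite !J_splitt// => hJ.
have pick s' t' : s <= s' <= s + a' -> t <= t' <= t + b' ->
    e * (a' + b') ^+ 2 < `|J s' t' a' b'| -> exists st', sub e k (s, t) st'.
  move=> /andP[? ?] /andP[? ?] ?; exists (s', t'); rewrite /sub /bad /= ea eb -/a' -/b' => _.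
  by case: r => ? ? ? ?; split => //; try lra; split => //; split => //; lra.
have [|x1] := ltP (e * (a' + b') ^+ 2) `|J s t a' b'|.
  by apply: pick; rewrite ?lexx ?lerDl ?a'0 ?b'0.
have [|x2] := ltP (e * (a' + b') ^+ 2) `|J s (t + b') a' b'|.
  by apply: pick; rewrite ?lexx ?lerDl ?a'0 ?b'0.
have [|x3] := ltP (e * (a' + b') ^+ 2) `|J (s + a') t a' b'|.
  by apply: pick; rewrite ?lexx ?lerDl ?a'0 ?b'0.
have [|x4] := ltP (e * (a' + b') ^+ 2) `|J (s + a') (t + b') a' b'|.
  by apply: pick; rewrite ?lexx ?lerDl ?a'0 ?b'0.
exfalso; move: hJ; apply/negP; rewrite -leNgt.
rewrite (_ : e * _ = (e * (a' + b') ^+ 2 + e * (a' + b') ^+ 2) +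
  (e * (a' + b') ^+ 2 + e * (a' + b') ^+ 2)); last by ring.
by rewrite (le_trans (ler_normD _ _))// lerD// (le_trans (ler_normD _ _))// lerD.
Qed.

Lemma goursat_rect : rect_defect S0 T0 L1 L2 = 0.
Proof.
suff H e : 0 < e -> `|J S0 T0 L1 L2| <= e * (L1 + L2) ^+ 2.
  apply/eqP; rewrite -normr_le0; apply/ler_addgt0Pl => e e0; rewrite addr0.
  have L0 : 0 < (L1 + L2) ^+ 2 + 1 by rewrite ltr_wpDl// sqr_ge0.
  apply: (le_trans (H (e / ((L1 + L2) ^+ 2 + 1)) _)); first by rewrite divr_gt0.
  by rewrite mulrAC ler_pdivrMr// ler_wpM2l ?(ltW e0)// lerDl.
move=> e0; rewrite leNgt; apply/negP => hJ.
have [g hg] : exists g : nat -> R * R, g 0%N = (S0, T0) /\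
    forall k, sub e k (g k) (g k.+1).
  pose h k st := projT1 (cid (subdivide e k st)).
  pose g := fix g k := if k is k'.+1 then h k' (g k') else (S0, T0).
  by exists g; split => // k /=; rewrite /h; case: cid.
case: hg => g0 hg.
have gb k : bad e k (g k).
  elim: k => [|k ih]; last by case: (hg k ih).
  by rewrite g0 /bad /= expr0 !divr1; split => //; split.
have [s hs] : exists s, forall k, (g k).1 <= s <= (g k).1 + L1 / 2 ^+ k.
  apply: (@nested_segments _ (fun k => (g k).1)) => k; try by case: (hg k (gb k)).
  by rewrite lerDl divr_ge0// exprn_ge0.
have [t ht] : exists t, forall k, (g k).2 <= t <= (g k).2 + L2 / 2 ^+ k.
  apply: (@nested_segments _ (fun k => (g k).2)) => k; try by case: (hg k (gb k)).
  by rewrite lerDl divr_ge0// exprn_ge0.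
have hs0 := hs 0%N; have ht0 := ht 0%N.
rewrite g0 /= expr0 divr1 in hs0; rewrite g0 /= expr0 divr1 in ht0.
(* Taken at the point common to all the nested rectangles and with [e / 2]: the factor 2 of [J_near]
   then yields exactly the bound that bad rectangles violate. *)
have [d d0 hd] := J_near hs0 ht0 (divr_gt0 e0 (ltr0Sn R 1)).
have [k hk] : exists k, L1 / 2 ^+ k < d /\ L2 / 2 ^+ k < d.
  have L0 : 0 <= (L1 + L2) / d by rewrite divr_ge0 ?addr_ge0// ltW.
  exists (Num.truncn ((L1 + L2) / d)).+1.
  have : (L1 + L2) / d < 2 ^+ (Num.truncn ((L1 + L2) / d)).+1.
    apply: (lt_le_trans (truncnS_gt _)); rewrite -natrX ler_nat ltnW//.
    exact: ltn_expl.
  rewrite ltr_pdivrMr// mulrC -ltr_pdivrMr ?exprn_gt0// mulrDl => h.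
  have h1 : 0 <= L1 / 2 ^+ (Num.truncn ((L1 + L2) / d)).+1.
    by rewrite divr_ge0// exprn_ge0.
  have h2 : 0 <= L2 / 2 ^+ (Num.truncn ((L1 + L2) / d)).+1.
    by rewrite divr_ge0// exprn_ge0.
  by split; lra.
have [r] := gb k; apply/negP; rewrite -leNgt.
have := hd (g k).1 (g k).2 (L1 / 2 ^+ k) (L2 / 2 ^+ k).
rewrite !divr_ge0 ?exprn_ge0//=; case: hk => -> -> /(_ isT isT r (hs k) (ht k)).
by rewrite [2 * (e / _)]mulrC divfK// pnatr_eq0.
Qed.

End goursat.

(** * Real derivatives and the mean value inequality *)

Section real_derivative.
Variable R : realType.
Implicit Types (f : R -> R) (x d e h : R).

Definition rder f x d := forall e, 0 < e -> exists2 r : R, 0 < r &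
  forall h, `|h| < r -> `|f (x + h) - f x - d * h| <= e * `|h|.

Lemma rder_is_derive f x d : rder f x d -> is_derive x (1 : R) f d.
Proof.
move=> hf; have H : (fun h => h^-1 *: (f (h *: (1 : R) + x) - f x)) @ 0^' --> d.
  apply/cvgrPdist_le => e e0; have [r r0 hr] := hf e e0.
  rewrite near_withinE; near=> h => h0.
  have hr' : `|h| < r.
    near: h; apply/nbhs_ballP; exists r => //= y.
    by rewrite /ball/= sub0r normrN.
  have hn : 0 < `|h| by rewrite normr_gt0.
  rewrite -(ler_pM2r hn) -normrM mulrBl distrC.
  rewrite (_ : h^-1 *: _ * h = f (x + h) - f x); first exact: hr.
  rewrite -[h *: 1]/(h * 1) mulr1 addrC -[h^-1 *: _]/(h^-1 * _).
  by rewrite mulrAC mulVf// mul1r addrC [h + x]addrC.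
apply: DeriveDef; first by apply/cvg_ex; exists d.
exact: (cvg_lim (@Rhausdorff R) H).
Unshelve. all: by end_near.
Qed.

Lemma is_derive_rder f x d : is_derive x (1 : R) f d -> rder f x d.
Proof.
case=> /cvg_ex[l hl] fd e e0.
have ld : l = d.
  by rewrite -fd; apply/esym; exact: (cvg_lim (@Rhausdorff R) hl).
move: hl; rewrite ld => /cvgrPdist_le/(_ e e0).
rewrite near_withinE => /nbhs_ballP[r /= r0 hr]; exists r => // h hh.
have [->|h0] := eqVneq h 0; first by rewrite addr0 subrr mulr0 subrr normr0 mulr0.
have hn : 0 < `|h| by rewrite normr_gt0.
have /hr/(_ h0) : ball (0 : R) r h by rewrite /ball/= sub0r normrN.
rewrite -(ler_pM2r hn) -normrM mulrBl distrC.
rewrite (_ : h^-1 *: _ * h = f (x + h) - f x)//.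
rewrite -[h *: 1]/(h * 1) mulr1 -[h^-1 *: _]/(h^-1 * _).
by rewrite mulrAC mulVf// mul1r [h + x]addrC.
Qed.

Lemma rder_cont f x d : rder f x d -> {for x, continuous f}.
Proof.
move=> /rder_is_derive h; apply: differentiable_continuous.
by apply/derivable1_diffP; case: h.
Qed.

Lemma mean_value_bound f (f' : R -> R) (M : R) :
  (forall x, 0 <= x <= 1 -> rder f x (f' x)) ->
  (forall x, 0 <= x <= 1 -> `|f' x| <= M) -> `|f 1 - f 0| <= M.
Proof.
move=> df fM; have [| |c] := @MVT_segment R f f' 0 1 ler01.
- move=> x; rewrite in_itv/= => /andP[x0 x1]; apply/rder_is_derive/df.
  by rewrite (ltW x0) (ltW x1).
- apply/continuous_in_subspaceT => x; rewrite inE/= in_itv/= => x01.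
  exact: rder_cont (df x x01).
by rewrite in_itv/= => /fM h ->; rewrite subr0 mulr1.
Qed.

End real_derivative.

(** * The maximum principle on the unit disc *)

Section maximum_principle.
Variable R : realType.
Implicit Types (F : R[i] -> R[i]) (s t e M : R) (z w d : R[i]).

Definition unitc t : R[i] := (cos t +i* sin t)%C.

Lemma nc_unitc t : nc (unitc t) = 1.
Proof. by rewrite ncE /= cos2Dsin2 sqrtr1. Qed.

Lemma unitcD s t : unitc (s + t) = unitc s * unitc t.
Proof.
apply/eqP; rewrite eq_complex ReM ImM /= cosD sinD eqxx/=.
by rewrite addrC eqxx.
Qed.

Lemma unitc0 : unitc 0 = 1.
Proof. by rewrite /unitc cos0 sin0. Qed.

Lemma unitc_2pi : unitc (pi *+ 2) = 1.
Proof. by rewrite /unitc cos2pi sin2pi. Qed.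

(** The exponential of [s + i t]; these coordinates turn the punctured disc into a half-strip, on
    which rectangles are annuli cut along a ray. *)
Definition polarc s t : R[i] := (expR s)%:C%C * unitc t.

Lemma nc_polarc s t : nc (polarc s t) = expR s.
Proof. by rewrite ncM nc_unitc mulr1 nc_real ger0_norm// expR_ge0. Qed.

Lemma polarcD s t s' t' : polarc (s + s') (t + t') = polarc s t * polarc s' t'.
Proof. by rewrite /polarc unitcD expRD rmorphM/= mulrACA. Qed.

Lemma polarc_near e : 0 < e -> exists2 d : R, 0 < d &
  forall s t, `|s| < d -> `|t| < d ->
    nc (polarc s t - 1 - (s +i* t)%C) <= e * (`|s| + `|t|).
Proof.
move=> e0; have e4 : 0 < e / 4 by rewrite divr_gt0.
have e8 : 0 < e / 8 by rewrite divr_gt0.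
have [r1 r10 h1] := is_derive_rder (is_derive_expR 0) e4.
have [r2 r20 h2] := is_derive_rder (is_derive_cos 0) e8.
have [r3 r30 h3] := is_derive_rder (is_derive_sin 0) e8.
exists (Num.min (Num.min r1 (Num.min r2 r3)) (Num.min 1 (e / 4))).
  by rewrite !lt_min r10 r20 r30 e4 ltr01.
move=> s t; rewrite !lt_min => /andP[/andP[s1 _] /andP[s4 s5]].
move=> /andP[/andP[_ /andP[t2 t3]] _].
have := h1 s s1; have := h2 t t2; have := h3 t t3.
rewrite !add0r sin0 cos0 expR0 oppr0 mul0r !mul1r addr0 !subr0 => hs hc hE.
rewrite (_ : _ - _ = (expR s - 1 - s)%:C%C * unitc t +
  (1 + s)%:C%C * (unitc t - 1 - (0 +i* t)%C) + (0 +i* (s * t))%C); last first.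
  apply/eqP; rewrite eq_complex; apply/andP; split; apply/eqP.
    by rewrite /polarc !(ReD, ReN, ReM, ImD, ImN, ImM)/=; ring.
  by rewrite /polarc !(ReD, ReN, ReM, ImD, ImN, ImM)/=; ring.
have k1 : nc ((expR s - 1 - s)%:C%C * unitc t) <= e / 4 * `|s|.
  by rewrite ncM nc_unitc mulr1 nc_real.
have k2 : nc ((1 + s)%:C%C * (unitc t - 1 - (0 +i* t)%C)) <= e / 2 * `|t|.
  rewrite ncM nc_real (_ : e / 2 * _ = 2 * (e / 8 * `|t| + e / 8 * `|t|)); last by field.
  apply: ler_pM => //; rewrite ?nc_ge0//.
    by rewrite (le_trans (ler_normD _ _))// normr1; lra.
  rewrite (le_trans (nc_le_ReIm _))//= lerD//.
    by rewrite subr0.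
  by rewrite subr0.
have k3 : nc (0 +i* (s * t))%C <= e / 4 * `|t|.
  rewrite (le_trans (nc_le_ReIm _))//= normr0 add0r normrM.
  by rewrite ler_wpM2r// ltW.
rewrite (le_trans (ncD _ _))// (le_trans (lerD (ncD _ _) (lexx _)))//.
apply: (le_trans (lerD (lerD k1 k2) k3)).
have := normr_ge0 s; have := normr_ge0 t; have := mulr_ge0 (ltW e0) (normr_ge0 s).
have := mulr_ge0 (ltW e0) (normr_ge0 t).
by lra.
Qed.

Lemma cder_polar F s t d : cder F (polarc s t) d ->
  forall e : R, 0 < e -> exists2 r : R, 0 < r &
    forall x y, `|x| < r -> `|y| < r ->
      nc (F (polarc (s + x) (t + y)) - F (polarc s t) -
          d * polarc s t * (x +i* y)%C) <= e * (`|x| + `|y|).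
Proof.
set w := polarc s t => hF e e0.
have w0 : 0 < nc w + 1 by rewrite ltr_wpDl ?nc_ge0.
have dw0 : 0 < nc d * nc w + 1 by rewrite ltr_wpDl ?mulr_ge0 ?nc_ge0.
have [r r0 hr] := hF (e / (4 * (nc w + 1))) (divr_gt0 e0 (mulr_gt0 (ltr0Sn _ 3) w0)).
have [r1 r10 h1] := polarc_near ltr01.
have [r2 r20 h2] := polarc_near (divr_gt0 e0 (mulr_gt0 (ltr0Sn R 1) dw0)).
exists (Num.min (Num.min r1 r2) (r / (4 * (nc w + 1)))).
  by rewrite !lt_min r10 r20 divr_gt0// mulr_gt0.
move=> x y; rewrite !lt_min => /andP[/andP[x1 x2] x3] /andP[/andP[y1 y2] y3].
have {}h1 := h1 x y x1 y1; have {}h2 := h2 x y x2 y2.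
have xy0 : 0 <= `|x| + `|y| by rewrite addr_ge0.
have h3 : nc (polarc x y - 1) <= 2 * (`|x| + `|y|).
  rewrite -[X in nc X](subrK (x +i* y)%C) (le_trans (ncD _ _))//.
  rewrite mulr_natl mulr2n lerD//; first by rewrite -[leRHS]mul1r.
  exact: nc_le_ReIm.
rewrite polarcD -/w; set h := w * (polarc x y - 1).
have wh : w * polarc x y = w + h by rewrite /h mulrBr mulr1 addrC subrK.
have nh : nc h <= 2 * (nc w + 1) * (`|x| + `|y|).
  by rewrite ncM -mulrA mulrCA ler_pM ?nc_ge0 ?lerDl ?ler01.
have hh : nc h < r.
  apply: (le_lt_trans nh); rewrite mulrC -ltr_pdivlMr ?mulr_gt0//.
  rewrite (_ : r / _ = r / (4 * (nc w + 1)) + r / (4 * (nc w + 1))); last first.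
    by field; rewrite gt_eqF.
  by rewrite ltrD.
rewrite wh (_ : _ - _ = (F (w + h) - F w - d * h) +
   d * w * (polarc x y - 1 - (x +i* y)%C)); last by rewrite /h; ring.
rewrite (le_trans (ncD _ _))// (splitr e) mulrDl lerD//.
  apply: (le_trans (hr h hh)).
  apply: (le_trans (ler_wpM2l _ nh)); first by rewrite ltW// divr_gt0// mulr_gt0.
  rewrite mulrA (_ : e / _ * _ = e / 2)//; field; rewrite gt_eqF//.
rewrite (ncM (d * w)) (ncM d w).
apply: (le_trans (ler_wpM2l _ h2)); first by rewrite mulr_ge0 ?nc_ge0.
rewrite mulrA ler_wpM2r// mulrCA ler_wpM2l ?(ltW e0)//.
rewrite invfM mulrCA -[leRHS]mulr1 ler_wpM2l// ler_pdivrMr// mul1r lerDl.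
exact: ler01.
Qed.

(** In the coordinates [polarc] the imaginary part is periodic in the angle, so its two integrals in
    Goursat's identity cancel, and the real part has the same integral over the circles of radius 1
    and [expR (- L)]. On the small circle it is close to its value at 0. At 0 itself only continuity
    is assumed, which admits the difference quotient of [cauchy_estimate]. *)
Lemma Re_max_principle F M :
  (forall z, 0 < nc z <= 1 -> exists d, cder F z d) -> ccont F 0 ->
  (forall t, 0 <= t <= pi *+ 2 -> complex.Re (F (unitc t)) <= M) -> complex.Re (F 0) <= M.
Proof.
move=> dF cF FM; apply/ler_addgt0Pr => e e0; rewrite leNgt; apply/negP => MF.
pose c := complex.Re (F 0) - (M + e).
have c0 : 0 < c by rewrite subr_gt0.
have [r r0 hr] := cF e e0.
(* The inner circle lies in the disc where [F] is within [e] of [F 0]; halving [r] makes the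
   inclusion strict. *)
pose L := Num.max 0 (- ln (r / 2)).
have L0 : 0 <= L by rewrite le_max lexx.
have Lr : expR (- L) < r.
  apply: (@le_lt_trans _ _ (r / 2)); last by lra.
  rewrite -[leRHS]lnK ?posrE ?divr_gt0// ler_expR lerNl.
  by rewrite le_max lexx orbT.
pose P s t := complex.Re (F (polarc s t)).
pose Q s t := complex.Im (F (polarc s t)).
have L20 : 0 <= pi *+ 2 :> R by rewrite mulrn_wge0// pi_ge0.
have PQ : forall s t, - L <= s <= - L + L -> 0 <= t <= 0 + pi *+ 2 ->
    exists p p' q : R, forall e : R, 0 < e -> exists2 d : R, 0 < d &
    forall x y, `|x| < d -> `|y| < d ->
    `|P (s + x) (t + y) - P s t - (p * x + p' * y)| <= e * (`|x| + `|y|) /\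
    `|Q (s + x) (t + y) - Q s t - (q * x + p * y)| <= e * (`|x| + `|y|).
  move=> s t; rewrite addNr => /andP[_ s0] _.
  have [|d hd] := dF (polarc s t).
    by rewrite nc_polarc expR_gt0 -expR0 ler_expR.
  pose v := d * polarc s t.
  exists (complex.Re v), (- complex.Im v), (complex.Im v) => e' e'0.
  have [r' r'0 hr'] := cder_polar hd e'0; exists r' => // x y hx hy.
  have := hr' x y hx hy; set X := (_ - _ - _) => hX; split.
    rewrite (_ : _ - _ = complex.Re X); first exact: le_trans (nc_Re _) hX.
    rewrite /X -/v !(ReD, ReN, ReM)/= /P; ring.
  rewrite (_ : _ - _ = complex.Im X); first exact: le_trans (nc_Im _) hX.
  rewrite /X -/v !(ImD, ImN, ImM)/= /Q; ring.
have := goursat_rect L0 L20 PQ; rewrite /rect_defect addNr add0r.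
rewrite (@eq_Int _ (- L) 0 _ (fun=> 0)); last first.
  by move=> x _; rewrite /Q /polarc unitc_2pi unitc0 subrr.
rewrite Int_cst ?oppr_le0// mul0r subr0 => /eqP; apply/negP.
rewrite lt_eqF//.
apply: (@le_lt_trans _ _ (Int 0 (pi *+ 2) (fun=> - c))); last first.
  by rewrite Int_cst// subr0 mulNr oppr_lt0 mulr_gt0// pmulrn_lgt0// pi_gt0.
apply: le_Int => [| |t ht].
- have h s : - L <= s <= - L + L -> rcont 0 (pi *+ 2) (P s).
    by move=> hs; have := rcont_rect PQ hs; rewrite add0r.
  apply: rcontB; apply: h; first by rewrite addNr oppr_le0 L0 lexx.
  by rewrite addNr oppr_le0 L0 lexx.
- exact: rcont_cst.
have : `|complex.Re (F (0 + polarc (- L) t) - F 0)| <= e.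
  by apply: (le_trans (nc_Re _)); apply: hr; rewrite nc_polarc.
rewrite add0r ReD ReN ler_distl => /andP[h1 h2].
have := FM t ht; have -> : unitc t = polarc 0 t by rewrite /polarc expR0 mul1r.
by rewrite /P /c; lra.
Qed.

Lemma max_principle F M :
  (forall z, 0 < nc z <= 1 -> exists d, cder F z d) -> ccont F 0 ->
  (forall t, 0 <= t <= pi *+ 2 -> nc (F (unitc t)) <= M) -> nc (F 0) <= M.
Proof.
move=> dF cF FM; have [u u1 <-] := nc_rotate (F 0).
apply: (@Re_max_principle (fun z => u * F z)).
- by move=> z /dF[d hd]; exists (u * d); exact: cderZ.
- move=> e /cF[r r0 hr]; exists r => // h /hr.
  by rewrite -mulrBr ncM u1 mul1r.
- move=> t ht; rewrite (le_trans (ler_norm _))// (le_trans (nc_Re _))//.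
  by rewrite ncM u1 mul1r FM.
Qed.

End maximum_principle.

Lemma rcont_unif (R : realType) (a b : R) (f : R -> R) : rcont a b f ->
  forall e : R, 0 < e -> exists2 d : R, 0 < d &
    forall x y, a <= x <= b -> a <= y <= b -> `|y - x| < d -> `|f y - f x| <= e.
Proof.
move=> cf e e0.
have := @segment_compact R a b; rewrite compact_near_coveringP => /(_ R (0 : R)^'+).
move=> /(_ (fun d x => a <= x <= b ->
  forall y, a <= y <= b -> `|y - x| < d -> `|f y - f x| <= e)) [].
- move=> x /=; rewrite in_itv/= => xab.
  have [d d0 hd] := cf x xab (e / 2) (divr_gt0 e0 (ltr0Sn R 1)).
  exists ([set x' | `|x' - x| < d / 2], [set d' | d' < d / 2]) => /=; first split.
  + apply/nbhs_ballP; exists (d / 2) => /=; first by rewrite divr_gt0.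
    by move=> y; rewrite /ball/= distrC.
  + by apply: nbhs_right_lt; rewrite divr_gt0.
  move=> [x' d'] /= [h1 h2] h3 y yab yx.
  rewrite (_ : _ - _ = (f y - f x) - (f x' - f x)); last by ring.
  rewrite (splitr e) (le_trans (ler_normB _ _))// lerD// hd//.
    rewrite (_ : _ - _ = (y - x') + (x' - x)); last by ring.
    by rewrite (le_lt_trans (ler_normD _ _))//; lra.
  by lra.
- move=> r r0 hr; have r20 : 0 < r / 2 by rewrite divr_gt0.
  exists (r / 2) => // x y xab yab yx.
  apply: (hr (r / 2)) => //=.
  by rewrite /= sub0r normrN gtr0_norm//; lra.
Qed.

Lemma rcont_comp (R : realType) (a b : R) (f g : R -> R) : rcont a b f ->
  (forall x, a <= x <= b -> {for f x, continuous g}) ->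
  rcont a b (fun x => g (f x)).
Proof.
move=> cf cg x xab e e0; have /cvgrPdist_le/(_ e e0) := cg x xab.
move=> /nbhs_ballP[r /= r0 hr]; have [d d0 hd] := cf x xab (r / 2) (divr_gt0 r0 (ltr0Sn R 1)).
exists d => // y yab /(hd _ yab) h; rewrite distrC; apply: hr.
by rewrite /ball/= distrC; lra.
Qed.

(** * Jensen's inequality for the logarithm of a modulus *)

Section jensen.
Variable R : realType.
Implicit Types (h : R[i] -> R[i]) (e : R).

Lemma rcont_unitc F : (forall z : R[i], nc z = 1 -> ccont F z) ->
  rcont 0 (pi *+ 2) (fun t : R => nc (F (unitc t))).
Proof.
move=> cF t _ e e0; have [r r0 hr] := cF (unitc t) (nc_unitc t) e e0.
have r4 : 0 < r / 4 by rewrite divr_gt0.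
have [d d0 hd] := @polarc_near R 1 ltr01.
exists (Num.min d (r / 4)) => [|s _]; first by rewrite lt_min d0 r4.
rewrite lt_min => /andP[s1 s2].
have := hd 0 (s - t); rewrite normr0 => /(_ d0 s1).
have -> : polarc 0 (s - t) = unitc (s - t) by rewrite /polarc expR0 mul1r.
rewrite mul1r add0r => h1.
have h2 : nc (unitc t * (unitc (s - t) - 1)) < r.
  rewrite ncM nc_unitc mul1r -[X in nc X](subrK (0 +i* (s - t))%C).
  rewrite (le_lt_trans (ncD _ _))// (le_lt_trans (lerD h1 (nc_le_ReIm _)))//=.
  by rewrite normr0; lra.
have ts : unitc t + unitc t * (unitc (s - t) - 1) = unitc s.
  by rewrite mulrBr mulr1 addrC subrK -unitcD [t + _]addrC subrK.
have := hr _ h2; rewrite ts => h3.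
have k1 := ncD (F (unitc s) - F (unitc t)) (F (unitc t)).
have k2 := ncD (F (unitc t) - F (unitc s)) (F (unitc s)).
rewrite subrK in k1; rewrite subrK ncBC in k2.
by rewrite ler_norml; apply/andP; split; lra.
Qed.

Let w (N : nat) : R[i] := unitc (pi *+ 2 / N%:R).

Let wX (N k : nat) : w N ^+ k = unitc (pi *+ 2 / N%:R * k%:R).
Proof.
elim: k => [|k ih]; first by rewrite expr0 mulr0 unitc0.
by rewrite exprSr ih -unitcD -natr1 mulrDr mulr1.
Qed.

Let HN (N : nat) h (z : R[i]) := \prod_(k < N) h (w N ^+ k * z).

Let HN_rot N h z : (0 < N)%N -> HN N h (w N * z) = HN N h z.
Proof.
case: N => // N _; rewrite /HN big_ord_recr big_ord_recl /= mulrC; congr (_ * _).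
  rewrite mulrA -exprSr wX -mulrA mulVf ?pnatr_eq0// mulr1 unitc_2pi.
  by rewrite expr0.
by apply: eq_bigr => i _; rewrite mulrA -exprSr.
Qed.

Let HN_der N h z : (forall y, nc y <= 1 -> exists d, cder h y d) ->
  nc z <= 1 -> exists d, cder (HN N h) z d.
Proof.
move=> dh z1; rewrite /HN.
suff H m : exists d, cder (fun z => \prod_(k < m) h (w N ^+ k * z)) z d by exact: H.
elim: m => [|m [d ih]].
  by exists 0; under eq_fun do rewrite big_ord0; exact: cder_cst.
have [|d' hd'] := dh (w N ^+ m * z); first by rewrite ncM ncX nc_unitc expr1n mul1r.
have -> : (fun z => \prod_(k < m.+1) h (w N ^+ k * z)) =
    (fun z => (\prod_(k < m) h (w N ^+ k * z)) * h (w N ^+ m * z)).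
  by apply/funext => y; rewrite big_ord_recr.
eexists; apply: cderM ih _.
have := @cder_affine _ 0 (w N ^+ m) h z d'; rewrite add0r => /(_ hd').
by under eq_fun do rewrite add0r; apply.
Qed.

Let w_gt0 (T : R) N : 0 < T -> (0 < N)%N -> 0 < T / N%:R.
Proof. by move=> T0 N0; rewrite divr_gt0// ltr0n. Qed.

Let Int_sum (v : R -> R) (T : R) N m : 0 < T -> (0 < N)%N -> (m <= N)%N ->
  rcont 0 T v ->
  \sum_(k < m) Int (T / N%:R * k%:R) (T / N%:R * k.+1%:R) v =
  Int 0 (T / N%:R * m%:R) v.
Proof.
move=> T0 N0 + cv; have TN := w_gt0 T0 N0; elim: m => [_|m ih mN].
  rewrite big_ord0 mulr0 /Int set_itv1; apply/esym.
  exact: Rintegral_set1.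
rewrite big_ord_recr /= ih ?(ltnW mN)//.
rewrite -(@Int_split _ 0 (T / N%:R * m.+1%:R) (T / N%:R * m%:R))//.
  by rewrite mulr_ge0 ?(ltW TN)//= ler_wpM2l ?(ltW TN)// ler_nat.
apply: (rcont_sub _ _ cv) => //; rewrite mulrAC ler_pdivrMr ?ltr0n//.
by rewrite ler_wpM2l ?(ltW T0)// ler_nat.
Qed.

(** The regularisation by [e] keeps the logarithm finite and continuous at the zeros of the function
    to which Jensen's inequality is applied. *)
Lemma ler_expR_ln_sqr (x e : R) : 0 <= x -> 0 < e ->
  x <= expR (2^-1 * ln (x ^+ 2 + e)).
Proof.
move=> x0 e0; have [->|xn0] := eqVneq x 0; first exact: expR_ge0.
have xp : 0 < x by rewrite lt_neqAle eq_sym xn0.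
rewrite -[leLHS]lnK ?posrE// ler_expR mulrC ler_pdivlMr// mulr_natr -lnXn//.
by rewrite ler_ln ?posrE ?addr_gt0 ?exprn_gt0// lerDl ltW.
Qed.

Lemma rcont_ln_sqr (a b e : R) (f : R -> R) : 0 < e -> rcont a b f ->
  rcont a b (fun t => 2^-1 * ln (f t ^+ 2 + e)).
Proof.
move=> e0 c1.
have c2 : rcont a b (fun t => f t ^+ 2 + e).
  apply: rcontD; last exact: rcont_cst.
  by apply: (@rcont_comp _ _ _ f (fun x => x ^+ 2)) => // x _; exact: exprn_continuous.
have c3 : rcont a b (fun t => ln (f t ^+ 2 + e)).
  apply: (@rcont_comp _ _ _ _ (@ln R) c2) => x _; apply: continuous_ln.
  by rewrite ltr_wpDl// sqr_ge0.
by apply: (@rcont_comp _ _ _ _ ( *%R 2^-1) c3) => x _; exact: mulrl_continuous.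
Qed.

(* The maximum principle is applied to the product of the functions
   [h (w ^+ k * z)], [w] a primitive [N]-th root of unity: the logarithm of its
   modulus is a Riemann sum on the unit circle. *)
Lemma jensen_le h e : (forall z, nc z <= 1 -> exists d, cder h z d) ->
  0 < e -> h 0 != 0 ->
  pi *+ 2 * ln (nc (h 0)) <=
  Int 0 (pi *+ 2) (fun t => 2^-1 * ln (nc (h (unitc t)) ^+ 2 + e)).
Proof.
move=> dh e0 h0; set v := fun t : R => _; pose T : R := pi *+ 2.
have T0 : 0 < T by rewrite /T pmulrn_lgt0// pi_gt0.
have cv : rcont 0 T v.
  have c1 : rcont 0 T (fun t => nc (h (unitc t))).
    by apply: rcont_unitc => z z1; have [|d hd] := dh z; [rewrite z1|exact: cder_cont hd].
  exact: rcont_ln_sqr.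
apply/ler_addgt0Pr => eta eta0.
have etaT : 0 < eta / T by rewrite divr_gt0.
have [d d0 hd] := rcont_unif cv etaT.
(* On arcs of length [T / N] the function [v] varies by at most [eta / T], so any Riemann sum of
   this mesh exceeds the integral by at most [eta]. *)
pose N := (Num.truncn (T / d)).+1.
have N0 : (0 < N)%N by [].
have TN0 := w_gt0 T0 N0.
have TNd : T / N%:R < d.
  by rewrite ltr_pdivrMr ?ltr0n// mulrC -ltr_pdivrMr// truncnS_gt.
pose I := Int 0 T v.
pose M := expR (N%:R * ((I + eta) / T)).
have small t : 0 <= t <= T / N%:R -> nc (HN N h (unitc t)) <= M.
  move=> /andP[t0 tT]; rewrite /HN nc_prod.
  apply: (@le_trans _ _ (\prod_(k < N) expR (v (T / N%:R * k%:R + t)))).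
    apply: ler_prod => k _; rewrite nc_ge0/= wX -unitcD.
    by apply: ler_expR_ln_sqr => //; exact: nc_ge0.
  rewrite -expR_sum ler_expR.
  apply: (@le_trans _ _ (\sum_(k < N) (N%:R / T *
     Int (T / N%:R * k%:R) (T / N%:R * k.+1%:R) v + eta / T))).
    apply: ler_sum => k _.
    have kT : T / N%:R * k.+1%:R <= T.
      by rewrite mulrAC ler_pdivrMr ?ltr0n// ler_wpM2l ?(ltW T0)// ler_nat.
    have k0 : 0 <= T / N%:R * k%:R by rewrite mulr_ge0 ?(ltW TN0).
    have kS : T / N%:R * k.+1%:R = T / N%:R * k%:R + T / N%:R.
      by rewrite -natr1 mulrDr mulr1.
    rewrite -lerBlDr -[N%:R / T]invf_div ler_pdivlMl// mulrC.
    have eD : T / N%:R * k.+1%:R - T / N%:R * k%:R = T / N%:R.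
      by rewrite kS addrC addKr.
    rewrite -[X in _ * X <= _]eD -Int_cst; last by rewrite kS lerDl ltW.
    have cvk : rcont (T / N%:R * k%:R) (T / N%:R * k.+1%:R) v.
      exact: (rcont_sub k0 kT cv).
    apply: le_Int => //; first exact: rcont_cst.
    move=> x /andP[x1 x2]; move: (x2); rewrite kS => x3.
    suff : `|v x - v (T / N%:R * k%:R + t)| <= eta / T.
      by rewrite ler_norml => /andP[]; lra.
    apply: hd; rewrite ?(le_trans k0 x1) ?(le_trans x2 kT)//=.
      by rewrite addr_ge0// (le_trans _ kT)// kS lerD2l.
    by apply: le_lt_trans TNd; rewrite ler_norml; apply/andP; split; lra.
  rewrite big_split /= -mulr_sumr Int_sum// mulfVK ?pnatr_eq0// sumr_const.
  rewrite card_ord -mulr_natl le_eqVlt; apply/orP; left; apply/eqP.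
  by rewrite /I; ring.
(* The product is invariant under rotation by [w N], so the bound on one arc holds on the whole
   circle. *)
have big_ t j : 0 <= t <= T / N%:R ->
    nc (HN N h (unitc (T / N%:R * j%:R + t))) <= M.
  elim: j => [|j ih] ht; first by rewrite mulr0 add0r small.
  by rewrite -natr1 mulrDr mulr1 addrAC addrC unitcD HN_rot// ih.
have : nc (HN N h 0) <= M.
  apply: max_principle.
  - by move=> z /andP[_ z1]; exact: HN_der.
  - have [|dd hdd] := @HN_der N h 0 dh; first by rewrite nc0 ler01.
    exact: cder_cont hdd.
  move=> t /andP[t0 tT]; pose j := Num.truncn (t / (T / N%:R)).
  have tj : 0 <= t / (T / N%:R) by rewrite divr_ge0// ltW.
  have /andP[j1 j2] := truncn_itv tj.
  rewrite -(subrK (T / N%:R * j%:R) t) addrC big_//.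
  rewrite ler_pdivlMr// mulrC in j1; rewrite ltr_pdivrMr// mulrC in j2.
  rewrite subr_ge0 j1 lerBlDr (le_trans (ltW j2))// -natr1 mulrDr mulr1.
  by rewrite addrC.
rewrite /HN (eq_bigr (fun=> h 0)); last by move=> k _; rewrite mulr0.
rewrite nc_prod prodr_const card_ord.
have p0 : 0 < nc (h 0) by rewrite nc_gt0.
rewrite -ler_ln ?posrE ?exprn_gt0 ?expR_gt0// expRK lnXn// -[_ *+ N]mulr_natl.
by rewrite ler_pM2l ?ltr0n// ler_pdivlMr// mulrC.
Qed.

End jensen.

(** * Cauchy's estimate and limits at linear speed *)

Section one_variable.
Variable R : realType.
Implicit Types (F G : R[i] -> R[i]) (a d h : R[i]) (M : R).

Lemma cder_congr F G a d (r : R) : 0 < r ->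
  (forall h, nc h < r -> F (a + h) = G (a + h)) -> cder F a d -> cder G a d.
Proof.
move=> r0 FG hF e e0; have [s s0 hs] := hF e e0.
exists (Num.min r s); first by rewrite lt_min r0.
move=> h; rewrite lt_min => /andP[h1 /hs]; rewrite FG//.
by have := FG 0; rewrite nc0 addr0 => ->.
Qed.

Lemma cder_shift F a b d :
  cder (fun x => F (b + x)) a d -> cder F (b + a) d.
Proof.
by move=> hF e /hF[r r0 hr]; exists r => // h /hr; rewrite addrA.
Qed.

Lemma cder_unique F a d d' : cder F a d -> cder F a d' -> d = d'.
Proof.
move=> h1 h2; apply/eqP; rewrite -subr_eq0 -nc_le0.
apply/ler_addgt0Pr => e e0; rewrite add0r.
have [r r0 hr] := h1 _ (divr_gt0 e0 (ltr0Sn R 1)).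
have [s s0 hs] := h2 _ (divr_gt0 e0 (ltr0Sn R 1)).
pose t := Num.min r s / 2.
have rs : 0 < Num.min r s by rewrite lt_min r0.
have t0 : 0 < t by rewrite divr_gt0.
have tt : nc t%:C%C = t by rewrite nc_real gtr0_norm.
have trs : t < Num.min r s by rewrite /t; lra.
have := trs; rewrite lt_min => /andP[tr ts].
have := hr t%:C%C; rewrite tt => /(_ tr) k1.
have := hs t%:C%C; rewrite tt => /(_ ts) k2.
rewrite -(ler_pM2r t0) -{1}tt -ncM.
rewrite (_ : _ * _ = (F (a + t%:C%C) - F a - d' * t%:C%C) -
  (F (a + t%:C%C) - F a - d * t%:C%C)); last by ring.
by rewrite (splitr e) mulrDl (le_trans (ncB _ _))// lerD.
Qed.

Lemma cder_quad F a d (C r : R) : 0 < r ->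
  (forall h, nc h < r -> nc (F (a + h) - F a - d * h) <= C * nc h ^+ 2) ->
  cder F a d.
Proof.
move=> r0 hr e e0; have C0 : 0 < `|C| + 1 by rewrite ltr_wpDl.
exists (Num.min r (e / (`|C| + 1))); first by rewrite lt_min r0 divr_gt0.
move=> h; rewrite lt_min => /andP[/hr h1 h2]; apply: (le_trans h1).
rewrite expr2 mulrA ler_wpM2r ?nc_ge0//.
rewrite ltr_pdivlMr// mulrC in h2; apply: le_trans (ltW h2).
by rewrite ler_wpM2r ?nc_ge0// (le_trans (ler_norm _))// lerDl.
Qed.

(* The maximum principle for the difference quotient, extended by [d] at 0. *)
Lemma cauchy_estimate F d (r M : R) : 0 < r ->
  (forall z, nc z <= r -> exists d, cder F z d) ->
  (forall z, nc z <= r -> nc (F z) <= M) -> cder F 0 d -> nc d <= 2 * M / r.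
Proof.
move=> r0 dF FM d0; have rC : (r%:C)%C != 0.
  by rewrite -nc_gt0 nc_real gtr0_norm.
pose G x : R[i] := if x == 0 then d else (F (0 + r%:C%C * x) - F 0) * (r%:C%C * x)^-1.
have -> : d = G 0 by rewrite /G eqxx.
apply: max_principle.
- move=> z /andP[z0 z1].
  have [|d' hd'] := dF (0 + r%:C%C * z).
    by rewrite add0r ncM nc_real gtr0_norm// -[leRHS]mulr1 ler_wpM2l// ltW.
  have z0' : z != 0 by rewrite -nc_gt0.
  have rz : 0 + r%:C%C * z != 0 by rewrite add0r mulf_neq0.
  have k1 := cderB (cder_affine hd') (cder_cst (F 0) z).
  have k2 := cderM k1 (cder_affine (cderV rz)).
  eexists; apply: cder_congr k2; first exact: z0.
  move=> h hz; rewrite /G ifF ?add0r//.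
  apply/negP => /eqP zh; move: hz; rewrite -normcN.
  have -> : - h = z by apply/eqP; rewrite eq_sym -addr_eq0 zh.
  by rewrite ltxx.
- move=> e e0; have [s s0 hs] := d0 e e0.
  exists (s / r); first by rewrite divr_gt0.
  move=> h; rewrite ltr_pdivlMr// add0r => hh.
  rewrite /G eqxx; case: ifPn => [_|h0]; first by rewrite subrr nc0 ltW.
  have h00 : r%:C%C * h != 0 by rewrite mulf_neq0.
  have nh : 0 < nc (r%:C%C * h) by rewrite nc_gt0.
  rewrite -(ler_pM2r nh) -ncM mulrBl mulfVK//; apply: hs.
  by rewrite ncM nc_real gtr0_norm// mulrC.
- move=> t _; rewrite /G ifF; last first.
    by apply/negbTE; rewrite -nc_gt0 nc_unitc.
  rewrite ncM ncV ncM nc_unitc mulr1 nc_real gtr0_norm// ler_wpM2r ?invr_ge0 ?(ltW r0)//.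
  rewrite (le_trans (ncB _ _))// mulr_natl mulr2n lerD// FM//.
    by rewrite add0r ncM nc_unitc mulr1 nc_real gtr0_norm.
  by rewrite nc0 ltW.
Qed.

Lemma cder_rder F (t : R) d u : cder F t%:C%C d ->
  rder (fun t : R => complex.Re (u * F t%:C%C)) t (complex.Re (u * d)).
Proof.
move=> hF; have := cderZ u hF => {}hF e e0; have [r r0 hr] := hF e e0.
exists r => // h hh; have := hr h%:C%C; rewrite nc_real => /(_ hh).
apply: le_trans; rewrite -rmorphD/=.
apply: le_trans (nc_Re _); rewrite !(ReD, ReN) [complex.Re (_ * h%:C%C)]ReM /=.
by rewrite mulr0 subr0.
Qed.

Lemma segment_bound F (F' : R -> R[i]) M :
  (forall t : R, 0 <= t <= 1 -> cder F t%:C%C (F' t)) ->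
  (forall t : R, 0 <= t <= 1 -> nc (F' t) <= M) -> nc (F 1 - F 0) <= M.
Proof.
move=> dF FM; have [u u1 <-] := nc_rotate (F 1 - F 0).
rewrite (le_trans (ler_norm _))// mulrBr ReD ReN.
have := @mean_value_bound R (fun t => complex.Re (u * F t%:C%C))
  (fun t => complex.Re (u * F' t)) M; apply => t t01.
  exact/cder_rder/dF.
by rewrite (le_trans (nc_Re _))// ncM u1 mul1r FM.
Qed.

(** For a real function [g] the hypothesis puts every [g t - C * t] below every [g s + C * s], and
    the limit is the supremum of the former. Real and imaginary parts each cost [C * t], whence the
    factor 2. *)
Lemma cauchy_limit (f : R -> R[i]) (C r : R) :
  (forall s t, 0 < s < r -> 0 < t < r -> nc (f s - f t) <= C * (s + t)) -> 0 < r ->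
  exists l, forall t, 0 < t < r -> nc (f t - l) <= 2 * C * t.
Proof.
move=> fC r0.
have H (g : R -> R) : (forall s t, 0 < s < r -> 0 < t < r -> `|g s - g t| <= C * (s + t)) ->
    exists l, forall t, 0 < t < r -> `|g t - l| <= C * t.
  move=> gC; pose A := [set g t - C * t | t in [set t | 0 < t < r]].
  have r2 : 0 < r / 2 < r by apply/andP; split; lra.
  have ubA s : 0 < s < r -> ubound A (g s + C * s).
    move=> hs _ [t ht <-]; have := gC t s ht hs.
    by rewrite ler_norml => /andP[_]; lra.
  have hA : has_sup A.
    by split; [exists (g (r / 2) - C * (r / 2)), (r / 2)|
               exists (g (r / 2) + C * (r / 2)); exact: ubA].
  exists (sup A) => t ht; rewrite ler_norml.
  have k1 : g t - C * t <= sup A by apply: ub_le_sup; [case: hA|exists t].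
  have k2 : sup A <= g t + C * t by apply: ge_sup; [case: hA|exact: ubA].
  by apply/andP; split; lra.
have [|l1 hl1] := H (fun t => complex.Re (f t)).
  by move=> s t hs ht; rewrite -ReN -ReD (le_trans (nc_Re _))// fC.
have [|l2 hl2] := H (fun t => complex.Im (f t)).
  by move=> s t hs ht; rewrite -ImN -ImD (le_trans (nc_Im _))// fC.
exists (l1 +i* l2)%C => t ht.
rewrite (le_trans (nc_le_ReIm _))// !(ReD, ImD, ReN, ImN)/=.
by have := hl1 t ht; have := hl2 t ht; lra.
Qed.

End one_variable.

(** * Holomorphic functions of several variables *)

Section holomorphic_functions.
Variables (R : realType) (n : nat).
Notation E := 'rV[R[i]]_n.
Implicit Types (f g : E -> R[i]) (z w v a y : E) (r M : R) (U : E -> Prop).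

Definition nm z : R := \sum_j nc (z 0 j).

Lemma nm_ge0 z : 0 <= nm z.
Proof. by apply: sumr_ge0 => j _; exact: nc_ge0. Qed.

Lemma nm0 : nm 0 = 0.
Proof. by rewrite /nm big1// => j _; rewrite mxE nc0. Qed.

Lemma nmD z w : nm (z + w) <= nm z + nm w.
Proof.
by rewrite /nm -big_split/=; apply: ler_sum => j _; rewrite mxE ncD.
Qed.

Lemma nmZ (c : R[i]) z : nm (c *: z) = nc c * nm z.
Proof. by rewrite /nm mulr_sumr; apply: eq_bigr => j _; rewrite mxE ncM. Qed.

Lemma nmN z : nm (- z) = nm z.
Proof. by rewrite /nm; apply: eq_bigr => j _; rewrite mxE normcN. Qed.

Lemma nmB z w : nm (z - w) <= nm z + nm w.
Proof. by rewrite -[nm w]nmN nmD. Qed.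

Lemma nm_coord z j : nc (z 0 j) <= nm z.
Proof.
by rewrite /nm (bigD1 j)//= lerDl sumr_ge0// => i _; exact: nc_ge0.
Qed.

Lemma nm_eq0 z : nm z <= 0 -> z = 0.
Proof.
move=> z0; apply/rowP => j; rewrite mxE; apply/eqP; rewrite -nc_le0.
exact: le_trans (nm_coord z j) z0.
Qed.

Lemma nm_convex a r z w (t : R) : nm (z - a) < r -> nm (w - a) < r ->
  0 <= t <= 1 -> nm (z + t%:C%C *: (w - z) - a) < r.
Proof.
move=> zr wr /andP[t0 t1].
rewrite (_ : _ - _ = (1 - t)%:C%C *: (z - a) + t%:C%C *: (w - a)); last first.
  apply/rowP => j; rewrite !mxE rmorphB/= rmorph1; ring.
apply: (le_lt_trans (nmD _ _)); rewrite !nmZ !nc_real.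
rewrite [`|t|]ger0_norm// [`|1 - t|]ger0_norm ?subr_ge0//.
have [->|tn0] := eqVneq t 0; first by rewrite subr0 mul1r mul0r addr0.
have tp : 0 < t by rewrite lt_neqAle eq_sym tn0.
have : t * nm (w - a) < t * r by rewrite ltr_pM2l.
have : (1 - t) * nm (z - a) <= (1 - t) * r.
  by apply: ler_wpM2l (ltW zr); rewrite subr_ge0.
by lra.
Qed.

Definition cline f z w (x : R[i]) := f (z + x *: w).

(** Differentiability along each complex line together with continuity. Linearity of the derivative
    in the direction is not part of the definition; it is proved in [DwD]. *)
Definition hol f U := forall z, U z ->
  (forall w, exists d, cder (cline f z w) 0 d) /\
  (forall e : R, 0 < e -> exists2 r, 0 < r &
     forall h, nm h < r -> nc (f (z + h) - f z) <= e).

Definition uopen U := forall z, U z -> exists2 r, 0 < r &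
  forall h, nm h < r -> U (z + h).

Definition Dw f w z : R[i] := xget 0 [set d | cder (cline f z w) 0 d].

Definition bl a r z := nm (z - a) < r.

Lemma bl_open a r : uopen (bl a r).
Proof.
move=> z zr; exists (r - nm (z - a)); first by rewrite subr_gt0.
move=> h hh; rewrite /bl addrAC (le_lt_trans (nmD _ _))//.
by rewrite -ltrBrDl.
Qed.

Lemma bl_center a r : 0 < r -> bl a r a.
Proof. by rewrite /bl subrr nm0. Qed.

Lemma hol_sub f U W : (forall z, W z -> U z) -> hol f U -> hol f W.
Proof. by move=> WU hf z /WU/hf. Qed.

Lemma cder_Dw f U z w : hol f U -> U z -> cder (cline f z w) 0 (Dw f w z).
Proof.
move=> hf Uz; have [/(_ w)[d hd] _] := hf z Uz.
by rewrite /Dw; case: xgetP => [y -> //|/(_ d)].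
Qed.

Lemma DwE f z w d : cder (cline f z w) 0 d -> Dw f w z = d.
Proof.
move=> hd; apply/(cder_unique _ hd).
by rewrite /Dw; case: xgetP => [y -> //|/(_ d)].
Qed.

Lemma cder_line f z w c d :
  cder (cline f (z + c *: w) w) 0 d -> cder (cline f z w) c d.
Proof.
move=> h; rewrite -[c]addr0; apply: cder_shift; move: h.
by rewrite /cline; under eq_fun do rewrite -addrA -scalerDl.
Qed.

Lemma hol_line f U z w c : hol f U -> U (z + c *: w) ->
  cder (cline f z w) c (Dw f w (z + c *: w)).
Proof. by move=> hf Uz; apply: cder_line; exact: cder_Dw hf Uz. Qed.

Lemma hol_cst (k : R[i]) U : hol (fun=> k) U.
Proof.
move=> z _; split=> [w|e e0]; first by exists 0; exact: cder_cst.
by exists 1 => // h _; rewrite subrr nc0 ltW.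
Qed.

Lemma holD f g U : hol f U -> hol g U -> hol (fun z => f z + g z) U.
Proof.
move=> hf hg z Uz; split=> [w|e e0].
  have [/(_ w)[d hd] _] := hf z Uz; have [/(_ w)[d' hd'] _] := hg z Uz.
  by exists (d + d'); exact: cderD.
have e2 : 0 < e / 2 by rewrite divr_gt0.
have [_ /(_ _ e2)[r r0 hr]] := hf z Uz; have [_ /(_ _ e2)[s s0 hs]] := hg z Uz.
exists (Num.min r s); first by rewrite lt_min r0.
move=> h; rewrite lt_min => /andP[/hr h1 /hs h2].
by rewrite opprD addrACA (splitr e) (le_trans (ncD _ _))// lerD.
Qed.

Lemma holZ (c : R[i]) f U : hol f U -> hol (fun z => c * f z) U.
Proof.
move=> hf z Uz; split=> [w|e e0].
  by have [/(_ w)[d hd] _] := hf z Uz; exists (c * d); exact: cderZ.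
have c0 : 0 < nc c + 1 by rewrite ltr_wpDl ?nc_ge0.
have [_ /(_ _ (divr_gt0 e0 c0))[r r0 hr]] := hf z Uz.
exists r => // h /hr h1; rewrite -mulrBr ncM.
have : nc c * nc (f (z + h) - f z) <= (nc c + 1) * (e / (nc c + 1)).
  by rewrite ler_pM ?nc_ge0// lerDl ler01.
by rewrite mulrCA divff ?mulr1// gt_eqF.
Qed.

Lemma holB f g U : hol f U -> hol g U -> hol (fun z => f z - g z) U.
Proof.
by move=> hf hg; under eq_fun do rewrite -mulN1r; exact/holD/holZ.
Qed.

Lemma hol_translate f U v : hol f U -> hol (fun z => f (z + v)) (fun z => U (z + v)).
Proof.
move=> hf z Uz; have [h1 h2] := hf _ Uz; split => [w|e e0].
  have [d hd] := h1 w; exists d; move: hd; rewrite /cline.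
  by under eq_fun do rewrite addrAC.
have [r r0 hr] := h2 e e0; exists r => // h /hr; by rewrite addrAC.
Qed.

Lemma Dw_translate f U v w z : hol f U -> U (z + v) ->
  Dw (fun z => f (z + v)) w z = Dw f w (z + v).
Proof.
move=> hf Uz; apply: DwE; have := cder_Dw w hf Uz; rewrite /cline.
by under eq_fun do rewrite addrAC.
Qed.

Lemma DwB f g U w z : hol f U -> hol g U -> U z ->
  Dw (fun z => f z - g z) w z = Dw f w z - Dw g w z.
Proof. by move=> hf hg Uz; apply/DwE/cderB; exact: cder_Dw Uz. Qed.

Lemma DwZ f U (c : R[i]) w z : hol f U -> U z -> Dw f (c *: w) z = c * Dw f w z.
Proof.
move=> hf Uz; apply: DwE; have := cder_Dw w hf Uz => h.
have := @cder_affine _ 0 c (cline f z w) 0 (Dw f w z).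
rewrite mulr0 addr0 => /(_ h); rewrite mulrC /cline.
by under eq_fun do rewrite add0r mulrC -scalerA.
Qed.

Lemma Dw0 f U z : hol f U -> U z -> Dw f 0 z = 0.
Proof. by move=> hf Uz; rewrite -(scale0r 0) (DwZ 0 0 hf Uz) mul0r. Qed.

Lemma hol_bounded f U z : uopen U -> hol f U -> U z ->
  exists r, exists2 M, 0 < r /\ 0 <= M &
    forall y, bl z r y -> U y /\ nc (f y) <= M.
Proof.
move=> oU hf Uz; have [r r0 hr] := oU z Uz.
have [_ /(_ _ ltr01)[s s0 hs]] := hf z Uz.
exists (Num.min r s), (nc (f z) + 1).
  by rewrite lt_min r0 s0 addr_ge0 ?nc_ge0.
move=> y; rewrite /bl lt_min => /andP[/hr h1 /hs h2].
rewrite [z + _]addrC subrK in h1; rewrite [z + _]addrC subrK in h2; split => //.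
by rewrite -[f y](subrK (f z)) addrC (le_trans (ncD _ _))// lerD2l.
Qed.

(** Cauchy's estimate in the line through [z] with direction [w], on the disc of radius
    [r / (4 * nm w)]: it stays inside the ball, and dividing [2 * M] by this radius gives the factor
    8. *)
Lemma Dw_bound f a r M : 0 < r -> 0 <= M -> hol f (bl a r) ->
  (forall z, bl a r z -> nc (f z) <= M) ->
  forall z w, nm (z - a) < r / 2 -> nc (Dw f w z) <= 8 * M / r * nm w.
Proof.
move=> r0 M0 hf fM z w zr; have zr' : bl a r z by rewrite /bl; lra.
have [w0|w0] := leP (nm w) 0.
  by rewrite (nm_eq0 w0) (Dw0 hf zr') nc0 nm0 mulr0.
pose s := r / (4 * nm w).
have s0 : 0 < s by rewrite divr_gt0// mulr_gt0.
have sb x : nc x <= s -> bl a r (z + x *: w).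
  rewrite /s ler_pdivlMr ?mulr_gt0// => xs.
  rewrite /bl addrAC (le_lt_trans (nmD _ _))// nmZ.
  by move: xs zr; rewrite mulrCA; have := mulr_ge0 (nc_ge0 x) (nm_ge0 w); lra.
have : nc (Dw f w z) <= 2 * M / s.
  apply: (@cauchy_estimate _ (cline f z w)) => //.
  - by move=> x /sb xr; eexists; exact: hol_line hf xr.
  - by move=> x /sb xr; exact: fM.
  - exact: cder_Dw hf zr'.
by rewrite /s invf_div; congr (_ <= _); field; rewrite !gt_eqF.
Qed.

Lemma hol_lipschitz f a r M : 0 < r -> 0 <= M -> hol f (bl a r) ->
  (forall z, bl a r z -> nc (f z) <= M) ->
  forall z z', nm (z - a) < r / 2 -> nm (z' - a) < r / 2 ->
  nc (f z' - f z) <= 8 * M / r * nm (z' - z).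
Proof.
move=> r0 M0 hf fM z z' zr zr'; have := @segment_bound R (cline f z (z' - z))
  (fun t => Dw f (z' - z) (z + t%:C%C *: (z' - z))) (8 * M / r * nm (z' - z)).
rewrite /cline scale1r scale0r addr0 [z + _]addrC subrK; apply => t t01.
  by apply: hol_line hf _; have := nm_convex zr zr' t01; rewrite /bl; lra.
exact/(Dw_bound r0 M0 hf fM)/nm_convex.
Qed.

(** [Dw_bound] used twice: [f (y + v) - f y] is at most [8 * M / r * nm v], and the derivative of
    this difference is estimated on a ball of radius [r / 4]. *)
Definition qc M r : R := 8 * (8 * M / r) / (r / 4).

Lemma qc_ge0 M r : 0 < r -> 0 <= M -> 0 <= qc M r.
Proof.
move=> r0 M0; apply: divr_ge0; last by rewrite divr_ge0// ltW.
by apply: mulr_ge0 => //; apply: divr_ge0; [exact: mulr_ge0|exact: ltW].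
Qed.

Lemma Dw_lipschitz f a r M : 0 < r -> 0 <= M -> hol f (bl a r) ->
  (forall z, bl a r z -> nc (f z) <= M) ->
  forall z z' w, nm (z - a) < r / 8 -> nm (z' - a) < r / 8 ->
  nc (Dw f w z' - Dw f w z) <= qc M r * nm w * nm (z' - z).
Proof.
move=> r0 M0 hf fM z z' w zr zr'.
pose v := z' - z; pose g y := f (y + v) - f y.
have vr : nm v < r / 4.
  rewrite (_ : v = (z' - a) - (z - a)); last by rewrite /v opprB addrA subrK.
  by rewrite (le_lt_trans (nmB _ _))//; lra.
have r4 : 0 < r / 4 by rewrite divr_gt0.
have bv y : bl a (r / 4) y -> nm (y - a) < r / 2 /\ nm (y + v - a) < r / 2.
  rewrite /bl => yr; split; first by lra.
  by rewrite addrAC (le_lt_trans (nmD _ _))//; lra.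
have b1 y : bl a (r / 4) y -> bl a r y by rewrite /bl; lra.
have b2 y : bl a (r / 4) y -> bl a r (y + v) by move=> /bv[_]; rewrite /bl; lra.
have h1 : hol (fun y => f (y + v)) (bl a (r / 4)).
  exact: (@hol_sub _ (fun y => bl a r (y + v)) _ b2 (@hol_translate f _ v hf)).
have h2 := hol_sub b1 hf.
have K0 : 0 <= 8 * M / r * nm v by rewrite mulr_ge0 ?nm_ge0// divr_ge0 ?(ltW r0)// mulr_ge0.
have gM y : bl a (r / 4) y -> nc (g y) <= 8 * M / r * nm v.
  move=> /bv[k1 k2]; have := hol_lipschitz r0 M0 hf fM k1 k2.
  by have -> : y + v - y = v by rewrite addrC addKr.
have zb : bl a (r / 4) z by rewrite /bl; lra.
have := @Dw_bound g a (r / 4) _ r4 K0 (holB h1 h2) gM z w.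
rewrite (DwB _ h1 h2)// (Dw_translate w hf) ?b2//.
have -> : z + v = z' by rewrite /v addrC subrK.
move=> /(_ _)/le_trans; apply; first by lra.
by rewrite le_eqVlt /qc; apply/orP; left; apply/eqP; ring.
Qed.

Lemma hol_taylor1 f a r M : 0 < r -> 0 <= M -> hol f (bl a r) ->
  (forall z, bl a r z -> nc (f z) <= M) ->
  forall z v, nm (z - a) < r / 8 -> nm (z + v - a) < r / 8 ->
  nc (f (z + v) - f z - Dw f v z) <= qc M r * nm v ^+ 2.
Proof.
move=> r0 M0 hf fM z v zr zr'.
have cv t : 0 <= t <= 1 -> nm (z + t%:C%C *: v - a) < r / 8.
  by move=> t01; have := nm_convex zr zr' t01; rewrite [z + v]addrC addrK.
have := @segment_bound R (fun x => cline f z v x - Dw f v z * x)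
  (fun t => Dw f v (z + t%:C%C *: v) - Dw f v z * 1) (qc M r * nm v ^+ 2).
rewrite mulr1 mulr0 /cline scale1r scale0r addr0 subr0 addrAC; apply => t t01.
  apply: cderB; last first.
    by have := @cderZ _ (Dw f v z) id _ 1 (@cder_id _ t%:C%C); rewrite mulr1.
  by apply: hol_line hf _; have := cv t t01; rewrite /bl; lra.
rewrite (le_trans (Dw_lipschitz r0 M0 hf fM v zr (cv t t01)))//.
rewrite addrC addKr nmZ nc_real [nm v ^+ 2]expr2 mulrA ler_wpM2l//.
  by rewrite mulr_ge0 ?nm_ge0 ?qc_ge0.
case/andP: t01 => t0 t1; rewrite ger0_norm//.
by rewrite ler_piMl ?nm_ge0.
Qed.

(** The path from [z] to [z + h *: (w + w')] is split at [z + h *: w]. Each leg has a quadratic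
    Taylor error, and moving the second derivative back to [z] costs one more quadratic term: hence
    the factor 3. *)
Lemma DwD f U w w' z : uopen U -> hol f U -> U z ->
  Dw f (w + w') z = Dw f w z + Dw f w' z.
Proof.
move=> oU hf Uz; have [r [M [r0 M0] hM]] := hol_bounded oU hf Uz.
have hfr : hol f (bl z r) by apply: hol_sub hf => y /hM[].
have fM y : bl z r y -> nc (f y) <= M by move=> /hM[].
have zz : nm (z - z) < r / 8 by rewrite subrr nm0 divr_gt0.
pose K := qc M r.
have K0 : 0 <= K by exact: qc_ge0.
pose W := nm w + nm w' + 1.
have W0 : 0 < W by rewrite ltr_wpDl// addr_ge0 ?nm_ge0.
have r8 : r / 8 < r by rewrite ltr_pdivrMr// ltr_pMr// ltr1n.
apply: DwE; apply: (@cder_quad _ _ _ _ (3 * K * W ^+ 2) (r / 8 / W)).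
  by rewrite !divr_gt0.
move=> h; rewrite ltr_pdivlMr// => hh; rewrite add0r /cline scale0r addr0.
have nh := nc_ge0 h.
have small v : nm v <= W -> nm (z + h *: v - z) < r / 8.
  move=> vW; rewrite addrC addKr nmZ (le_lt_trans _ hh)//.
  by rewrite ler_wpM2l.
have w1 : nm w <= W by rewrite /W -addrA lerDl addr_ge0 ?nm_ge0 ?ler01.
have w2 : nm w' <= W.
  by rewrite /W addrAC lerDr addr_ge0 ?nm_ge0 ?ler01.
have w3 : nm (w + w') <= W by rewrite (le_trans (nmD _ _))// /W lerDl ler01.
have k1 := hol_taylor1 r0 M0 hfr fM zz (small w w1).
have k3 := small _ w3; rewrite scalerDr addrA in k3.
have k2 := hol_taylor1 r0 M0 hfr fM (small w w1) k3.
have k4 := Dw_lipschitz r0 M0 hfr fM w' zz (small w w1).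
have zb : bl z r z by exact: bl_center.
have zb' : bl z r (z + h *: w) := lt_trans (small w w1) r8.
rewrite (DwZ _ _ hfr zb) in k1; rewrite (DwZ _ _ hfr zb') in k2.
rewrite scalerDr addrA (_ : _ - _ =
  (f (z + h *: w + h *: w') - f (z + h *: w) - h * Dw f w' (z + h *: w)) +
  (f (z + h *: w) - f z - h * Dw f w z) +
  h * (Dw f w' (z + h *: w) - Dw f w' z)); last by ring.
rewrite (le_trans (ncD _ _))// (le_trans (lerD (ncD _ _) (lexx _)))//.
rewrite (_ : 3 * K * _ * _ = (K * W ^+ 2 * nc h ^+ 2 + K * W ^+ 2 * nc h ^+ 2)
  + K * W ^+ 2 * nc h ^+ 2); last by ring.
have sq v : nm v <= W -> nm v ^+ 2 <= W ^+ 2.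
  by move=> vW; rewrite lerXn2r ?nnegrE ?nm_ge0// ltW.
rewrite lerD//.
  rewrite lerD//.
    apply: (le_trans k2); rewrite -/K nmZ exprMn -mulrA ler_wpM2l// mulrC.
    by rewrite ler_wpM2r ?exprn_ge0// sq.
  apply: (le_trans k1); rewrite -/K nmZ exprMn -mulrA ler_wpM2l// mulrC.
  by rewrite ler_wpM2r ?exprn_ge0// sq.
rewrite ncM; apply: (le_trans (ler_wpM2l nh k4)).
rewrite addrC addKr nmZ -/K.
rewrite (_ : nc h * (K * nm w' * (nc h * nm w)) = K * (nm w' * nm w) * nc h ^+ 2); last by ring.
rewrite ler_wpM2r ?exprn_ge0// ler_wpM2l// expr2 ler_pM ?nm_ge0//.
Qed.

Lemma hol_Dw f U w : uopen U -> hol f U -> hol (Dw f w) U.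
Proof.
move=> oU hf a Ua; have [r [M [r0 M0] hM]] := hol_bounded oU hf Ua.
have hfr : hol f (bl a r) by apply: hol_sub hf => y /hM[].
have fM y : bl a r y -> nc (f y) <= M by move=> /hM[].
have aa : nm (a - a) < r / 8 by rewrite subrr nm0 divr_gt0.
pose K := qc M r.
have K0 : 0 <= K by exact: qc_ge0.
split; last first.
  move=> e e0; pose k := K * nm w + 1.
  have k0 : 0 < k by rewrite ltr_wpDl// mulr_ge0 ?nm_ge0.
  exists (Num.min (r / 8) (e / k)); first by rewrite lt_min !divr_gt0.
  move=> h; rewrite lt_min => /andP[h1 h2].
  have h3 : nm (a + h - a) < r / 8 by rewrite addrC addKr.
  rewrite (le_trans (Dw_lipschitz r0 M0 hfr fM w aa h3))// addrC addKr -/K.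
  rewrite ltr_pdivlMr// in h2; apply: le_trans (ltW h2).
  by rewrite mulrC ler_wpM2l ?nm_ge0// /k lerDl ler01.
move=> w'.
(* Difference quotients of [f] along [w] converge uniformly to [Dw f w], at
   linear speed, hence so do their derivatives by the Cauchy estimates. *)
have subrBB (x3 x1 x2 : R[i]) : (x1 - x3) - (x2 - x3) = x1 - x2 by ring.
pose g (t : R) y := (t%:C%C)^-1 * (f (y + t%:C%C *: w) - f y).
pose W := nm w + 1.
have W0 : 0 < W by rewrite ltr_wpDl ?nm_ge0.
pose s := r / 16.
have s0 : 0 < s by rewrite divr_gt0.
pose q := r / 16 / W.
have q0 : 0 < q by rewrite divr_gt0// divr_gt0.
have tw t : 0 < t < q -> nm (t%:C%C *: w) < r / 16.
  move=> /andP[t0]; rewrite /q ltr_pdivlMr// nmZ nc_real gtr0_norm//.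
  by apply: le_lt_trans; rewrite ler_wpM2l ?(ltW t0)// lerDl ler01.
have b1 y : bl a s y -> nm (y - a) < r / 8 by rewrite /bl /s; lra.
have b2 t y : 0 < t < q -> bl a s y -> nm (y + t%:C%C *: w - a) < r / 8.
  move=> /tw ht; rewrite /bl /s => hy.
  by rewrite addrAC (le_lt_trans (nmD _ _))//; lra.
have b3 y : nm (y - a) < r / 8 -> bl a r y by rewrite /bl; lra.
have gh1 t : 0 < t < q -> hol (fun y => f (y + t%:C%C *: w)) (bl a s).
  move=> ht; apply: hol_sub (@hol_translate f _ (t%:C%C *: w) hfr) => y hy.
  exact/b3/b2.
have fh : hol f (bl a s) by apply: hol_sub hfr => y /b1/b3.
have gh t : 0 < t < q -> hol (g t) (bl a s).
  by move=> ht; apply/holZ/holB => //; exact: gh1.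
have gD t y : 0 < t < q -> bl a s y ->
    nc (g t y - Dw f w y) <= K * nm w ^+ 2 * t.
  move=> ht hy; have t0 : 0 < t by case/andP: ht.
  have tC : t%:C%C != 0 by rewrite -nc_gt0 nc_real gtr0_norm.
  rewrite -(ler_pM2l t0) -{1}[t]gtr0_norm// -nc_real -ncM mulrBr.
  rewrite /g mulrA divff// mul1r.
  have := hol_taylor1 r0 M0 hfr fM (b1 y hy) (b2 t y ht hy).
  rewrite (DwZ _ _ hfr); last exact/b3/b1.
  move=> /le_trans; apply; rewrite nmZ nc_real gtr0_norm// -/K.
  by rewrite le_eqVlt; apply/orP; left; apply/eqP; ring.
pose C := K * nm w ^+ 2.
have C0 : 0 <= C by rewrite mulr_ge0// exprn_ge0// nm_ge0.
have gg t t' y : 0 < t < q -> 0 < t' < q -> bl a s y ->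
    nc (g t y - g t' y) <= C * (t + t').
  move=> ht ht' hy; rewrite -(subrBB (Dw f w y)).
  by rewrite (le_trans (ncB _ _))// mulrDr lerD// gD.
have Ct t t' : 0 < t < q -> 0 < t' < q -> 0 <= C * (t + t').
  by move=> /andP[t0 _] /andP[t'0 _]; rewrite mulr_ge0// addr_ge0// ltW.
have sa : bl a s a by exact: bl_center.
have as2 : nm (a - a) < s / 2 by rewrite subrr nm0 divr_gt0.
have s8 : 0 <= 8 / s by exact: divr_ge0 (ler0n _ 8) (ltW s0).
pose k := 8 / s * nm w'.
have k0 : 0 <= k by exact: mulr_ge0 s8 (nm_ge0 w').
have [|l hl] := @cauchy_limit R (fun t => Dw (g t) w' a) (C * k) q _ q0.
  move=> t t' ht ht'; rewrite -(DwB _ (gh t ht) (gh t' ht'))//.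
  have := @Dw_bound _ a s _ s0 (Ct t t' ht ht') (holB (gh t ht) (gh t' ht')) _ a w' as2.
  move=> /(_ (fun y hy => gg t t' y ht ht' hy))/le_trans; apply.
  by rewrite le_eqVlt /k; apply/orP; left; apply/eqP; ring.
(* [g t - g t'] is Lipschitz with a constant of order [t + t']. Letting [t'] tend to 0 gives the
   same for [g t - Dw f w], although [Dw f w] is not yet known to be holomorphic. *)
have lip t y : 0 < t < q -> nm (y - a) < s / 2 ->
    nc ((g t y - Dw f w y) - (g t a - Dw f w a)) <= C * t * (8 / s * nm (y - a)).
  move=> ht hy; apply/ler_addgt0Pr => e e0.
  pose B := C * (8 / s * nm (y - a)) + 2 * C + 1.
  have B0 : 0 < B.
    apply: ltr_wpDl => //; apply: addr_ge0; last exact: mulr_ge0.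
    by apply: mulr_ge0 => //; apply: mulr_ge0 => //; exact: nm_ge0.
  pose t' := Num.min (q / 2) (e / B).
  have t'0 : 0 < t' by rewrite lt_min !divr_gt0.
  have t'q : t' < q by rewrite gt_min; apply/orP; left; lra.
  have ht' : 0 < t' < q by rewrite t'0.
  have hy' : bl a s y by rewrite /bl; lra.
  have k1 := @hol_lipschitz _ a s _ s0 (Ct t t' ht ht') (holB (gh t ht) (gh t' ht'))
    (fun y hy => gg t t' y ht ht' hy) a y as2 hy.
  rewrite /= in k1.
  have k2 := gD t' y ht' hy'; have k3 := gD t' a ht' sa.
  have split4 (x1 x2 x3 x4 x5 x6 : R[i]) : (x1 - x2) - (x3 - x4) =
      ((x1 - x5) - (x3 - x6)) + ((x5 - x2) - (x6 - x4)) by ring.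
  rewrite (split4 _ _ _ _ (g t' y) (g t' a)).
  rewrite (le_trans (ncD _ _))// (le_trans (lerD k1 (ncB _ _)))//.
  apply: (le_trans (lerD (lexx _) (lerD k2 k3))).
  have : t' * B <= e by rewrite -ler_pdivlMr// ge_min lexx orbT.
  by rewrite /B -/C; lra.
exists l => e e0.
pose A := C * (8 / s * nm w') + 2 * (C * k) + 1.
have A0 : 0 < A.
  apply: ltr_wpDl => //; apply: addr_ge0; last by apply: mulr_ge0 => //; exact: mulr_ge0.
  by apply: mulr_ge0 => //; apply: mulr_ge0 => //; exact: nm_ge0.
pose t := Num.min (q / 2) (e / 2 / A).
have t0 : 0 < t by rewrite lt_min !divr_gt0.
have tq : t < q by rewrite gt_min; apply/orP; left; lra.
have ht : 0 < t < q by rewrite t0.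
have tA : t * A <= e / 2 by rewrite -ler_pdivlMr// ge_min lexx orbT.
have [r1 r10 hr1] := cder_Dw w' (gh t ht) sa (divr_gt0 e0 (ltr0Sn R 1)).
have W'0 : 0 < nm w' + 1 by rewrite ltr_wpDl ?nm_ge0.
exists (Num.min r1 (s / 2 / (nm w' + 1))); first by rewrite lt_min r10 !divr_gt0.
move=> h; rewrite lt_min => /andP[h1 h2].
have nh := nc_ge0 h.
have hw : nm (a + h *: w' - a) < s / 2.
  rewrite addrC addKr nmZ; rewrite ltr_pdivlMr// in h2; apply: le_lt_trans h2.
  by rewrite ler_wpM2l// lerDl ler01.
have k1 := hr1 h h1; have k2 := lip t _ ht hw; have k3 := hl t ht.
rewrite add0r /cline scale0r addr0 in k1 *.
rewrite (_ : _ - _ = (g t (a + h *: w') - g t a - Dw (g t) w' a * h) -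
  ((g t (a + h *: w') - Dw f w (a + h *: w')) - (g t a - Dw f w a)) +
  (Dw (g t) w' a - l) * h); last by ring.
rewrite (le_trans (ncD _ _))// (le_trans (lerD (ncB _ _) (lexx _)))//.
rewrite ncM; apply: (le_trans (lerD (lerD k1 k2) (ler_wpM2r nh k3))).
have -> : a + h *: w' - a = h *: w' by rewrite addrC addKr.
rewrite nmZ; have : t * A * nc h <= e / 2 * nc h by rewrite ler_wpM2r.
have : 0 <= t * nc h by rewrite mulr_ge0// ltW.
by rewrite /A; lra.
Qed.

End holomorphic_functions.

(** * The topology of C^n in terms of [nm] *)

Section topology_bridge.
Variables (R : realType) (n : nat).
Notation E := 'rV[R[i]]_n.
Implicit Types (z w : E) (A : set E).

Lemma complex_gt0 (e : R[i]) : 0 < e -> e = (complex.Re e)%:C%C /\ 0 < complex.Re e.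
Proof.
rewrite ltcE /= => /andP[/eqP i0 r0]; split => //.
by apply/eqP; rewrite eq_complex /= i0 !eqxx.
Qed.

Lemma norm_nc (x : R[i]) : `|x| = (nc x)%:C%C.
Proof. by rewrite normc_def ncE. Qed.

(** The radii of balls are complex numbers, and positivity forces them to be real. Dividing by
    [n.+1] rather than [n] makes the comparison strict and covers [n = 0]. *)
Lemma nbhs_nm z A : nbhs z A <->
  exists2 r : R, 0 < r & forall h, nm h < r -> A (z + h).
Proof.
split.
- move=> /nbhs_ballP[e /= ep eA]; have [ee e0] := complex_gt0 ep.
  exists (complex.Re e) => // h hh; apply: eA; split=> [//|i j].
  rewrite !mxE (ord1 i) ee /ball /= opprD addNKr normrN norm_nc ltcR.
  exact: le_lt_trans (nm_coord h j) hh.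
- move=> [r r0 rA]; apply/nbhs_ballP.
  have n0 : 0 < n.+1%:R :> R by rewrite ltr0n.
  exists ((r / n.+1%:R)%:C%C) => /=; first by rewrite ltcR divr_gt0.
  move=> w zw; rewrite -(subrK z w) addrC; apply: rA.
  apply: (@le_lt_trans _ _ (\sum_(j < n) r / n.+1%:R)).
    apply: ler_sum => j _; have := (proj2 zw) 0 j; rewrite /ball/= !mxE distrC norm_nc ltcR.
    exact: ltW.
  rewrite sumr_const card_ord -[_ *+ n]mulr_natr mulrAC ltr_pdivrMr// ltr_pM2l// ltr_nat.
  exact: ltnSn.
Qed.

Lemma continuous_nm (f : E -> R) z : {for z, continuous f} <->
  (forall e : R, 0 < e -> exists2 r : R, 0 < r &
     forall h, nm h < r -> `|f (z + h) - f z| <= e).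
Proof.
split.
- move=> cf e e0; have : nbhs (f z) [set y | `|y - f z| <= e].
    by apply/nbhs_ballP; exists e => //= y; rewrite /ball/= distrC => /ltW.
  by move=> /cf /nbhs_nm[r r0 hr]; exists r.
- move=> cf A /nbhs_ballP[e /= e0 eA].
  have [r r0 hr] := cf (e / 2) (divr_gt0 e0 (ltr0Sn R 1)).
  apply/nbhs_nm; exists r => // h /hr hh; apply: eA.
  by rewrite /ball/= distrC (le_lt_trans hh)// ltr_pdivrMr// ltr_pMr// ltr1n.
Qed.

Lemma nbhs_nc (x : R[i]) (A : set R[i]) : nbhs (x : R[i]^o) A <->
  exists2 r : R, 0 < r & forall h, nc h < r -> A (x + h).
Proof.
split.
- move=> /nbhs_ballP[e /= /complex_gt0[ee e0] eA].
  exists (complex.Re e) => // h hh; apply: eA.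
  by rewrite ee /ball /= opprD addNKr normrN norm_nc ltcR.
- move=> [r r0 rA]; apply/nbhs_ballP.
  exists (r%:C%C) => /=; first by rewrite ltcR.
  by move=> w zw; rewrite -(subrK x w) addrC; apply: rA; move: zw;
    rewrite /ball/= distrC norm_nc ltcR.
Qed.

End topology_bridge.

Section differentiable_holomorphic.
Variables (R : realType) (n : nat).
Notation E := 'rV[R[i]]_n.
Implicit Types (z w : E) (A : set E).

Lemma derivable_cder (f : E -> R[i]) z w :
  derivable (f : E -> R[i]^o) z w -> exists d, cder (cline f z w) 0 d.
Proof.
move=> /cvg_ex[/= l hl]; exists l => e e0.
have ball_e : nbhs (l : R[i]^o) [set y | nc (y - l) < e].
  by apply/nbhs_nc; exists e => // h; rewrite /= addrC addKr.
have H : nbhs (0 : R[i]^o) [set h : R[i] | h != 0 ->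
    nc (h^-1 * (f (h *: w + z) - f z) - l) < e] := hl _ ball_e.
have /nbhs_nc[r r0 hr] := H; exists r => // h hh.
rewrite /cline add0r scale0r addr0.
have [->|h0] := eqVneq h 0.
  by rewrite scale0r addr0 subrr mulr0 subr0 nc0 mulr0.
have hn : 0 < nc h by rewrite nc_gt0.
have := hr h hh; rewrite /= add0r => /(_ h0) hle.
rewrite (_ : _ - _ = (h^-1 * (f (h *: w + z) - f z) - l) * h).
  by rewrite ncM ler_wpM2r ?nc_ge0// ltW.
by rewrite [h *: w + z]addrC mulrBl mulrAC mulVf// mul1r.
Qed.

Lemma derivable_coord m (f : E -> 'rV[R[i]]_m) z w j :
  derivable f z w -> derivable ((fun y => f y 0 j) : E -> R[i]^o) z w.
Proof.
move=> /cvg_ex[/= l hl]; apply/cvg_ex; exists (l 0 j) => A.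
move=> /nbhs_nc[r r0 rA].
have : nbhs l [set y : 'rV[R[i]]_m | A (y 0 j)].
  apply/nbhs_nm; exists r => // h hh; rewrite /= mxE; apply: rA.
  exact: le_lt_trans (nm_coord h j) hh.
move=> /hl; rewrite !nbhs_simpl/=; apply: filterS => x /=.
by rewrite !mxE.
Qed.

Lemma differentiable_coord_hol m (f : E -> 'rV[R[i]]_m) (U : E -> Prop) j :
  (forall z, U z -> differentiable f z) -> hol (fun y => f y 0 j) U.
Proof.
move=> df z /df dfz; split.
  by move=> w; apply: derivable_cder; apply: derivable_coord; exact: diff_derivable.
move=> e e0.
have N : nbhs (f z) [set y | nc (y 0 j - f z 0 j) <= e].
  apply/nbhs_nm; exists e => // h hh.
  rewrite /=; have -> : (f z + h) 0 j - f z 0 j = h 0 j by rewrite mxE addrC addKr.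
  exact: le_trans (nm_coord h j) (ltW hh).
have N' : nbhs z [set y | nc (f y 0 j - f z 0 j) <= e] := differentiable_continuous dfz N.
by have /nbhs_nm[r r0 hr] := N'; exists r.
Qed.

Lemma differentiable_hol (f : E -> R[i]) (U : E -> Prop) :
  (forall z, U z -> differentiable (f : E -> R[i]^o) z) -> hol f U.
Proof.
move=> df z /df dfz; split.
  by move=> w; apply: derivable_cder; exact: diff_derivable.
move=> e e0.
have : nbhs (f z : R[i]^o) [set y | nc (y - f z) < e].
  by apply/nbhs_nc; exists e => // h; rewrite /= addrC addKr.
move=> /(differentiable_continuous dfz); rewrite nbhs_simpl/= => /nbhs_nm[r r0 hr].
by exists r => // h /hr/ltW.
Qed.

End differentiable_holomorphic.

(** * Smoothness of real expressions in holomorphic functions *)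

Section smooth_functions.
Variables (R : realType) (n : nat).
Notation E := 'rV[R[i]]_n.
Implicit Types (z w : E) (U : set E).

Lemma rder_congr (f g : R -> R) x d (r : R) : 0 < r ->
  (forall h, `|h| < r -> f (x + h) = g (x + h)) -> rder f x d -> rder g x d.
Proof.
move=> r0 fg hf e e0; have [s s0 hs] := hf e e0.
exists (Num.min r s); first by rewrite lt_min r0.
move=> h; rewrite lt_min => /andP[h1 /hs]; rewrite fg//.
by have := fg 0; rewrite normr0 addr0 => ->.
Qed.

Lemma rderD (f g : R -> R) x d d' : rder f x d -> rder g x d' ->
  rder (fun t => f t + g t) x (d + d').
Proof.
move=> hf hg e e0; have e2 : 0 < e / 2 by rewrite divr_gt0.
have [r r0 hr] := hf _ e2; have [s s0 hs] := hg _ e2.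
exists (Num.min r s); first by rewrite lt_min r0 s0.
move=> h; rewrite lt_min => /andP[/hr h1 /hs h2].
rewrite (_ : _ - _ = (f (x + h) - f x - d * h) + (g (x + h) - g x - d' * h)); last by ring.
by rewrite (splitr e) mulrDl (le_trans (ler_normD _ _))// lerD.
Qed.

Lemma rderM (f g : R -> R) x d d' : rder f x d -> rder g x d' ->
  rder (fun t => f t * g t) x (d * g x + f x * d').
Proof.
move=> /rder_is_derive hf /rder_is_derive hg; apply: is_derive_rder.
rewrite addrC [d * _]mulrC.
exact: (@is_deriveM R R f g x 1 d d' hf hg).
Qed.

Lemma rder_sum (I : Type) (r : seq I) (f : I -> R -> R) (d : I -> R) x :
  (forall i, rder (f i) x (d i)) ->
  rder (fun t => \sum_(i <- r) f i t) x (\sum_(i <- r) d i).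
Proof.
move=> fd; elim: r => [|i r ih].
  rewrite big_nil; under eq_fun do rewrite big_nil.
  by move=> e e0; exists 1 => // h _; rewrite subrr mul0r subr0 normr0 mulr_ge0// ltW.
rewrite big_cons; under eq_fun do rewrite big_cons.
exact: (@rderD (f i) (fun t => \sum_(j <- r) f j t) _ _ _ (fd i) ih).
Qed.

Lemma Re_hol_continuous (F : E -> R[i]) U z : hol F U -> U z ->
  {for z, continuous (fun y => complex.Re (F y))}.
Proof.
move=> hF Uz; apply/continuous_nm => e e0; have [_ /(_ e e0)[r r0 hr]] := hF z Uz.
exists r => // h /hr; apply: le_trans.
by rewrite -ReN -ReD nc_Re.
Qed.

Lemma continuous_ext (f g : E -> R) z : f =1 g ->
  {for z, continuous f} -> {for z, continuous g}.
Proof. by move=> /funext ->. Qed.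

Lemma continuous_sum (I : Type) (r : seq I) (f : I -> E -> R) z :
  (forall i, {for z, continuous (f i)}) ->
  {for z, continuous (fun y => \sum_(i <- r) f i y)}.
Proof.
move=> cf; elim: r => [|i r ih].
  apply: (@continuous_ext (fun=> 0)) => [y|]; first by rewrite big_nil.
  exact: cst_continuous.
apply: (@continuous_ext (fun y => f i y + \sum_(j <- r) f j y)) => [y|].
  by rewrite big_cons.
by apply: continuousD => //; exact: cf.
Qed.

Lemma continuous_congr U (f g : E -> R) z : uopen U -> U z ->
  (forall y, U y -> f y = g y) ->
  {for z, continuous f} -> {for z, continuous g}.
Proof.
move=> oU Uz fg /continuous_nm cf; apply/continuous_nm => e e0.
have [r r0 hr] := cf e e0; have [s s0 hs] := oU z Uz.
exists (Num.min r s); first by rewrite lt_min r0.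
by move=> h; rewrite lt_min => /andP[/hr h1 /hs h2]; rewrite -!fg.
Qed.

Lemma Re_hol_rder (F : E -> R[i]) U z w : hol F U -> U z ->
  rder (fun t : R => complex.Re (F (z + t%:C%C *: w))) 0 (complex.Re (Dw F w z)).
Proof.
move=> hF Uz; have := @cder_rder R (cline F z w) 0 (Dw F w z) 1 (cder_Dw w hF Uz).
by rewrite mul1r; under eq_fun do rewrite mul1r.
Qed.

(* The real-bilinear expressions in real parts of holomorphic functions form a
   class that is stable under directional derivatives. *)
Lemma Ck_on_bilinear k U (I : finType) (F G : I -> E -> R[i]) (v : E -> R) :
  uopen U -> (forall i, hol (F i) U) -> (forall i, hol (G i) U) ->
  (forall z, U z -> v z = \sum_i complex.Re (F i z) * complex.Re (G i z)) ->
  Ck_on k U v.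
Proof.
move=> oU; elim: k I F G v => [|k ih] I F G v hF hG hv.
  split => // z Uz; apply: (@continuous_congr _ _ v z oU Uz (fun y Uy => esym (hv y Uy))).
  by apply: continuous_sum => i; apply: continuousM; exact: Re_hol_continuous Uz.
split => [z Uz|w].
  apply: (@continuous_congr _ _ v z oU Uz (fun y Uy => esym (hv y Uy))).
  by apply: continuous_sum => i; apply: continuousM; exact: Re_hol_continuous Uz.
pose dv z := \sum_i (complex.Re (Dw (F i) w z) * complex.Re (G i z) +
                     complex.Re (F i z) * complex.Re (Dw (G i) w z)).
have vd z : U z -> is_derive (0 : R) (1 : R) (fun t : R => v (z + t%:C%C *: w)) (dv z).
  move=> Uz; apply: rder_is_derive.
  have [r r0 hr] := oU z Uz.
  have W0 : 0 < nm w + 1 by rewrite ltr_wpDl ?nm_ge0.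
  apply: (@rder_congr (fun t => \sum_i complex.Re (F i (z + t%:C%C *: w)) *
            complex.Re (G i (z + t%:C%C *: w))) _ _ _ (r / (nm w + 1))).
  - by rewrite divr_gt0.
  - move=> h; rewrite add0r ltr_pdivlMr// => hh; rewrite hv//; apply: hr.
    rewrite nmZ nc_real (le_lt_trans _ hh)// ler_wpM2l// lerDl.
    exact: ler01.
  - apply: rder_sum => i.
    have := rderM (Re_hol_rder w (hF i) Uz) (Re_hol_rder w (hG i) Uz).
    by rewrite !scale0r !addr0.
split=> [z Uz|]; first by case: (vd z Uz).
pose F' (i : I + I) := match i with inl i => Dw (F i) w | inr i => F i end.
pose G' (i : I + I) := match i with inl i => G i | inr i => Dw (G i) w end.
apply: (ih _ F' G') => [[]i|[]i|z Uz] //=; try exact: hol_Dw.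
rewrite derive1E (@derive_val _ _ _ _ _ _ _ (vd z Uz)).
by rewrite /dv big_split big_sumType.
Qed.

End smooth_functions.

(** * The singular plurisubharmonic model *)

Section submean.
Variable R : realType.
Notation mu := (@lebesgue_measure R).
Notation T := (pi *+ 2 : R).

Lemma twopi_gt0 : 0 < T.
Proof. by rewrite pmulrn_lgt0// pi_gt0. Qed.

Lemma integral_rcont (f : R -> R) : rcont 0 T f ->
  (\int[mu]_(t in `[0%R, T]) (f t)%:E)%E = (Int 0 T f)%:E.
Proof.
move=> /rcont_integrable fi; rewrite /Int /Rintegral fineK//.
by have := integrable_fin_num _ fi; apply.
Qed.

Lemma measurable_rcont (f : R -> R) : rcont 0 T f ->
  measurable_fun `[0, T]%classic (EFin \o f).
Proof. by move=> /rcont_integrable/integrableP[]. Qed.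

(* A decreasing limit [w_k] of continuous functions whose integrals are bounded
   below minorizes [u]; the measurable function [u] need not be integrable
   a priori. *)
Lemma integral_ge_limit (u : R -> \bar R) (w : nat -> R -> R) (B c : R) :
  measurable_fun `[0, T]%classic u ->
  (forall t, 0 <= t <= T -> (u t <= B%:E)%E) ->
  (forall k, rcont 0 T (w k)) ->
  (forall k t, 0 <= t <= T -> w k.+1 t <= w k t) ->
  (forall k, c <= Int 0 T (w k)) ->
  (forall t (a : R), 0 <= t <= T -> (u t < a%:E)%E -> exists k, w k t <= a) ->
  (c%:E <= \int[mu]_(t in `[0%R, T]) u t)%E.
Proof.
move=> mu_ uB cw wS cle uw.
have D t : (`[0, T]%classic : set R) t -> 0 <= t <= T by rewrite /= in_itv.
have wm t i j : 0 <= t <= T -> (i <= j)%N -> w j t <= w i t.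
  move=> ht; apply: (@homo_leq _ (w^~ t) (fun x y => y <= x)) => // [x y z h1 h2|k].
    exact: le_trans h2 h1.
  exact: wS.
(* The decreasing sequence becomes a nonnegative increasing one, to which monotone convergence
   applies; the lower bound [c] keeps the limit integrable. *)
pose f k t := (w 0%N t - w k t)%:E.
have cf k : rcont 0 T (fun t => w 0%N t - w k t) by exact: rcontB.
have f0 k t : `[0, T]%classic t -> (0 <= f k t)%E.
  by move=> /D ht; rewrite lee_fin subr_ge0 wm.
have fm t : `[0, T]%classic t -> nondecreasing_seq (f ^~ t).
  by move=> /D ht i j ij; rewrite lee_fin lerD2l lerN2 wm.
pose W t := limn (f ^~ t).
have fW k t : `[0, T]%classic t -> (f k t <= W t)%E.
  move=> ht; rewrite /W (cvg_lim _ (ereal_nondecreasing_cvgn (fm t ht)))//.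
  by apply: ereal_sup_ubound; exists k.
have W0 t : `[0, T]%classic t -> (0 <= W t)%E.
  by move=> ht; rewrite (le_trans (f0 0%N t ht))// fW.
have mW : measurable_fun `[0, T]%classic W.
  apply: (@emeasurable_fun_cvg _ _ _ _ f) => [k|t ht].
    exact: measurable_rcont.
  by apply: ereal_nondecreasing_is_cvgn; exact: fm.
have IW : (\int[mu]_(t in `[0%R, T]) W t <= (Int 0 T (w 0%N) - c)%:E)%E.
  rewrite (@monotone_convergence _ _ _ mu _ _ f)//; last first.
    by move=> k; exact: measurable_rcont.
  apply: lime_le.
    apply: ereal_nondecreasing_is_cvgn => i j ij; apply: ge0_le_integral => //.
    - by move=> t ht; exact: f0.
    - exact: measurable_rcont.
    - exact: measurable_rcont.
    - by move=> t ht; exact: fm.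
  apply: nearW => k; rewrite integral_rcont// lee_fin IntB//.
  by rewrite lerD2l lerN2.
have iW : mu.-integrable `[0, T] W.
  apply/integrableP; split => //; under eq_integral => t ht.
    rewrite gee0_abs; last by apply: W0; exact: set_mem.
    over.
  exact: le_lt_trans IW (ltry _).
have iw := rcont_integrable (cw 0%N).
have wWu t : `[0, T]%classic t -> ((w 0%N t)%:E - W t <= u t)%E.
  move=> ht; rewrite leNgt; apply/negP => h.
  have [x Wx] : exists x, W t = x%:E.
    move: h (W0 t ht); case: (W t) => [x| |] // h _; first by exists x.
    by move: h; rewrite addeC/= ltNge leNye.
  rewrite Wx in h; have [a ua aw] : exists2 a : R, (u t < a%:E)%E & a < w 0%N t - x.
    move: h (uB t (D t ht)); case: (u t) => [y| |] //= h _.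
      exists ((y + (w 0%N t - x)) / 2); move: h; rewrite -EFinD !lte_fin; lra.
    by exists (w 0%N t - x - 1); [rewrite ltNyr|lra].
  have [k hk] := uw t a (D t ht) ua.
  by have := fW k t ht; rewrite Wx lee_fin; lra.
(* [u] lies between the integrable [w 0 - W] and the constant [B], hence is dominated by
   [|w 0| + |B| + W]. *)
have iu : mu.-integrable `[0, T] u.
  have iB : mu.-integrable `[0, T] (fun t => ((fun t : R => `|w 0%N t| + `|B|) t)%:E + W t)%E.
    apply: integrableD => //.
    have := @rcont_integrable _ 0 T (fun t : R => `|w 0%N t| + `|B|); apply.
    apply: rcontD; last exact: rcont_cst.
    by apply: (@rcont_comp _ _ _ (w 0%N) Num.norm) => // x _; exact: norm_continuous.
  apply: (@le_integrable _ (measurableTypeR R) _ mu _ _ u _ mu_ _ iB) => //= t ht.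
  rewrite [leRHS]gee0_abs; last by rewrite adde_ge0 ?W0// lee_fin addr_ge0.
  have := wWu t ht; have := uB t (D t ht); have := W0 t ht.
  case: (W t) => [x| |] //; last by move=> *; rewrite addey// leey.
  case: (u t) => [y| |] //=; rewrite -?EFinD -?EFinB !lee_fin => x0 yB hy.
  have := ler_norm B; have := ler_norm (- w 0%N t); rewrite normrN => h1 h2.
  by rewrite ler_norml; apply/andP; split; have := normr_ge0 B; have := normr_ge0 (w 0%N t); lra.
apply: (@le_trans _ _ (\int[mu]_(t in `[0%R, T]) ((w 0%N t)%:E - W t))%E); last first.
  apply: le_integral => //; first exact: integrableB.
  by move=> t /set_mem ht; exact: wWu.
rewrite integralB// integral_rcont// leeBrDr; last exact: integrable_fin_num.
by apply: (le_trans (leeD2l _ IW)); rewrite -EFinD lee_fin; lra.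
Qed.

End submean.

Section log_submean.
Variable R : realType.
Notation mu := (@lebesgue_measure R).
Notation T := (pi *+ 2 : R).

Lemma rcont_sum (I : Type) (r : seq I) (a b : R) (f : I -> R -> R) :
  (forall i, rcont a b (f i)) -> rcont a b (fun t => \sum_(i <- r) f i t).
Proof.
move=> cf; elim: r => [|i r ih].
  by under eq_fun do rewrite big_nil; exact: rcont_cst.
under eq_fun do rewrite big_cons.
exact: (@rcontD _ _ _ (f i) (fun t => \sum_(j <- r) f j t)).
Qed.

Lemma Int_bigsum (I : Type) (r : seq I) (a b : R) (f : I -> R -> R) : a <= b ->
  (forall i, rcont a b (f i)) ->
  Int a b (fun t => \sum_(i <- r) f i t) = \sum_(i <- r) Int a b (f i).
Proof.
move=> ab cf; elim: r => [|i r ih].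
  rewrite big_nil (@eq_Int _ _ _ _ (fun=> 0)) ?Int_cst ?mul0r// => x _.
  by rewrite big_nil.
rewrite big_cons -ih -IntD//; last exact: rcont_sum.
by apply: eq_Int => x _; rewrite big_cons.
Qed.

Lemma rcontZ (a b k : R) f : rcont a b f -> rcont a b (fun t => k * f t).
Proof.
by move=> cf; apply: (@rcont_comp _ _ _ f ( *%R k)) => // x _; exact: mulrl_continuous.
Qed.

(** Adding [expR (- k)] to each squared modulus gives continuous functions [w k], decreasing in [k],
    to which [jensen_le] applies termwise. The logarithmic minorant is compared with [u] only where
    no [h i] with [0 < lam i] vanishes; elsewhere [w k] tends to [-oo]. *)
Lemma log_submean (I : finType) (h : I -> R[i] -> R[i]) (lam : I -> R) (m B : R)
    (u : R -> \bar R) :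
  (forall i z, nc z <= 1 -> exists d, cder (h i) z d) ->
  (forall i, 0 <= lam i) -> (forall i, 0 < lam i -> h i 0 != 0) ->
  measurable_fun `[0, T]%classic u ->
  (forall t, 0 <= t <= T -> (u t <= B%:E)%E) ->
  (forall t, 0 <= t <= T -> (forall i, 0 < lam i -> h i (unitc t) != 0) ->
     ((\sum_i lam i * ln (nc (h i (unitc t)) ^+ 2) + m)%:E <= u t)%E) ->
  ((\sum_i lam i * ln (nc (h i 0) ^+ 2) + m)%:E <=
    ((2 * pi)^-1)%:E * \int[mu]_(t in `[0%R, (2 * pi)%R]) u t)%E.
Proof.
move=> dh lam0 h0 mu_ uB hu; have T0 := twopi_gt0 R.
pose c i t := nc (h i (unitc t)).
have cc i : rcont 0 T (c i).
  by apply: rcont_unitc => z z1; have [|d hd] := dh i z; [rewrite z1|exact: cder_cont hd].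
pose w (k : nat) t := \sum_i (2 * lam i) * (2^-1 * ln (c i t ^+ 2 + expR (- k%:R))) + m.
have cw1 k i : rcont 0 T (fun t => (2 * lam i) * (2^-1 * ln (c i t ^+ 2 + expR (- k%:R)))).
  by apply: rcontZ; apply: rcont_ln_sqr => //; exact: expR_gt0.
have cw k : rcont 0 T (w k).
  by apply: rcontD; [exact: rcont_sum|exact: rcont_cst].
pose w0 := \sum_i lam i * ln (nc (h i 0) ^+ 2) + m.
have wint k : T * w0 <= Int 0 T (w k).
  rewrite /w IntD ?Int_cst ?(ltW T0)//; last 2 first.
    exact: rcont_sum.
    exact: rcont_cst.
  rewrite subr0 Int_bigsum ?(ltW T0)// mulrDr [m * _]mulrC lerD2r mulr_sumr.
  apply: ler_sum => i _; rewrite IntZ; last by apply: rcont_ln_sqr => //; exact: expR_gt0.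
  have [->|li] := eqVneq (lam i) 0; first by rewrite mulr0 !mul0r mulr0.
  have lp : 0 < lam i by rewrite lt_neqAle eq_sym li lam0.
  have hp : 0 < nc (h i 0) by rewrite nc_gt0 h0.
  rewrite lnXn// (_ : T * _ = 2 * lam i * (T * ln (nc (h i 0)))); last by rewrite mulr2n; ring.
  by rewrite ler_pM2l ?mulr_gt0//; apply: jensen_le; [exact: dh|exact: expR_gt0|exact: h0].
have cpos k i t : 0 < c i t ^+ 2 + expR (- k%:R).
  by rewrite ltr_wpDl ?sqr_ge0// expR_gt0.
have wS k t : 0 <= t <= T -> w k.+1 t <= w k t.
  move=> _; rewrite lerD2r; apply: ler_sum => i _.
  rewrite ler_wpM2l ?mulr_ge0// ler_wpM2l// ler_ln ?posrE ?cpos// lerD2l ler_expR.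
  by rewrite lerN2 ler_nat.
have uw t (a : R) : 0 <= t <= T -> (u t < a%:E)%E -> exists k, w k t <= a.
  move=> ht ua.
  (* If some [h i] of positive weight vanishes, its term is [- k * lam i] and the others are at most
     their values for [k = 0]. Otherwise [w k] exceeds its limit by at most [expR (- k) * S], and
     [expR k] is at least [k]. *)
  have [/existsP[i /andP[li /eqP hi]]|] := boolP [exists i, (0 < lam i) && (h i (unitc t) == 0)].
    pose r := \sum_(j | j != i) (2 * lam j) * (2^-1 * ln (c j t ^+ 2 + 1)) + m.
    have ci : c i t = 0 by rewrite /c hi nc0.
    exists (Num.truncn (Num.max 0 (r - a) / lam i)).+1.
    set k := _.+1.
    have : Num.max 0 (r - a) / lam i < k%:R by exact: truncnS_gt.
    rewrite ltr_pdivrMr// gt_max => /andP[_ hk].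
    rewrite /w (bigD1 i)//= ci expr0n add0r expRK mulrA mulrC.
    apply: (@le_trans _ _ (- k%:R * lam i + r)); last by lra.
    rewrite -addrA lerD//.
      by rewrite le_eqVlt; apply/orP; left; apply/eqP; field.
    rewrite lerD2r; apply: ler_sum => j _.
    rewrite ler_wpM2l ?mulr_ge0// ler_wpM2l// ler_ln ?posrE ?cpos//; last first.
      by rewrite ltr_wpDl ?sqr_ge0.
    by rewrite lerD2l -expR0 ler_expR oppr_le0.
  rewrite negb_exists => /forallP hn.
  have hn' i : 0 < lam i -> h i (unitc t) != 0.
    by move=> li; have := hn i; rewrite li.
  pose S := \sum_i lam i * (c i t ^+ 2)^-1.
  have S0 : 0 <= S by apply: sumr_ge0 => i _; rewrite mulr_ge0// invr_ge0 sqr_ge0.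
  pose v := \sum_i lam i * ln (c i t ^+ 2) + m.
  have va : v < a by rewrite -lte_fin (le_lt_trans _ ua)// hu.
  exists (Num.truncn (S / (a - v))).+1; set k := _.+1.
  have av : 0 < a - v by rewrite subr_gt0.
  have : S / (a - v) < k%:R by exact: truncnS_gt.
  rewrite ltr_pdivrMr// => hk.
  have k0 : 0 < k%:R :> R by rewrite ltr0n.
  apply: (@le_trans _ _ (v + expR (- k%:R) * S)).
    rewrite /w /v addrAC lerD2r mulr_sumr -big_split/=; apply: ler_sum => i _.
    have [->|li] := eqVneq (lam i) 0; first by rewrite !(mulr0, mul0r) addr0.
    have lp : 0 < lam i by rewrite lt_neqAle eq_sym li lam0.
    have cp : 0 < c i t ^+ 2 by rewrite exprn_gt0// nc_gt0 hn'.
    rewrite (_ : _ * (2^-1 * _) = lam i * ln (c i t ^+ 2 + expR (- k%:R))); last by field.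
    rewrite [expR _ * _]mulrCA -mulrDr ler_pM2l//.
    rewrite (_ : _ + expR _ = c i t ^+ 2 * (1 + expR (- k%:R) * (c i t ^+ 2)^-1)); last first.
      by field; rewrite gt_eqF// nc_gt0 hn'.
    have ep : 0 < expR (- k%:R) * (c i t ^+ 2)^-1 by rewrite mulr_gt0 ?expR_gt0 ?invr_gt0.
    rewrite lnM ?posrE ?addr_gt0// lerD2l le_ln1Dx//.
    by rewrite (lt_trans _ ep)// oppr_lt0.
  rewrite -lerBrDl expRN mulrC ler_pdivrMr ?expR_gt0//.
  apply: (le_trans (ltW hk)); rewrite mulrC ler_wpM2l ?(ltW av)//.
  by rewrite (le_trans _ (expR_ge1Dx _))// lerDr.
have := integral_ge_limit mu_ uB cw wS wint uw.
rewrite -/w0 mulr_natl => h1.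
by rewrite lee_pdivlMl// mulrC.
Qed.

End log_submean.

Lemma measurable_usc d (X : measurableType d) (R : realType) (D : set X)
    (u : X -> \bar R) : measurable D ->
  (forall a : R, measurable (D `&` [set x | (u x < a%:E)%E])) -> measurable_fun D u.
Proof.
move=> mD h; apply: (measurability _ (ErealGenCInfty.measurableE R)) => // _ [_ [x ->] <-].
rewrite (_ : D `&` _ = D `\` (D `&` [set y | (u y < x%:E)%E])); first exact: measurableD.
apply/seteqP; split => y /=; rewrite in_itv/= andbT.
  by move=> [Dy xy]; split => // -[_]; rewrite ltNge xy.
by move=> [Dy xy]; split => //; rewrite leNgt; apply/negP => uy; exact: xy.
Qed.

Section usc_segment.
Variable R : realType.
Notation T := (pi *+ 2 : R).

Lemma measurable_usc_segment (u : R -> \bar R) :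
  (forall t (a : R), 0 <= t <= T -> (u t < a%:E)%E ->
     exists2 d : R, 0 < d & forall s, 0 <= s <= T -> `|s - t| < d -> (u s < a%:E)%E) ->
  measurable_fun `[0, T]%classic u.
Proof.
move=> usc; apply: measurable_usc => //= a.
pose O := [set x : R | exists t d : R, [/\ 0 < d, `|x - t| < d &
   forall s, 0 <= s <= T -> `|s - t| < d -> (u s < a%:E)%E]].
rewrite (_ : _ `&` _ = `[0, T]%classic `&` O); last first.
  apply/seteqP; split => x /=; rewrite in_itv/= => -[x0 ux]; split => //.
    have [d d0 hd] := usc x a x0 ux; exists x, d; split => //.
    by rewrite subrr normr0.
  by case: ux => t [d [d0 xt hd]]; exact: hd.
apply: measurableI => //; apply: open_measurable.
rewrite openE => x [t [d [d0 xt hd]]]; apply/nbhs_ballP.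
exists (d - `|x - t|) => /=; first by rewrite subr_gt0.
move=> y; rewrite /ball/= => xy; exists t, d; split => //.
rewrite (_ : y - t = (x - t) - (x - y)); last by ring.
by rewrite (le_lt_trans (ler_normB _ _))// -ltrBrDl.
Qed.

Lemma rcont_bounded (a b : R) (f : R -> R) : a <= b -> rcont a b f ->
  exists B, forall t, a <= t <= b -> f t <= B.
Proof.
move=> ab /rcont_within cf; have [c _ hc] := EVT_max ab cf.
by exists (f c) => t tab; apply: hc; rewrite in_itv.
Qed.

End usc_segment.

Section truncated_log.
Variable R : realType.
Implicit Types (t s m l : R).
Local Open Scope ereal_scope.

(* [1 + ln t] continued affinely from [t = 1]: convex as a function of [ln t]. *)
Definition kap t : \bar R :=
  if (t <= 0)%R then -oo else ((if t <= 1 then 1 + ln t else t)%R)%:E.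

Lemma kap_pos t : (0 < t)%R -> kap t = ((if t <= 1 then 1 + ln t else t)%R)%:E.
Proof. by rewrite /kap ltNge => /negbTE ->. Qed.

Lemma ln_le_subr1 t : (0 < t -> ln t <= t - 1)%R.
Proof.
move=> t0; rewrite -{1}(subrK 1%R t) addrC le_ln1Dx//.
by rewrite ltrBDl subrr.
Qed.

Lemma kap_le t : (0 <= t)%R -> kap t <= (1 + t)%:E.
Proof.
rewrite le_eqVlt => /predU1P[<-|t0]; first by rewrite /kap lexx leNye.
rewrite kap_pos// lee_fin; case: ifP => _; last by rewrite lerDr.
by rewrite lerD2l ltW// ln_sublinear.
Qed.

Lemma kap_ge_id t : kap t <= t%:E.
Proof.
rewrite /kap; case: ifPn => [_|]; first exact: leNye.
rewrite -ltNge lee_fin => t0; case: ifP => // _.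
by have := ln_le_subr1 t0; lra.
Qed.

(** The tangent at [ln s] to the convex function [x |-> kap (expR x)]: slope 1 up to [s = 1], slope
    [s] beyond. Its positive slope is a coefficient allowed in [log_submean]. *)
Lemma kap_minorant s : (0 < s)%R -> exists l m, [/\ (0 < l)%R,
  kap s = (l * ln s + m)%:E & forall t, (0 < t)%R -> (l * ln t + m)%:E <= kap t].
Proof.
move=> s0; have [s1|s1] := leP s 1%R.
  exists 1%R, 1%R; rewrite kap_pos// s1; split => //.
    by rewrite mul1r addrC.
  move=> t t0; rewrite kap_pos// lee_fin mul1r addrC; case: ifP => // _.
  by have := ln_le_subr1 t0; lra.
exists s, (s - s * ln s)%R; rewrite kap_pos// leNgt s1/=; split => //.
  by congr (_%:E); ring.
move=> t t0; rewrite kap_pos// lee_fin.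
have k1 : (ln t - ln s <= t / s - 1)%R.
  by rewrite -ln_div ?posrE// ln_le_subr1// divr_gt0.
case: ifPn => [t1|].
  have k2 := ln_le_subr1 t0; have lt0 : (ln t <= 0)%R by exact: ln_le0.
  have k3 : (ln s^-1 <= s^-1 - 1)%R by rewrite ln_le_subr1// invr_gt0.
  rewrite lnV ?posrE// in k3.
  have k4 : (s * (- ln s) <= s * (s^-1 - 1))%R by rewrite ler_pM2l.
  have k5 : (s * s^-1 = 1)%R by rewrite mulfV// gt_eqF.
  rewrite mulrBr k5 mulr1 in k4.
  have : ((s - 1) * ln t <= 0)%R by rewrite mulr_ge0_le0// subr_ge0 ltW.
  by lra.
rewrite -ltNge => t1; have k2 : (s * (ln t - ln s) <= s * (t / s - 1))%R by rewrite ler_pM2l.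
have k5 : (s * (t / s) = t)%R by rewrite mulrCA mulfV ?mulr1// gt_eqF.
by rewrite mulrBr [X in (_ <= X)%R]mulrBr k5 mulr1 in k2; lra.
Qed.

(** The tangent at [ln s] to the exponential; for [s = 0] it degenerates to the constant 0. *)
Lemma id_minorant s t : (0 <= s)%R -> (0 <= t)%R -> (0 < s -> 0 < t)%R ->
  (s * ln t + (s - s * ln s) <= t)%R.
Proof.
rewrite le_eqVlt => /predU1P[<- t0 _|s0 _ /(_ s0) t0].
  by rewrite !mul0r subrr addr0.
have k1 : (ln t - ln s <= t / s - 1)%R.
  by rewrite -ln_div ?posrE// ln_le_subr1// divr_gt0.
have k2 : (s * (ln t - ln s) <= s * (t / s - 1))%R by rewrite ler_pM2l.
have k5 : (s * (t / s) = t)%R by rewrite mulrCA mulfV ?mulr1// gt_eqF.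
by rewrite mulrBr [X in (_ <= X)%R]mulrBr k5 mulr1 in k2; lra.
Qed.

Lemma kap_usc s (b : R) : (0 <= s)%R -> kap s < b%:E ->
  exists2 d, (0 < d)%R & forall t, (t < s + d)%R -> kap t < b%:E.
Proof.
rewrite le_eqVlt => /predU1P[<- _|s0].
  pose d : R := Num.min 1%R (expR (b - 1)%R).
  exists d; first by rewrite lt_min ltr01 expR_gt0.
  move=> t; rewrite add0r lt_min => /andP[t1 tb].
  have [t0|t0] := leP t 0%R; first by rewrite /kap t0 ltNyr.
  rewrite kap_pos// (ltW t1) lte_fin.
  have : (ln t < b - 1)%R by rewrite -ltr_expR lnK ?posrE.
  by lra.
rewrite kap_pos// lte_fin.
set k := (if _ then _ else _)%R => kb.
(* To the right of [s], [kap] grows by at most [(t - s) * s^-1] along its logarithmic branch and by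
   at most [t - s] along the other. *)
pose K := (1 + s^-1)%R.
have K0 : (0 < K)%R by rewrite addr_gt0// invr_gt0.
exists ((b - k) / K)%R; first by rewrite divr_gt0// subr_gt0.
move=> t ts; have [t0|t0] := leP t 0%R; first by rewrite /kap t0 ltNyr.
have tK : ((t - s) * K < b - k)%R by rewrite -ltr_pdivlMr// ltrBlDl.
have sp : (0 < s^-1)%R by rewrite invr_gt0.
have k1 : (ln t - ln s <= (t - s) * s^-1)%R.
  rewrite -ln_div ?posrE// (le_trans (ln_le_subr1 _)) ?divr_gt0//.
  by rewrite mulrBl mulfV// gt_eqF.
rewrite kap_pos// lte_fin; have [h1|h1] := leP t s.
  apply: le_lt_trans kb; rewrite /k.
  have [h2|h2] := leP t 1%R; have [h3|h3] := leP s 1%R => //.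
  - by rewrite lerD2l ler_ln ?posrE.
  - by have := ln_le_subr1 t0; lra.
  - by lra.
have h4 : (0 < (t - s) * s^-1)%R by rewrite mulr_gt0// subr_gt0.
have h5 : ((t - s) * K = (t - s) + (t - s) * s^-1)%R by rewrite /K; ring.
have [h2|h2] := leP t 1%R.
  by move: tK; rewrite /k (le_trans (ltW h1) h2); lra.
have [h3|h3] := leP s 1%R; last by move: tK; rewrite /k leNgt h3/=; lra.
move: tK; rewrite /k h3 h5.
have k3 : (ln s^-1 <= s^-1 - 1)%R by rewrite ln_le_subr1.
rewrite lnV ?posrE// in k3.
have k4 : ((1 - s) * s^-1 <= (t - s) * s^-1)%R.
  by rewrite ler_pM2r// lerD2r ltW.
have k5 : ((1 - s) * s^-1 = s^-1 - 1)%R by rewrite mulrBl mul1r mulfV// gt_eqF.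
by lra.
Qed.

End truncated_log.

(** * The model on C^n and its composition with holomorphic maps *)

Section model_function.
Variables (R : realType) (n : nat) (A : 'I_n -> R).
Notation V := 'rV[R[i]]_n.
Implicit Types (Z : V).

Definition sqc Z i : R := nc (Z 0 i) ^+ 2.

(** The terms with [j != i] come from a sum added to all members of the maximum: without it,
    [kap t - t] would be concave in [ln t] for [t <= 1]. *)
Definition psi_at Z i : \bar R :=
  ((A i)%:E * kap (sqc Z i) + (\sum_(j | j != i) A j * sqc Z j)%:E)%E.

Definition Psi Z : \bar R := \big[maxe/-oo%E]_(i < n) psi_at Z i.

Definition vsq Z : R := - \sum_j A j * sqc Z j.

Definition Phi Z : \bar R := (Psi Z + (vsq Z)%:E)%E.

Lemma sqc_ge0 Z i : 0 <= sqc Z i. Proof. exact: sqr_ge0. Qed.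

Lemma emax_attained (f : 'I_n -> \bar R) :
  \big[maxe/-oo%E]_(i < n) f i = -oo%E \/ exists i, \big[maxe/-oo%E]_(i < n) f i = f i.
Proof.
elim/big_rec : _ => [|i x _ [->|[j ->]]]; first by left.
  by right; exists i; rewrite maxEle leeNy_eq; case: ifP => // /eqP.
by right; rewrite maxEle; case: ifP; [exists j|exists i].
Qed.

Hypothesis A_gt0 : forall i, 0 < A i.

Let A_ge0 i : 0 <= A i. Proof. exact: ltW. Qed.

Lemma psi_at_le Z i : (psi_at Z i <= (\sum_j A j * (1 + sqc Z j))%:E)%E.
Proof.
rewrite /psi_at [X in (_ <= X%:E)%E](bigD1 i)//= EFinD leeD//.
  by rewrite EFinM lee_pmul2l ?lte_fin// kap_le// sqc_ge0.
rewrite lee_fin; apply: ler_sum => j _; rewrite ler_wpM2l//.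
by rewrite lerDr.
Qed.

Lemma Psi_le Z : (Psi Z <= (\sum_j A j * (1 + sqc Z j))%:E)%E.
Proof. by apply: bigmax_le => [|i _]; [exact: leNye|exact: psi_at_le]. Qed.

(** Splitting the inequality at a real [b] lets the two summands vary separately, also when [kap] is
    [-oo]. *)
Lemma psi_at_lt Z i (a : R) : (psi_at Z i < a%:E)%E -> exists b : R,
  (kap (sqc Z i) < b%:E)%E /\ A i * b + \sum_(j | j != i) A j * sqc Z j < a.
Proof.
rewrite /psi_at; set B := \sum_(j | _) _ => h.
have Ai := A_gt0 i.
have [k1|[k k1]] : kap (sqc Z i) = -oo%E \/ exists k, kap (sqc Z i) = k%:E.
  by rewrite /kap; case: ifP => _; [left|right; eexists].
- exists ((a - B) / A i - 1); rewrite k1 ltNyr; split => //.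
  by rewrite mulrBr mulrCA mulfV ?gt_eqF// mulr1; lra.
- move: h; rewrite k1 -EFinM -EFinD lte_fin => h.
  have h2 : k < (a - B) / A i by rewrite ltr_pdivlMr// mulrC; lra.
  exists ((k + (a - B) / A i) / 2); rewrite lte_fin; split; first by lra.
  have : A i * ((k + (a - B) / A i) / 2) < A i * ((a - B) / A i) by rewrite ltr_pM2l//; lra.
  by rewrite [X in _ < X -> _]mulrCA mulfV ?gt_eqF// mulr1; lra.
Qed.

Lemma lt_psi_at Z i (a b : R) : (kap (sqc Z i) < b%:E)%E ->
  A i * b + \sum_(j | j != i) A j * sqc Z j < a -> (psi_at Z i < a%:E)%E.
Proof.
move=> kb ba; apply: (@le_lt_trans _ _ ((A i)%:E * b%:E + (\sum_(j | j != i) A j * sqc Z j)%:E)%E).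
  by rewrite leeD2r// lee_pmul2l// ?lte_fin//; exact: ltW.
by rewrite -EFinM -EFinD lte_fin.
Qed.

Section composition.
Variables (U : set V) (H : V -> V).
Hypothesis (holH : forall j, hol (fun z => H z 0 j) U).

Lemma continuous_sqc z j : U z -> {for z, continuous (fun z => sqc (H z) j)}.
Proof.
move=> Uz.
apply: (@continuous_ext _ _ (fun y => complex.Re (H y 0 j) * complex.Re (H y 0 j) +
    complex.Re (- 'i%C * H y 0 j) * complex.Re (- 'i%C * H y 0 j))) => [y|].
  by rewrite /sqc nc_sqr !expr2 !(ReM, ReN, ImN)/= oppr0 mul0r sub0r mulN1r opprK.
by apply: continuousD; apply: continuousM; apply: (@Re_hol_continuous _ _ _ U) => //;
  try apply: holZ; exact: holH.
Qed.

Lemma Psi_usc z (a : R) : U z -> (Psi (H z) < a%:E)%E ->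
  \forall y \near z, (Psi (H y) < a%:E)%E.
Proof.
move=> Uz ua.
have : forall i, \forall y \near z, (psi_at (H y) i < a%:E)%E.
  move=> i; have hi : (psi_at (H z) i < a%:E)%E.
    exact: le_lt_trans (le_bigmax _ _ i) ua.
  have [b [kb ba]] := psi_at_lt hi.
  have [d d0 hd] := kap_usc (sqc_ge0 _ _) kb.
  have N1 : \forall y \near z, sqc (H y) i < sqc (H z) i + d.
    have L : nbhs (sqc (H z) i) [set x : R | x < sqc (H z) i + d].
      by apply: lt_nbhsl; rewrite ltrDl.
    exact: (@continuous_sqc z i Uz _ L).
  have cB : {for z, continuous (fun y => \sum_(j | j != i) A j * sqc (H y) j)}.
    apply: (@continuous_ext _ _ (fun y => \sum_j (if j != i then A j else 0) * sqc (H y) j)) => [y|].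
      by rewrite [RHS]big_mkcond/=; apply: eq_bigr => j _; case: ifP => //; rewrite mul0r.
    apply: continuous_sum => j; apply: continuousM; first exact: cst_continuous.
    exact: continuous_sqc.
  have N2 : \forall y \near z, \sum_(j | j != i) A j * sqc (H y) j < a - A i * b.
    have L : nbhs (\sum_(j | j != i) A j * sqc (H z) j) [set x : R | x < a - A i * b].
      by apply: lt_nbhsl; lra.
    exact: (cB _ L).
  near=> y; apply: (@lt_psi_at _ _ _ b).
    by apply: hd; near: y.
  have : \sum_(j | j != i) A j * sqc (H y) j < a - A i * b by near: y.
  lra.
move=> /filter_forall; apply: filterS => y hy.
by apply: bigmax_lt => [|i _]; [exact: ltNyr|exact: hy].
Unshelve. all: by end_near. Qed.

End composition.
End model_function.

Section psh_composition.
Variables (R : realType) (n : nat) (A : 'I_n -> R).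
Notation V := 'rV[R[i]]_n.
Hypothesis A_gt0 : forall i, 0 < A i.
Variables (U : set V) (H : V -> V).
Hypothesis (holH : forall j, hol (fun z => H z 0 j) U).

Lemma unitc_cont (e : R) : 0 < e -> exists2 d : R, 0 < d &
  forall s t : R, `|s - t| < d -> nc (unitc s - unitc t) <= e.
Proof.
move=> e0; have [d d0 hd] := @polarc_near R 1 ltr01.
exists (Num.min d (e / 2)); first by rewrite lt_min d0 divr_gt0.
move=> s t; rewrite lt_min => /andP[h1 h2].
have := hd 0 (s - t); rewrite normr0 => /(_ d0 h1).
have -> : polarc 0 (s - t) = unitc (s - t) by rewrite /polarc expR0 mul1r.
rewrite mul1r add0r => h3.
have -> : unitc s - unitc t = unitc t * (unitc (s - t) - 1).
  by rewrite mulrBr mulr1 -unitcD [t + _]addrC subrK.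
rewrite ncM nc_unitc mul1r -[X in nc X](subrK (0 +i* (s - t))%C).
rewrite (le_trans (ncD _ _))// (le_trans (lerD h3 (nc_le_ReIm _)))//=.
by rewrite normr0; lra.
Qed.

Let disc z w := forall x : R[i], nc x <= 1 -> U (z + x *: w).

Lemma Psi_circle_measurable z w : disc z w ->
  measurable_fun `[0, pi *+ 2]%classic (fun t : R => Psi A (H (z + unitc t *: w))).
Proof.
move=> dzw; apply: measurable_usc_segment => t a _ ua.
have Ut : U (z + unitc t *: w) by apply: dzw; rewrite nc_unitc.
have /nbhs_nm[r r0 hr] := Psi_usc A_gt0 holH Ut ua.
have W0 : 0 < nm w + 1 by rewrite ltr_wpDl ?nm_ge0.
have [d d0 hd] := unitc_cont (divr_gt0 (divr_gt0 r0 (ltr0Sn R 1)) W0).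
exists d => // s _ st.
have -> : z + unitc s *: w = z + unitc t *: w + (unitc s - unitc t) *: w.
  by rewrite -addrA -scalerDl [unitc t + _]addrC subrK.
apply: hr; rewrite nmZ.
have h1 := hd s t st.
apply: (@le_lt_trans _ _ (r / 2 / (nm w + 1) * (nm w + 1))).
  by rewrite ler_pM ?nc_ge0 ?nm_ge0// lerDl.
by rewrite divfK ?gt_eqF//; lra.
Qed.

(** Let [i0] attain the maximum at [z]. Replacing each convex function in [psi_at] by its tangent at
    the centre gives a combination of the [ln |h j|^2] with nonnegative coefficients, equal to [Psi]
    at the centre and below it on the circle. *)
Lemma Psi_submean z w : disc z w ->
  (Psi A (H z) <= ((2 * pi)^-1)%:E *
    \int[@lebesgue_measure R]_(t in `[0%R, (2 * pi)%R])
      Psi A (H (z + unitc t *: w)))%E.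
Proof.
move=> dzw.
have Uz : U z by have := dzw 0; rewrite nc0 ler01 scale0r addr0; apply.
have [->|[i0 e0]] : Psi A (H z) = -oo%E \/ exists i, Psi A (H z) = psi_at A (H z) i.
- exact: emax_attained.
- exact: leNye.
pose h j (x : R[i]) := H (z + x *: w) 0 j.
have h0 j : nc (h j 0) ^+ 2 = sqc (H z) j by rewrite /h scale0r addr0.
have [k0|k0] := leP (sqc (H z) i0) 0.
  by rewrite e0 /psi_at /kap k0 gt0_muleNy ?lte_fin// leNye.
have [l [m [l0 ks km]]] := kap_minorant k0.
(* The slopes of the tangents. A coordinate other than [i0] that vanishes at the centre gets slope
   0, so its logarithm does not occur. *)
pose lam j := if j == i0 then A i0 * l else A j * sqc (H z) j.
pose s j := sqc (H z) j.
pose M := A i0 * m + \sum_(j | j != i0) A j * (s j - s j * ln (s j)).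
have -> : Psi A (H z) = (\sum_j lam j * ln (nc (h j 0) ^+ 2) + M)%:E.
  rewrite e0 /psi_at ks -EFinM -EFinD; congr (_%:E).
  rewrite [in RHS](bigD1 i0)//= /lam eqxx h0 /M addrACA mulrDr mulrA; congr (_ + _).
  rewrite -big_split/=; apply: eq_bigr => j /negbTE ji; rewrite ji h0 -/(s j); ring.
have lam_sq j x : 0 < lam j -> h j x != 0 -> 0 < nc (h j x) ^+ 2.
  by move=> _ hx; rewrite exprn_gt0// nc_gt0.
have [B hB] : exists B, forall t : R, 0 <= t <= pi *+ 2 ->
    \sum_j A j * (1 + nc (h j (unitc t)) ^+ 2) <= B.
  apply: rcont_bounded; first by rewrite ltW// twopi_gt0.
  apply: rcont_sum => j; apply: rcontZ; apply: rcontD; first exact: rcont_cst.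
  apply: (@rcont_comp _ _ _ (fun t => nc (h j (unitc t))) (fun x => x ^+ 2)); last first.
    by move=> x _; exact: exprn_continuous.
  apply: rcont_unitc => x x1; apply: cder_cont.
  by apply: (@hol_line _ _ (fun z => H z 0 j)) (holH j) _; apply: dzw; rewrite x1.
apply: (@log_submean _ _ h lam M B).
- move=> j x x1; eexists.
  by apply: (@hol_line _ _ (fun z => H z 0 j)) (holH j) _; apply: dzw.
- move=> j; rewrite /lam; case: ifP => _; first by rewrite mulr_ge0// ltW.
  by rewrite mulr_ge0 ?sqc_ge0// ltW.
- have pos j : 0 < sqc (H z) j -> h j 0 != 0.
    rewrite -h0 => hj; rewrite -nc_gt0 lt_neqAle nc_ge0 andbT eq_sym.
    by apply/eqP => hz; move: hj; rewrite hz expr0n ltxx.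
  move=> j; rewrite /lam; case: ifP => [/eqP -> _|_]; first exact: pos.
  by rewrite pmulr_rgt0//; exact: pos.
- exact: Psi_circle_measurable.
- by move=> t /hB hb; rewrite (le_trans (Psi_le _ _))// lee_fin.
move=> t ht hn.
apply: le_trans (le_bigmax _ _ i0).
have li0 : 0 < lam i0 by rewrite /lam eqxx mulr_gt0.
have t0 : 0 < sqc (H (z + unitc t *: w)) i0 by exact: lam_sq (hn i0 li0).
rewrite (bigD1 i0)//= /lam eqxx /M addrACA EFinD leeD//.
  set t1 := sqc _ _ in t0 *.
  have k1 : ((A i0)%:E * (l * ln t1 + m)%:E <= (A i0)%:E * kap t1)%E.
    by rewrite lee_pmul2l ?lte_fin// km.
  by rewrite -EFinM mulrDr mulrA in k1; exact: k1.
rewrite lee_fin -big_split/=; apply: ler_sum => j /negbTE ji; rewrite ji.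
rewrite -mulrA -mulrDr ler_wpM2l ?(ltW (A_gt0 j))//.
apply: id_minorant; rewrite ?sqc_ge0//.
move=> sj; apply: (lam_sq j); last apply: hn.
  by rewrite /lam ji mulr_gt0.
by rewrite /lam ji mulr_gt0.
Qed.

Lemma Psi_psh_Cn : psh_Cn U (fun z => Psi A (H z)).
Proof.
split.
- by move=> z Uz; rewrite (le_lt_trans (Psi_le A_gt0 _))// ltry.
- by move=> z a; exact: Psi_usc.
- move=> z w dzw; apply: Psi_submean => x x1; apply: dzw.
  by rewrite norm_nc lecR.
Qed.

End psh_composition.

Section model_bounds.
Variables (R : realType) (n : nat) (A : 'I_n -> R).
Hypothesis A_gt0 : forall i, 0 < A i.
Implicit Types Z : 'rV[R[i]]_n.

Lemma psi_atE Z i :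
  (psi_at A Z i + (vsq A Z)%:E = (A i)%:E * (kap (sqc Z i) - (sqc Z i)%:E))%E.
Proof.
have Ai := A_gt0 i; rewrite /psi_at /vsq.
set S := \sum_(j | _) _; rewrite (bigD1 i)//= -/S.
have [->|[k ->]] : kap (sqc Z i) = -oo%E \/ exists k, kap (sqc Z i) = k%:E.
  by rewrite /kap; case: ifP => _; [left|right; eexists].
  by rewrite !gt0_muleNy ?lte_fin.
by rewrite -EFinB -!EFinM; congr (_%:E); ring.
Qed.

Lemma Phi_ge Z i : ((A i)%:E * (kap (sqc Z i) - (sqc Z i)%:E) <= Phi A Z)%E.
Proof. by rewrite -psi_atE leeD2r//; exact: le_bigmax. Qed.

Lemma Phi_le Z (a : R) :
  (forall i, ((A i)%:E * (kap (sqc Z i) - (sqc Z i)%:E) <= a%:E)%E) ->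
  (Phi A Z <= a%:E)%E.
Proof.
move=> h; rewrite /Phi -leeBrDr//; apply: bigmax_le => [|i _]; first exact: leNye.
by rewrite leeBrDr// psi_atE.
Qed.

Lemma Phi_le0 Z : (Phi A Z <= 0)%E.
Proof.
apply: Phi_le => i; rewrite mule_ge0_le0 ?lee_fin ?(ltW (A_gt0 i))//.
by rewrite leeBlDr// add0e kap_ge_id.
Qed.

Lemma Phi_eq0 Z i : 1 <= sqc Z i -> Phi A Z = 0%E.
Proof.
move=> h; apply/eqP; rewrite eq_le Phi_le0/= (le_trans _ (Phi_ge Z i))//.
rewrite mule_ge0 ?lee_fin ?(ltW (A_gt0 i))// kap_pos ?(lt_le_trans _ h)// -EFinB lee_fin.
case: ifPn => [h1|_]; last by rewrite subrr.
have -> : sqc Z i = 1 by apply/eqP; rewrite eq_le h h1.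
by rewrite ln1 addr0 subrr.
Qed.

Lemma Phi_ge_ln Z i : 0 < sqc Z i <= 1 -> ((A i * ln (sqc Z i))%:E <= Phi A Z)%E.
Proof.
move=> /andP[t0 t1]; apply: le_trans (Phi_ge Z i); rewrite kap_pos// t1.
by rewrite -EFinB -EFinM lee_fin ler_pM2l// ; lra.
Qed.

(** The [- 1] in the exponent compensates the 1 in [kap t = 1 + ln t]. *)
Lemma Phi_le_ln Z (s : R) : 0 <= s ->
  (forall i, sqc Z i <= expR (- (s / A i) - 1)) -> (Phi A Z <= (- s)%:E)%E.
Proof.
move=> s0 h; apply: Phi_le => i; have Ai := A_gt0 i.
have [t0|t0] := leP (sqc Z i) 0.
  by rewrite /kap t0 -EFinN addNye gt0_muleNy ?lte_fin// leNye.
have l1 : ln (sqc Z i) <= - (s / A i) - 1.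
  by rewrite -ler_expR lnK.
have sA : 0 <= s / A i by rewrite divr_ge0// ltW.
have t1 : sqc Z i <= 1 by rewrite (le_trans (h i))// -[leRHS]expR0 ler_expR; lra.
rewrite kap_pos// t1 -EFinB -EFinM lee_fin.
have -> : - s = A i * (- (s / A i)) by rewrite mulrN mulrCA mulfV ?mulr1// gt_eqF.
by rewrite ler_pM2l//; lra.
Qed.

Lemma Phi_bounded Z (d : R) i : 0 < d -> d <= sqc Z i ->
  ((A i * Num.min 0 (ln d))%:E <= Phi A Z)%E.
Proof.
move=> d0 dt; have t0 := lt_le_trans d0 dt.
have [t1|t1] := leP (sqc Z i) 1; last first.
  by rewrite (@Phi_eq0 _ i) ?(ltW t1)// lee_fin mulr_ge0_le0 ?(ltW (A_gt0 i))// ge_min lexx.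
apply: (@le_trans _ _ (A i * ln (sqc Z i))%:E); last by apply: Phi_ge_ln; apply/andP.
by rewrite lee_fin ler_wpM2l ?(ltW (A_gt0 i))// ge_min; apply/orP; right; rewrite ler_ln.
Qed.

End model_bounds.

(** * Transfer of the model to the manifold *)

Section charts.
Variables (R : realType) (n : nat) (M : complexManifold R n).
Implicit Types (c : chart R n M) (V : set M) (x p : M).
Notation E := 'rV[R[i]]_n.

Definition cimg c V : set E := c @` (V `&` chart_dom c).

Lemma cimg_inv c V z : cimg c V z -> V (chart_inv c z) /\ chart_dom c (chart_inv c z).
Proof. by move=> [x [Vx dx] <-]; rewrite chartK. Qed.

Lemma cimgK c V z : cimg c V z -> c (chart_inv c z) = z.
Proof. by move=> [x [Vx dx] <-]; rewrite chartK. Qed.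

Lemma near_cimg c V x : open V -> V x -> chart_dom c x -> nbhs (c x) (cimg c V).
Proof.
move=> oV Vx dx.
have N1 : nbhs (c x) (c @` chart_dom c).
  by apply: open_nbhs_nbhs; split; [exact: chart_img_open|exists x].
have N2 : nbhs (c x) [set w | V (chart_inv c w)].
  have oVx : nbhs (chart_inv c (c x)) V by rewrite chartK//; exact: open_nbhs_nbhs.
  exact: (@chart_inv_continuous _ _ _ c x dx _ oVx).
apply: filterS2 N1 N2 => w [y dy <-] /=; rewrite chartK// => Vy.
by exists y.
Qed.

Lemma cimg_uopen c V : open V -> uopen (cimg c V).
Proof.
by move=> oV z [x [Vx dx] <-]; apply/nbhs_nm; exact: near_cimg.
Qed.

Lemma transition_hol c c' j : atlas c -> atlas c' ->
  hol (fun z => c' (chart_inv c z) 0 j) (cimg c (chart_dom c')).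
Proof.
move=> ac ac'.
apply: (@differentiable_coord_hol _ _ n (c' \o chart_inv c)) => z [x [dx' dx] <-].
exact: atlas_compat.
Qed.

Lemma holomorphic_on_hol V (f : M -> R[i]) c : atlas c -> holomorphic_on V f ->
  hol (f \o chart_inv c) (cimg c V).
Proof.
move=> ac hf; apply: differentiable_hol => z [x [Vx dx] <-]; exact: hf.
Qed.

End charts.

Section singular_function.
Variables (R : realType) (n : nat) (M : complexManifold R n).
Variables (c0 : chart R n M) (x0 : M) (A : 'I_n -> R) (rho : R).
Hypotheses (ac0 : atlas c0) (dx0 : chart_dom c0 x0) (A_gt0 : forall i, 0 < A i)
  (rho_gt0 : 0 < rho) (n_gt0 : (0 < n)%N).
Notation E := 'rV[R[i]]_n.

Hypothesis polysquare : forall z : E,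
  (forall j, `|complex.Re (z 0 j - c0 x0 0 j)| <= rho /\
             `|complex.Im (z 0 j - c0 x0 0 j)| <= rho) ->
  (c0 @` chart_dom c0) z.

Definition zmap (x : M) : E := (rho^-1)%:C%C *: (c0 x - c0 x0).

(** The rescaling by [rho] puts all points with every [sqc] below 1 inside the polysquare. [Phi]
    thus vanishes on the rest of the chart domain, and the value 0 outside continues it. *)
Definition phi0 (x : M) : \bar R :=
  if `[< chart_dom c0 x >] then Phi A (zmap x) else 0%E.

Lemma zmap_coord x j : zmap x 0 j = (rho^-1)%:C%C * (c0 x 0 j - c0 x0 0 j).
Proof. by rewrite /zmap !mxE. Qed.

Lemma zmap_hol c j : atlas c ->
  hol (fun z => zmap (chart_inv c z) 0 j) (cimg c (chart_dom c0)).
Proof.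
move=> ac; under eq_fun do rewrite zmap_coord.
by apply: holZ; apply: holB; [exact: transition_hol|exact: hol_cst].
Qed.

Lemma zmap_eq0 x : chart_dom c0 x -> (forall j, sqc (zmap x) j <= 0) -> x = x0.
Proof.
move=> dx h; have : c0 x = c0 x0.
  apply/rowP => j; apply/eqP; rewrite -subr_eq0; have := h j.
  rewrite /sqc zmap_coord ncM exprMn => hj.
  have nr : 0 < nc (rho^-1)%:C%C ^+ 2.
    by rewrite exprn_gt0// nc_real gtr0_norm ?invr_gt0.
  rewrite pmulr_rle0// in hj.
  have : nc (c0 x 0 j - c0 x0 0 j) ^+ 2 = 0 by apply/eqP; rewrite eq_le hj sqr_ge0.
  by move=> /eqP; rewrite sqrf_eq0 => /eqP hz; rewrite -nc_le0 hz.
by move=> e; rewrite -(chartK dx) e chartK.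
Qed.

Lemma phi0E x : chart_dom c0 x -> phi0 x = (Psi A (zmap x) + (vsq A (zmap x))%:E)%E.
Proof. by move=> dx; rewrite /phi0 asboolT. Qed.

Lemma Psi_fin Z j : 0 < sqc Z j -> (Psi A Z != -oo)%E.
Proof.
move=> hj; rewrite -ltNye; apply: lt_le_trans (le_bigmax _ _ j).
by rewrite /psi_at kap_pos// -EFinM -EFinD ltNyr.
Qed.

Lemma psh_on_chart : psh_on (chart_dom c0) (Psi A \o zmap).
Proof.
split.
  move=> c ac.
  by apply: (@Psi_psh_Cn _ _ A A_gt0 _ (zmap \o chart_inv c)) => j; exact: zmap_hol.
move=> x dx; have [[j hj]|h] := pselect (exists j, 0 < sqc (zmap x) j).
  by exists x; [exact: connected_component_refl|exact: Psi_fin hj].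
have xx0 : x = x0.
  by apply: zmap_eq0 dx _ => j; rewrite leNgt; apply/negP => hj; apply: h; exists j.
rewrite {h dx}xx0.
(* At the pole itself, a segment of length [rho] along the first coordinate joins [x0] inside the
   chart domain to a point where [Psi] is finite. *)
pose j0 := Ordinal n_gt0.
pose g (t : R) : E := c0 x0 + t%:C%C *: (delta_mx 0 j0 : E).
have gdom t : 0 <= t <= rho -> (c0 @` chart_dom c0) (g t).
  move=> /andP[t0 tr]; apply: polysquare => j; rewrite /g !mxE [c0 x0 0 j + _]addrC addrK eqxx.
  case: (j == j0); rewrite ?mulr0 ?mulr1 /= ?normr0 ?(ltW rho_gt0)//.
  by rewrite ger0_norm.
pose y t := chart_inv c0 (g t).
have y0 : y 0 = x0 by rewrite /y /g scale0r addr0 chartK.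
have ydom t : 0 <= t <= rho -> chart_dom c0 (y t) /\ c0 (y t) = g t.
  by move=> /gdom[u du ug]; rewrite /y -ug chartK.
exists (y rho).
  exists (y @` `[0, rho]) => //; last by exists rho => //=; rewrite in_itv/= lexx ltW.
  split.
  - by exists 0 => //=; rewrite in_itv/= lexx ltW.
  - by move=> _ [t + <-]; rewrite /= in_itv/= => /ydom[].
  - apply: connected_continuous_connected.
      by apply: segment_connected.
    apply/continuous_in_subspaceT => t; rewrite inE/= in_itv/= => ht.
    have [u du ug] := gdom t ht.
    apply: (@continuous_comp _ _ _ g (chart_inv c0)); last first.
      by rewrite -ug; exact: chart_inv_continuous.
    move=> B /nbhs_nm[r r0 hr].
    apply/nbhs_ballP; exists r => //= s; rewrite /ball/= => ts.
    have -> : g s = g t + (s - t)%:C%C *: (delta_mx 0 j0 : E).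
      by rewrite /g -addrA -scalerDl -rmorphD/= [t + _]addrC subrK.
    apply: hr; rewrite nmZ nc_real distrC.
    apply: le_lt_trans ts; rewrite ler_piMr// /nm (bigD1 j0)//= big1 => [|j jn].
      by rewrite mxE !eqxx nc1 addr0.
    by rewrite mxE (negbTE jn) nc0.
have [_ e1] : chart_dom c0 (y rho) /\ c0 (y rho) = g rho.
  by apply: ydom; rewrite lexx ltW.
apply: (@Psi_fin _ j0); rewrite /sqc zmap_coord e1 /g !mxE !eqxx/= [c0 x0 0 j0 + _]addrC addrK.
by rewrite mulr1 -rmorphM mulVf ?gt_eqF// nc1 expr1n.
Qed.

Lemma smooth_on_chart : smooth_on (chart_dom c0) (vsq A \o zmap).
Proof.
move=> c ac k.
pose h j z := zmap (chart_inv c z) 0 j.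
pose F (i : 'I_n + 'I_n) := match i with
  | inl j => fun z => (- A j)%:C%C * h j z
  | inr j => fun z => (- A j)%:C%C * (- 'i%C * h j z) end.
pose G (i : 'I_n + 'I_n) := match i with
  | inl j => h j
  | inr j => fun z => - 'i%C * h j z end.
apply: (@Ck_on_bilinear _ _ k _ ('I_n + 'I_n)%type F G).
- exact/cimg_uopen/chart_dom_open.
- by case=> j /=; apply: holZ; [|apply: holZ]; exact: zmap_hol.
- by case=> j /=; [|apply: holZ]; exact: zmap_hol.
move=> z _; rewrite big_sumType/= /vsq -sumrN -big_split/=; apply: eq_bigr => j _.
rewrite /sqc nc_sqr /h; case: (zmap _ 0 j) => a b.
by rewrite !(ReM, ImM, ReN, ImN)/=; ring.
Qed.

(** Squares rather than discs in each coordinate make this a continuous image of a product of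
    segments, hence compact. As the manifold is Hausdorff, its complement is then open. *)
Definition core : set M := chart_inv c0 @` [set z : E | forall j,
  (fun u => `|complex.Re (u - c0 x0 0 j)| <= rho /\
            `|complex.Im (u - c0 x0 0 j)| <= rho) (z ord0 j)].

Lemma core_compact : compact core.
Proof.
apply: continuous_compact.
  apply/continuous_in_subspaceT => z; rewrite inE/= => hz.
  have [x dx <-] := polysquare hz; exact: chart_inv_continuous.
apply: (@rV_compact R[i] n (fun j => [set u : R[i] |
   `|complex.Re (u - c0 x0 0 j)| <= rho /\ `|complex.Im (u - c0 x0 0 j)| <= rho])).
move=> j; set q := c0 x0 0 j.
pose f (u : R * R) : R[i] := q + (u.1 +i* u.2)%C.
rewrite (_ : [set _ | _] = f @` (`[- rho, rho] `*` `[- rho, rho])); last first.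
  apply/seteqP; split => [u /= [h1 h2]|_ [[a b] /= [h1 h2] <-]].
    exists (complex.Re (u - q), complex.Im (u - q)).
      by rewrite /= !in_itv/= -!ler_norml.
    by rewrite /f/=; case: (u - q) (subrK q u) => a b <-; rewrite addrC.
  rewrite /f/= [q + _]addrC addrK/=.
  by move: h1 h2; rewrite !in_itv/= -!ler_norml.
apply: continuous_compact; last by apply: compact_setX; exact: segment_compact.
apply: continuous_subspaceT => u B /nbhs_nc[r r0 hr].
have r2 : 0 < r / 2 by rewrite divr_gt0.
exists (ball u.1 (r / 2), ball u.2 (r / 2)); first by split; exact: nbhsx_ballx.
case=> a b /= [h1 h2].
rewrite (_ : f (a, b) = f u + ((a - u.1) +i* (b - u.2))%C); last first.
  rewrite /f -addrA; congr (_ + _); apply/eqP; rewrite eq_complex ReD ImD/=.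
  by rewrite ![_ + (_ - _)]addrC !subrK !eqxx.
apply: hr; rewrite (le_lt_trans (nc_le_ReIm _))//=.
by move: h1 h2; rewrite /ball/= ![`|_ - a|]distrC ![`|_ - b|]distrC; lra.
Qed.

Lemma core_closed : closed core.
Proof. by apply: compact_closed core_compact; exact: manifold_hausdorff. Qed.

Lemma phi0_out x : ~ core x -> phi0 x = 0%E.
Proof.
move=> nx; rewrite /phi0; case: asboolP => // dx.
have [[j hj]|h] := pselect (exists j, 1 <= sqc (zmap x) j); first exact: Phi_eq0 hj.
exfalso; apply: nx; exists (c0 x); last by rewrite chartK.
move=> j /=; have : sqc (zmap x) j < 1.
  by rewrite ltNge; apply/negP => hj; apply: h; exists j.
rewrite /sqc zmap_coord => h1.
have h2 : nc ((rho^-1)%:C%C * (c0 x 0 j - c0 x0 0 j)) <= 1.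
  rewrite leNgt; apply/negP => h2; move: h1; apply/negP; rewrite -leNgt.
  by rewrite exprn_ege1// ltW.
rewrite ncM nc_real gtr0_norm ?invr_gt0// mulrC ler_pdivrMr// mul1r in h2.
by split; [exact: le_trans (nc_Re _) h2|exact: le_trans (nc_Im _) h2].
Qed.

(** The chart domain and the complement of the core form an open cover, and [phi0] is 0 on the
    second set. *)
Lemma phi0_quasi_psh : quasi_psh phi0.
Proof.
move=> p; have [dp|ndp] := pselect (chart_dom c0 p).
  exists (chart_dom c0), (Psi A \o zmap), (vsq A \o zmap); split.
  - by split => //; exact: chart_dom_open.
  - exact: psh_on_chart.
  - exact: smooth_on_chart.
  - by move=> x dx; rewrite phi0E.
have oC : open (~` core) by exact/closed_openC/core_closed.
exists (~` core), (fun=> 0%E), (fun=> 0); split.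
- split => //; move=> [z hz zp]; apply: ndp.
  by have [x dx xz] := polysquare hz; rewrite -zp -xz chartK.
- split => [c ac|x Vx]; last by exists x => //; exact: connected_component_refl.
  split => [z _|z a _ h|z w _] //=.
    by apply/nbhs_nm; exists 1.
  by rewrite integral0 mule0.
- move=> c ac k; apply: (@Ck_on_bilinear _ _ k _ void
    (fun=> fun=> 0) (fun=> fun=> 0)) => [||[]|z _] //=.
    exact: cimg_uopen.
  by rewrite big1// => -[].
- by move=> x Vx; rewrite phi0_out// adde0.
Qed.

(** A majorant of [phi0] is thereby bounded below away from [x0], so its integrability is in
    question at [x0] only. *)
Lemma phi0_locally_bounded p : p <> x0 -> exists V (B : R), open_nbhs p V /\
  forall x, V x -> (B%:E <= phi0 x)%E.
Proof.
move=> px0; have [dp|ndp] := pselect (chart_dom c0 p); last first.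
  exists (~` core), 0; split; last by move=> x Vx; rewrite phi0_out.
  split; first exact/closed_openC/core_closed.
  move=> [z hz zp]; apply: ndp.
  by have [x dx xz] := polysquare hz; rewrite -zp -xz chartK.
have [j hj] : exists j, 0 < sqc (zmap p) j.
  apply/not_existsP => h; apply: px0; apply: zmap_eq0 dp _ => j.
  by rewrite leNgt; apply/negP/h.
pose d := sqc (zmap p) j / 2.
have d0 : 0 < d by rewrite divr_gt0.
have Uz : cimg c0 (chart_dom c0) (c0 p) by exists p.
have cj := @continuous_sqc _ _ (cimg c0 (chart_dom c0)) (zmap \o chart_inv c0)
  (fun j => zmap_hol j ac0) _ j Uz.
have N1 : nbhs (sqc ((zmap \o chart_inv c0) (c0 p)) j) [set t : R | d < t].
  by apply: lt_nbhsr; rewrite /= chartK// /d; lra.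
have N2 : nbhs (c0 p) [set z | d < sqc (zmap (chart_inv c0 z)) j] := cj _ N1.
have N3 : nbhs p [set x | d < sqc (zmap (chart_inv c0 (c0 x))) j] := chart_continuous dp N2.
have N4 : nbhs p (chart_dom c0) by apply: open_nbhs_nbhs; split; [exact: chart_dom_open|].
have : nbhs p ([set x | d < sqc (zmap (chart_inv c0 (c0 x))) j] `&` chart_dom c0).
  exact: filterI.
rewrite nbhsE => -[V oV sV].
exists V, (A j * Num.min 0 (ln d)); split => // x /sV[/= hx dx].
rewrite chartK// in hx; rewrite /phi0 asboolT//.
exact: Phi_bounded (ltW hx).
Qed.

End singular_function.

(** * Lebesgue measure and integrability of exponentials *)

Section tuple_boxes.
Context d (T : measurableType d) (R : realType).
Variable mu : {sigma_finite_measure set T -> \bar R}.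

Definition tbox m (I : 'I_m -> set T) : set (m.-tuple T) :=
  [set t | forall i, I i (tnth t i)].

Lemma tbox_measurable m (I : 'I_m -> set T) :
  (forall i, measurable (I i)) -> measurable (tbox I).
Proof.
move=> mI; rewrite (_ : tbox I = \bigcap_(i in setT) ((@tnth m T)^~ i @^-1` I i)); last first.
  by apply/seteqP; split => t /= ht i; [move=> _; exact: ht|exact: ht i Logic.I].
apply: fin_bigcap_measurable => [|i _]; first exact: finite_finset.
by rewrite -[X in measurable X]setTI; exact: measurable_tnth.
Qed.

Lemma tuple_measure_tbox m (I : 'I_m -> set T) :
  (forall i, measurable (I i)) ->
  tuple_measure mu m (tbox I) = (\prod_(i < m) mu (I i))%E.
Proof.
elim: m I => [|m ih] I mI.
  rewrite big_ord0 /= diracE mem_set//.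
  by move=> [].
rewrite big_ord_recl /= /tuple_cons_measure /pushforward.
rewrite (_ : _ @^-1` _ = I ord0 `*` tbox (fun i => I (lift ord0 i))); last first.
  apply/seteqP; split => -[x t] /= h.
    split; first by have := h ord0.
    by move=> i; have := h (lift ord0 i); rewrite tnthS.
  case: h => h1 h2 i; have [j ->|->] := unliftP ord0 i; last by [].
  by rewrite tnthS; exact: h2.
rewrite product_measure1E//; last by apply: tbox_measurable => i; exact: mI.
by rewrite ih// => i; exact: mI.
Qed.

End tuple_boxes.

Section open_tuples.
Variable R : realType.
Notation T := (measurableTypeR R).

Let dist_cell (x y p q : R) : p <= x -> x < p + q -> p <= y -> y < p + q ->
  `|y - x| <= q.
Proof. by move=> *; rewrite ler_norml; apply/andP; split; lra. Qed.

(** Measurable sets of tuples are generated by the coordinates, so an open set has to be written as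
    a countable union of boxes: here all grid cells of mesh [1 / (k + 1)] contained in [S]. *)
Lemma tuple_open_measurable m (S : set (m.-tuple T)) :
  (forall t, S t -> exists2 r : R, 0 < r & forall s : m.-tuple T,
     (forall i, `|tnth s i - tnth t i : R| < r) -> S s) -> measurable S.
Proof.
move=> oS.
pose C (q : nat * {ffun 'I_m -> int}) : set (m.-tuple T) :=
  tbox (fun i => [set` `[(q.2 i)%:~R / (q.1.+1)%:R, (q.2 i + 1)%:~R / (q.1.+1)%:R[ ] : set R).
pose D q : set (m.-tuple T) := if `[< C q `<=` S >] then C q else set0.
have -> : S = \bigcup_q D q.
  apply/seteqP; split => [t St|t [q _]]; last first.
    by rewrite /D; case: asboolP => // h /h.
  have [r r0 hr] := oS t St.
  pose k := Num.truncn r^-1.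
  have kr : (k.+1%:R)^-1 < r.
    by rewrite invf_plt ?posrE ?ltr0n// truncnS_gt.
  have k0 : 0 < k.+1%:R :> R by rewrite ltr0n.
  pose f := [ffun i : 'I_m => Num.floor ((tnth t i : R) * k.+1%:R)].
  have Ct : C (k, f) t.
    move=> i /=; rewrite in_itv/= ler_pdivrMr// ltr_pdivlMr// ffunE.
    by rewrite floor_le floorD1_gt.
  exists (k, f) => //; rewrite /D asboolT// => s Cs; apply: hr => i.
  have := Cs i; have := Ct i; rewrite /= !in_itv/= intrD mulrDl mulr1z mul1r.
  move=> /andP[a1 a2] /andP[b1 b2]; apply: le_lt_trans kr.
  exact: (dist_cell a1 a2 b1 b2).
apply: countable_bigcupT_measurable; first exact: countableP.
move=> q; rewrite /D; case: asboolP => // _; apply: tbox_measurable => i.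
exact: measurable_itv.
Qed.

End open_tuples.

Section lebesgue_boxes.
Variables (R : realType) (n : nat).
Notation E := 'rV[R[i]]_n.
Notation T := (measurableTypeR R).
Notation lam := (lebesgue_Cn R n).
Notation pull W := (@cvec R n @^-1` W : set ((n + n).-tuple T)).

Lemma pull_measurable (W : set E) : open W -> measurable (pull W).
Proof.
move=> oW; apply: tuple_open_measurable => t Wt.
have /nbhs_nm[r r0 hr] : nbhs (cvec t) W by exact: open_nbhs_nbhs.
have n0 : 0 < 2 * n.+1%:R :> R by rewrite mulr_gt0.
exists (r / (2 * n.+1%:R)); first by rewrite divr_gt0.
move=> s st; rewrite /= -(subrK (cvec t) (cvec s)) addrC; apply: hr.
apply: (@le_lt_trans _ _ (\sum_(j < n) r / n.+1%:R)).
  apply: ler_sum => j _; rewrite !mxE (le_trans (nc_le_ReIm _))//=.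
  have -> : r / n.+1%:R = r / (2 * n.+1%:R) + r / (2 * n.+1%:R).
    by field; rewrite addrC natr1 pnatr_eq0.
  by rewrite lerD// ltW//; exact: st.
rewrite sumr_const card_ord -[_ *+ n]mulr_natr mulrAC ltr_pdivrMr ?ltr0n//.
by rewrite ltr_pM2l// ltr_nat.
Qed.

Definition qbox (a : E) (r : 'I_n -> R) : set E := [set z | forall j,
  `|complex.Re (z 0 j - a 0 j)| < r j /\ `|complex.Im (z 0 j - a 0 j)| < r j].

Lemma pull_qbox a r : pull (qbox a r) = tbox (fun i : 'I_(n + n) =>
  match fintype.split i with
  | inl j => `]complex.Re (a 0 j) - r j, complex.Re (a 0 j) + r j[
  | inr j => `]complex.Im (a 0 j) - r j, complex.Im (a 0 j) + r j[ end%classic : set T).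
Proof.
apply/seteqP; split => t /= ht.
  move=> i; case: splitP => j ij /=; have [] := ht j;
      rewrite !mxE !(ReD, ReN, ImD, ImN) /= in_itv/=.
    by move=> + _; rewrite ltr_distl (_ : lshift n j = i)//; exact: val_inj.
  by move=> _; rewrite ltr_distl (_ : rshift n j = i)//; exact: val_inj.
move=> j; rewrite !mxE !(ReD, ReN, ImD, ImN) /=; split.
  have := ht (lshift n j); rewrite (unsplitK (inl j)) /= in_itv/=.
  by rewrite ltr_distl.
have := ht (rshift n j); rewrite (unsplitK (inr j)) /= in_itv/=.
by rewrite ltr_distl.
Qed.

Lemma pull_qbox_measurable a r : measurable (pull (qbox a r)).
Proof.
by rewrite pull_qbox; apply: tbox_measurable => i; case: fintype.split => j; exact: measurable_itv.
Qed.

Lemma lebesgue_qbox a r : (forall j, 0 <= r j) ->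
  lam (pull (qbox a r)) = (\prod_(j < n) (2 * r j) ^+ 2)%:E.
Proof.
move=> r0; rewrite pull_qbox tuple_measure_tbox; last first.
  by move=> i; case: fintype.split => j; exact: measurable_itv.
have mu_itv (x s : R) : 0 <= s ->
    lebesgue_measure (`]x - s, x + s[%classic : set R) = (2 * s)%:E.
  move=> s0; rewrite lebesgue_measure_itv/= lte_fin.
  have -> : 2 * s = (x + s) - (x - s) by ring.
  case: ifPn => [_|]; first by rewrite EFinB.
  by rewrite -leNgt => h; congr (_%:E); lra.
rewrite big_split_ord/=.
under eq_bigr => j _ do rewrite (unsplitK (inl j)) mu_itv//.
under [X in (_ * X)%E]eq_bigr => j _ do rewrite (unsplitK (inr j)) mu_itv//.
by rewrite -big_split/= [RHS](big_morph EFin EFinM erefl).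
Qed.

Lemma qbox_nm a (r : R) z : nm (z - a) < r -> qbox a (fun=> r) z.
Proof.
move=> h j; have := nm_coord (z - a) j; rewrite !mxE => hj.
by split; [exact: le_lt_trans (nc_Re _) (le_lt_trans hj h)|
           exact: le_lt_trans (nc_Im _) (le_lt_trans hj h)].
Qed.

End lebesgue_boxes.

(** * Integrability of exponentials by level sets *)

Section exponential_integrability.
Variables (R : realType) (n : nat).
Notation E := 'rV[R[i]]_n.
Notation T := (measurableTypeR R).
Notation lam := (lebesgue_Cn R n).
Notation pull W := (@cvec R n @^-1` W : set ((n + n).-tuple T)).

(** The integrand of [multiplier_ideal] for the section 1, kept in the form in which it unfolds
    there. *)
Definition weight (u : \bar R) : \bar R :=
  ((nc (1 : R[i]) ^+ 2)%:E * expeR (- (2%:E * u)))%E.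

Lemma weightE u : weight u = expeR (- (2%:E * u))%E.
Proof. by rewrite /weight nc1 expr1n mul1e. Qed.

Lemma weight_ge0 u : (0 <= weight u)%E.
Proof. by rewrite weightE expeR_ge0. Qed.

Lemma weightNy : weight -oo%E = +oo%E.
Proof. by rewrite weightE gt0_muleNy ?lte_fin. Qed.

Lemma weight_fin (x : R) : weight x%:E = (expR (- (2 * x)))%:E.
Proof. by rewrite weightE. Qed.

Lemma lt_weight (a : R) u : (u < +oo)%E ->
  (a%:E < weight u)%E = (a <= 0) || (u < (- (ln a / 2))%:E)%E.
Proof.
have [a0|a0] := leP a 0.
  case: u => [x| |] // _; last by rewrite weightNy ltry.
  by rewrite weight_fin lte_fin (le_lt_trans a0)// expR_gt0.
case: u => [x| |] // _; last by rewrite weightNy ltry ltNyr.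
by rewrite weight_fin !lte_fin -{1}(lnK (x := a)) ?posrE// ltr_expR; apply/idP/idP; lra.
Qed.

Lemma usc_open (W : set E) (u : E -> \bar R) : open W ->
  (forall z (b : R), W z -> (u z < b%:E)%E -> \forall y \near z, (u y < b%:E)%E) ->
  forall b : R, open (W `&` [set z | (u z < b%:E)%E]).
Proof.
move=> oW usc b; rewrite openE => z [Wz uz]; apply: filterI; last exact: usc.
exact: open_nbhs_nbhs.
Qed.

Lemma weight_measurable (W : set E) (u : E -> \bar R) : open W ->
  (forall z, W z -> (u z < +oo)%E) ->
  (forall z (b : R), W z -> (u z < b%:E)%E -> \forall y \near z, (u y < b%:E)%E) ->
  measurable_fun (pull W) (fun t => weight (u (cvec t))).
Proof.
move=> oW ufin usc.
have mW := pull_measurable oW.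
apply: (measurability _ (ErealGenOInfty.measurableE R)) => // _ [_ [a ->] <-].
have [a0|a0] := leP a 0.
  rewrite (_ : _ `&` _ = pull W); first exact: pull_measurable.
  apply/seteqP; split => [t []//|t Wt]; split => //=.
  by rewrite in_itv/= andbT lt_weight ?a0// ufin.
rewrite (_ : _ `&` _ = pull (W `&` [set z | (u z < (- (ln a / 2))%:E)%E])).
  exact: (pull_measurable (@usc_open W u oW usc (- (ln a / 2)))).
apply/seteqP; split => t /=; rewrite in_itv/= andbT => -[Wt h]; split => //.
  by move: h; rewrite lt_weight ?ufin// leNgt a0.
by rewrite lt_weight ?ufin// h orbT.
Qed.

Lemma geometric_partial (q : R) N : 0 <= q < 1 ->
  \sum_(0 <= k < N) q ^+ k <= (1 - q)^-1.
Proof.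
move=> /andP[q0 q1]; have q10 : 0 < 1 - q by rewrite subr_gt0.
have -> : \sum_(0 <= k < N) q ^+ k = (1 - q ^+ N) / (1 - q).
  elim: N => [|N ih]; first by rewrite big_nil expr0 subrr mul0r.
  by rewrite big_nat_recr//= ih exprS; field; rewrite gt_eqF.
rewrite -[leRHS]mul1r ler_pM2r ?invr_gt0//.
by rewrite lerBlDr lerDl exprn_ge0.
Qed.

(** Where [- (m + 1) <= u < - m] with [k0 <= m], the term of level [m] alone dominates
    [expR (- 2 u)]. At [-oo] all terms are present and the series diverges. *)
Lemma weight_le_series (u : \bar R) (k0 : nat) : (u < +oo)%E ->
  (weight u <= (expR (2 * k0%:R))%:E + \sum_(0 <= k <oo)
     ((expR (2 * (k0 + k).+1%:R))%:E * (u < (- (k0 + k)%:R)%:E)%E%:R%:E))%E.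
Proof.
move=> uy.
pose g (k : nat) : \bar R := ((expR (2 * (k0 + k).+1%:R))%:E *
  (u < (- (k0 + k)%:R)%:E)%E%:R%:E)%E.
rewrite -/(\sum_(0 <= k <oo) g k)%E.
have g0 k : (0 <= g k)%E by rewrite /g mule_ge0 ?lee_fin ?expR_ge0.
have gS k : (g k <= \sum_(0 <= k <oo) g k)%E.
  have := @nneseries_lim_ge R g xpredT 0%N k.+1 (fun n _ _ => g0 n).
  apply: le_trans; rewrite big_nat_recr//= leeDr//.
  by apply: sume_ge0 => i _; exact: g0.
have S0 : (0 <= \sum_(0 <= k <oo) g k)%E by rewrite nneseries_ge0// => i _ _; exact: g0.
have e0 : (0 <= (expR (2 * k0%:R) : R)%:E)%E by rewrite lee_fin expR_ge0.
case: u uy @g g0 gS S0 => [x| |] // _ g g0 gS S0.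
- rewrite weight_fin; have [xk|xk] := leP (- k0%:R) x.
    apply: (@le_trans _ _ (expR (2 * k0%:R))%:E); last by rewrite leeDl.
    by rewrite lee_fin ler_expR; lra.
  have x0 : 0 <= k0%:R :> R by [].
  pose k := (Num.truncn (- x)).
  have nx0 : 0 <= - x by lra.
  have /andP[k1 k2] := truncn_itv nx0; rewrite -/k in k1 k2.
  (* [k <= -x < k + 1], and the term needs a strict inequality *)
  pose m := if - x == k%:R then k.-1 else k.
  have [mk mx] : m%:R < - x /\ - x <= m.+1%:R.
    rewrite /m; case: eqP => [e|/eqP ne]; last first.
      by rewrite lt_neqAle k1 eq_sym ne (ltW k2).
    have kp : (0 < k)%N by rewrite -(ltr0n R) -e; apply: le_lt_trans x0 _; lra.
    by rewrite e prednK// lexx ltr_nat ltn_predL.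
  have k0m : (k0 <= m)%N.
    by rewrite -ltnS -(ltr_nat R) (lt_le_trans _ mx)//; lra.
  have hm := gS (m - k0)%N; rewrite /g subnKC// in hm.
  rewrite lte_fin (_ : x < - m%:R) in hm; last by lra.
  rewrite mule1 in hm.
  apply: (@le_trans _ _ (expR (2 * m.+1%:R))%:E).
    by rewrite lee_fin ler_expR; lra.
  by apply: (le_trans hm); rewrite leeDr.
- rewrite weightNy (_ : (\sum_(0 <= k <oo) g k = +oo)%E) ?addey//.
  apply/eqyP => B B0; apply: le_trans (gS (Num.truncn B)).
  rewrite /g ltNyr mule1 lee_fin.
  apply: (le_trans (ltW (truncnS_gt B))).
  apply: le_trans (expR_ge1Dx _).
  have : (Num.truncn B).+1%:R <= (k0 + Num.truncn B).+1%:R :> R.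
    by rewrite ler_nat ltnS leq_addl.
  by have := ler0n R (k0 + Num.truncn B).+1; lra.
Qed.

(** The sublevel set at [- k] carries the coefficient [expR (2 * (k + 1))], which cancels the
    exponential in its volume up to [expR 2] and leaves a geometric series. The box makes the
    measure of [W] finite, for the constant term. *)
Lemma weight_integrable (W : set E) (u : E -> \bar R) (a : E) (r C q : R) (k0 : nat) :
  open W -> W `<=` qbox a (fun=> r) -> 0 <= r ->
  (forall z, W z -> (u z < +oo)%E) ->
  (forall z (b : R), W z -> (u z < b%:E)%E -> \forall y \near z, (u y < b%:E)%E) ->
  0 <= C -> 0 <= q < 1 ->
  (forall k, (k0 <= k)%N ->
    (lam (pull (W `&` [set z | u z < (- k%:R)%:E]%E)) <=
       (C * expR (- (2 * k%:R)) * q ^+ k)%:E)%E) ->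
  lam.-integrable (pull W) (fun t => weight (u (cvec t))).
Proof.
move=> oW Wr r0 ufin usc C0 q01 vol.
have mW := pull_measurable oW.
have mA (k : nat) := pull_measurable (@usc_open W u oW usc (- k%:R)).
have mw := weight_measurable oW ufin usc.
apply/integrableP; split => //.
under eq_integral do rewrite gee0_abs ?weight_ge0//.
pose h k (t : (n + n).-tuple T) : \bar R := ((expR (2 * (k0 + k).+1%:R))%:E *
  (\1_(pull (W `&` [set z | u z < (- (k0 + k)%:R)%:E]%E)) t)%:E)%E.
have h0 k t : (0 <= h k t)%E by rewrite mule_ge0 ?lee_fin ?expR_ge0.
have mh k : measurable_fun (pull W) (h k).
  apply: measurable_funeM; apply/measurable_EFinP.
  by apply: measurable_indic; exact: mA.
have mS : measurable_fun (pull W) (fun t => \sum_(0 <= k <oo) h k t)%E.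
  exact (@ge0_emeasurable_sum _ _ R (pull W) h xpredT (fun k x _ _ => h0 k x)
    (fun k _ => mh k)).
have wh t : pull W t ->
    (weight (u (cvec t)) <= (expR (2 * k0%:R))%:E + \sum_(0 <= k <oo) h k t)%E.
  move=> Wt; apply: le_trans (weight_le_series k0 (ufin _ Wt)) _.
  rewrite leeD2l//; apply: lee_nneseries => [k _ _|k _].
    by rewrite mule_ge0 ?lee_fin ?expR_ge0.
  rewrite /h indicE; case: (boolP (u _ < _)%E) => hk.
    by rewrite mem_set.
  by rewrite memNset// => -[_ /= hk']; move: hk; rewrite hk'.
apply: (@le_lt_trans _ _ (\int[lam]_(t in pull W)
    ((expR (2 * k0%:R))%:E + \sum_(0 <= k <oo) h k t))%E).
  apply: ge0_le_integral => //.
  - by move=> t _; exact: weight_ge0.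
  - exact (emeasurable_funD (@measurable_cst _ _ _ _ _ (expR (2 * k0%:R))%:E) mS).
rewrite ge0_integralD//; last by move=> t _; rewrite nneseries_ge0.
rewrite (integral_cst lam mW) integral_nneseries// lte_add_pinfty//.
  rewrite lte_mul_pinfty ?lee_fin ?expR_ge0//.
  apply: (@le_lt_trans _ _ (lam (pull (qbox a (fun=> r))))).
    apply: le_measure; rewrite ?inE//; first exact: pull_qbox_measurable.
    by move=> t /Wr.
  by rewrite lebesgue_qbox// ltry.
apply: (@le_lt_trans _ _ (C * expR 2 / (1 - q))%:E); last exact: ltry.
have /andP[q0 q1] := q01.
apply: lime_le.
  by apply: is_cvg_nneseries => k _ _; apply: integral_ge0 => t _; exact: h0.
apply: nearW => N.
apply: (@le_trans _ _ (\sum_(0 <= k < N) (C * expR 2 * q ^+ k)%:E)%E).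
  apply: lee_sum => k _.
  rewrite ge0_integralZl//; last first.
    by apply/measurable_EFinP; apply: measurable_indic; exact: mA.
  rewrite integral_indic//.
  rewrite (_ : _ `&` _ = pull (W `&` [set z | u z < (- (k0 + k)%:R)%:E]%E)); last first.
    by apply/seteqP; split => t /=; [case|move=> h1; split => //; case: h1].
  apply: (@le_trans _ _ ((expR (2 * (k0 + k).+1%:R))%:E *
     (C * expR (- (2 * (k0 + k)%:R)) * q ^+ (k0 + k))%:E)%E).
    by rewrite lee_pmul2l// ?lte_fin ?expR_gt0// vol// leq_addr.
  rewrite -EFinM lee_fin.
  have -> : expR (2 * (k0 + k).+1%:R) = expR 2 * expR (2 * (k0 + k)%:R) :> R.
    by rewrite -expRD; congr expR; rewrite -natr1; ring.
  rewrite [leLHS](_ : _ = C * expR 2 * q ^+ (k0 + k) *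
     (expR (2 * (k0 + k)%:R) * expR (- (2 * (k0 + k)%:R)))); last by ring.
  rewrite -expRD subrr expR0 mulr1 ler_wpM2l ?mulr_ge0 ?expR_ge0//.
  by rewrite exprD ler_piMl ?exprn_ge0// exprn_ile1// ltW.
rewrite sumEFin lee_fin -mulr_sumr ler_wpM2l ?mulr_ge0 ?expR_ge0//.
exact: geometric_partial.
Qed.

End exponential_integrability.

Section exponential_divergence.
Variables (R : realType) (n : nat).
Notation E := 'rV[R[i]]_n.
Notation T := (measurableTypeR R).
Notation lam := (lebesgue_Cn R n).
Notation pull W := (@cvec R n @^-1` W : set ((n + n).-tuple T)).

Lemma sum_expR_le (P : nat -> bool) N :
  \sum_(0 <= j < N) expR (2 * j%:R) * (P j)%:R <= expR (2 * N%:R) :> R.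
Proof.
elim: N => [|N ih]; first by rewrite big_nil expR_ge0.
rewrite big_nat_recr//= -[N.+1%:R]natr1 (_ : 2 * (N%:R + 1) = 2 * N%:R + 2); last by ring.
rewrite expRD; have e2 : 3 <= expR 2 :> R by apply: le_trans (expR_ge1Dx _); lra.
have e0 := expR_ge0 (2 * N%:R : R).
apply: (@le_trans _ _ (expR (2 * N%:R) * 3)); last by rewrite ler_wpM2l.
by case: (P N); rewrite ?mulr1 ?mulr0; lra.
Qed.

(** The sum of [expR (2 * j)] over the levels reached by [u] is at most twice its largest term, and
    that term is at most [weight u]. *)
Lemma sum_expR_weight (P : nat -> bool) (u : \bar R) N :
  (forall j, P j -> (u <= (- j%:R)%:E)%E) ->
  ((\sum_(0 <= j < N) expR (2 * j%:R) * (P j)%:R)%:E <= 2%:E * weight u)%E.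
Proof.
move=> hP; elim: N => [|N ih].
  by rewrite big_nil mule_ge0 ?lee_fin// weight_ge0.
rewrite big_nat_recr//=; case: (boolP (P N)) => hN; last by rewrite mulr0 addr0.
have := hP _ hN; case: u {ih hP} => [x| |] //; last first.
  by move=> _; rewrite weightNy gt0_muley ?lte_fin// leey.
rewrite lee_fin weight_fin -EFinM lee_fin => xN; rewrite mulr1.
have := sum_expR_le P N.
have : expR (2 * N%:R) <= expR (- (2 * x)) by rewrite ler_expR; lra.
lra.
Qed.

(** Each level contributes at least [c] to twice the integral, since [expR (2 * k)] compensates the
    volume of [B k]; the number of levels is unbounded. *)
Lemma weight_not_integrable (W : set E) (u : E -> \bar R) (B : nat -> set E) (c : R)
    (k0 : nat) : open W -> 0 < c ->
  (forall k, measurable (pull (B k))) ->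
  (forall k z, (k0 <= k)%N -> B k z -> W z /\ (u z <= (- k%:R)%:E)%E) ->
  (forall k, (k0 <= k)%N -> ((c * expR (- (2 * k%:R)))%:E <= lam (pull (B k)))%E) ->
  ~ lam.-integrable (pull W) (fun t => weight (u (cvec t))).
Proof.
move=> oW c0 mB BW Bc /integrableP[mw].
under eq_integral do rewrite gee0_abs ?weight_ge0//.
set I := (X in (X < _)%E) => Ioo.
have mW := pull_measurable oW.
have I0 : (0 <= I)%E by apply: integral_ge0 => t _; exact: weight_ge0.
have If : I = (fine I)%:E by rewrite fineK// ge0_fin_numE.
pose D k := if (k0 <= k)%N then pull (B k) else set0.
have mD k : measurable (D k) by rewrite /D; case: ifP.
pose h k (t : (n + n).-tuple T) : \bar R := (expR (2 * k%:R) * \1_(D k) t)%:E.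
have h0 k t : (0 <= h k t)%E by rewrite lee_fin mulr_ge0 ?expR_ge0.
have mh k : measurable_fun (pull W) (h k).
  apply/measurable_EFinP; apply: measurable_funM; first exact: measurable_cst.
  exact: measurable_indic.
have bnd N : ((N%:R * c)%:E <= 2%:E * I)%E.
  apply: (@le_trans _ _ (\int[lam]_(t in pull W) (\sum_(k < k0 + N) h k t))%E).
    rewrite ge0_integral_sum// big_split_ord/=.
    apply: (@le_trans _ _ (\sum_(j < N) c%:E)%E).
      by rewrite sumEFin lee_fin sumr_const card_ord mulr_natl.
    rewrite -[leLHS]add0e leeD//.
      by apply: sume_ge0 => j _; apply: integral_ge0 => t _; exact: h0.
    apply: lee_sum => j _.
    rewrite /h; under eq_integral => t _ do rewrite EFinM.
    rewrite ge0_integralZl//; last first.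
      by apply/measurable_EFinP; exact: measurable_indic.
    rewrite integral_indic// /D leq_addr.
    rewrite (_ : _ `&` _ = pull (B (k0 + j)%N)); last first.
      apply/seteqP; split => t /=; first by case.
      by move=> Bt; split => //; have [] := BW _ _ (leq_addr j k0) Bt.
    apply: (@le_trans _ _ ((expR (2 * (k0 + j)%:R))%:E *
        (c * expR (- (2 * (k0 + j)%:R)))%:E)%E).
      by rewrite -EFinM lee_fin mulrCA -expRD subrr expR0 mulr1.
    by rewrite lee_pmul2l// ?lte_fin ?expR_gt0// Bc// leq_addr.
  rewrite /I -ge0_integralZl//; last by move=> t _; exact: weight_ge0.
  apply: ge0_le_integral => //.
  - by move=> t _; apply: sume_ge0.
  - exact (emeasurable_sum _ (fun k : 'I_(k0 + N) => mh k)).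
  - exact (measurable_funeM _ mw).
  - move=> t Wt; rewrite sumEFin.
    have := @sum_expR_weight (fun j => (k0 <= j)%N && (t \in pull (B j))) (u (cvec t)) (k0 + N).
    rewrite big_mkord; under eq_bigr => j _.
      rewrite (_ : (_ && _)%:R = \1_(D j) t); first over.
      by rewrite indicE /D; case: ifP => //=; rewrite in_set0.
    by apply=> j /andP[k0j]; rewrite inE => /(BW _ _ k0j)[].
have := bnd (Num.truncn (2 * fine I / c)).+1.
rewrite If -EFinM lee_fin leNgt => /negP; apply.
by rewrite -ltr_pdivrMr// truncnS_gt.
Qed.

End exponential_divergence.

(** * Leading monomials *)

Lemma fin_pos_lower_bound (R : realType) (I : finType) (f : I -> R) (r : R) : 0 < r ->
  (forall i, 0 < f i) -> exists2 e : R, 0 < e & e <= r /\ forall i, e <= f i.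
Proof.
move=> r0 f0; exists (\big[Num.min/r]_i f i).
  by elim/big_ind: _ => // x y x0 y0; rewrite lt_min x0.
by split=> [|i]; [exact: bigmin_le_id|exact: bigmin_le_cond].
Qed.

Section taylor_expansion.
Variables (R : realType) (n : nat).
Notation E := 'rV[R[i]]_n.
Notation X := {ffun 'I_n -> nat}.
Implicit Types (z w : E) (m : X) (f : E -> R[i]).

Definition mono m z : R[i] := \prod_i z 0 i ^+ m i.

Definition mdeg m : nat := (\sum_i m i)%N.

Definition madd m (j : 'I_n) : X := [ffun i => (m i + (i == j))%N].

Lemma mono_scale m z x : mono m (x *: z) = x ^+ mdeg m * mono m z.
Proof.
rewrite /mono /mdeg -prodrXr -big_split/=.
by apply: eq_bigr => i _; rewrite mxE exprMn.
Qed.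

Lemma mono_madd m j z : mono (madd m j) z = z 0 j * mono m z.
Proof.
rewrite /mono; under eq_bigr => i _ do rewrite ffunE exprD.
rewrite big_split/= mulrC; congr (_ * _).
rewrite (bigD1 j)//= eqxx expr1 big1 ?mulr1// => i /negPf->.
by rewrite expr0.
Qed.

Lemma nc_mono m z : nc (mono m z) = \prod_i nc (z 0 i) ^+ m i.
Proof. by rewrite nc_prod; apply: eq_bigr => i _; rewrite ncX. Qed.

Definition mpolyn (s : seq (R[i] * X)) z := \sum_(q <- s) q.1 * mono q.2 z.

Lemma cder_sum (I : Type) (s : seq I) (F : I -> R[i] -> R[i]) a (d : I -> R[i]) :
  (forall i, cder (F i) a (d i)) ->
  cder (fun x => \sum_(i <- s) F i x) a (\sum_(i <- s) d i).
Proof.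
move=> Fd; elim: s => [|i s ih].
  rewrite big_nil; apply: cder_congr (ltr01 : 0 < 1 :> R) _ (cder_cst 0 a) => h _.
  by rewrite big_nil.
rewrite big_cons; apply: cder_congr (ltr01 : 0 < 1 :> R) _ (cderD (Fd i) ih) => h _.
by rewrite big_cons.
Qed.

Lemma cder_exp a k : cder (fun x : R[i] => x ^+ k.+1) a (k.+1%:R * a ^+ k).
Proof.
elim: k => [|k ih].
  by rewrite expr0 mulr1; exact: cder_congr (ltr01 : 0 < 1 :> R) (fun=> fun=> erefl) (cder_id a).
have := cderM (cder_id a) ih.
rewrite (_ : _ + _ = k.+2%:R * a ^+ k.+1); last first.
  by rewrite -[k.+2%:R]natr1 exprS; ring.
move=> h; apply: cder_congr (ltr01 : 0 < 1 :> R) _ h => y _.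
by rewrite /= -exprS.
Qed.

Lemma Dw_sum (I : Type) (s : seq I) f (U : E -> Prop) (c : I -> R[i]) (w : I -> E) z :
  uopen U -> hol f U -> U z ->
  Dw f (\sum_(i <- s) c i *: w i) z = \sum_(i <- s) c i * Dw f (w i) z.
Proof.
move=> oU hf Uz; elim: s => [|i s ih]; first by rewrite !big_nil (Dw0 hf Uz).
by rewrite !big_cons (DwD _ _ oU hf Uz) ih (DwZ _ _ hf Uz).
Qed.

(** Induction on the order. The expansions of the partial derivatives are integrated along the
    segment from 0 to [z]: a monomial of degree e times z_j gives one of degree e + 1, divided by e
    + 1, and the remainder gains a factor [nm z]. *)
Lemma taylor K f r : 0 < r -> hol f (bl 0 r) ->
  exists s, exists r' C : R, [/\ 0 < r', 0 <= C &
    forall z, nm z < r' -> nc (f z - mpolyn s z) <= C * nm z ^+ K].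
Proof.
elim: K f r => [|K ih] f r r0 hf.
  have [r' [C [r'0 C0] fC]] := hol_bounded (@bl_open _ _ 0 r) hf (bl_center 0 r0).
  exists [::], r', C; split => // z zr.
  rewrite /mpolyn big_nil subr0 expr0 mulr1; apply: (fC _ _).2.
  by rewrite /bl subr0.
pose e j : E := delta_mx 0 j.
have hg j : hol (Dw f (e j)) (bl 0 r) by apply: hol_Dw => //; exact: bl_open.
have /choice[p hp] : forall j, exists p : seq (R[i] * X) * (R * R),
    [/\ 0 < p.2.1, 0 <= p.2.2 & forall z, nm z < p.2.1 ->
       nc (Dw f (e j) z - mpolyn p.1 z) <= p.2.2 * nm z ^+ K].
  by move=> j; have [s [r' [C h]]] := ih _ _ r0 (hg j); exists (s, (r', C)).
have [|r1 r10 [r1r r1p]] := fin_pos_lower_bound (f := fun j => (p j).2.1) r0.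
  by move=> j; case: (hp j).
pose s := (f 0, [ffun=> 0%N] : X) ::
  flatten [seq [seq (q.1 / (mdeg q.2).+1%:R, madd q.2 j) | q <- (p j).1] | j <- enum 'I_n].
have sE z : mpolyn s z = f 0 + \sum_j \sum_(q <- (p j).1)
    q.1 / (mdeg q.2).+1%:R * (z 0 j * mono q.2 z).
  rewrite /mpolyn big_cons/= {1}/mono big1 ?mulr1; last by move=> i _; rewrite ffunE expr0.
  rewrite big_flatten/= big_map big_enum/=; congr (_ + _); apply: eq_bigr => j _.
  by rewrite big_map; apply: eq_bigr => q _; rewrite mono_madd.
exists s, r1, (\sum_j (p j).2.2); split => //.
  by apply: sumr_ge0 => j _; case: (hp j).
move=> z zr1.
pose F x := f (x *: z) - mpolyn s (x *: z).
pose F' (t : R) := \sum_j z 0 j * (Dw f (e j) (t%:C%C *: z) - mpolyn (p j).1 (t%:C%C *: z)).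
have nt (t : R) : 0 <= t <= 1 -> nm (t%:C%C *: z) <= nm z.
  by move=> /andP[t0 t1]; rewrite nmZ nc_real ger0_norm// ler_piMl ?nm_ge0.
have F0 : F 0 = 0.
  rewrite /F scale0r sE big1 ?addr0 ?subrr// => j _.
  by rewrite big1// => q _; rewrite !mxE mul0r mulr0.
have F1 : F 1 = f z - mpolyn s z by rewrite /F scale1r.
rewrite -F1 -[F 1]subr0 -F0; apply: (@segment_bound R F F').
- move=> t t01; rewrite /F /F'.
  have zt : bl 0 r (0 + t%:C%C *: z).
    by rewrite /bl add0r subr0 (le_lt_trans (nt _ t01))// (lt_le_trans zr1).
  have d1 := hol_line hf zt; rewrite add0r in zt d1.
  have d2 : cder (fun x => \sum_j \sum_(q <- (p j).1)
      (q.1 / (mdeg q.2).+1%:R * (z 0 j * mono q.2 z)) * x ^+ (mdeg q.2).+1) t%:C%C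
      (\sum_j \sum_(q <- (p j).1) (q.1 / (mdeg q.2).+1%:R * (z 0 j * mono q.2 z)) *
         ((mdeg q.2).+1%:R * t%:C%C ^+ mdeg q.2)).
    by apply: cder_sum => j; apply: cder_sum => q; apply: cderZ; exact: cder_exp.
  have := cderB (cderB d1 (cder_cst (f 0) t%:C%C)) d2.
  have -> : Dw f z (t%:C%C *: z) = \sum_j z 0 j * Dw f (e j) (t%:C%C *: z).
    by rewrite {1}[z]row_sum_delta (Dw_sum _ _ _ (@bl_open _ _ 0 r) hf zt).
  rewrite subr0 -sumrB => d3.
  rewrite (_ : \sum_j _ = \sum_(j < n) (z 0 j * Dw f (e j) (t%:C%C *: z) -
    \sum_(q <- (p j).1) (q.1 / (mdeg q.2).+1%:R * (z 0 j * mono q.2 z)) *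
         ((mdeg q.2).+1%:R * t%:C%C ^+ mdeg q.2))); last first.
    apply: eq_bigr => j _; rewrite mulrBr; congr (_ - _).
    rewrite /mpolyn mulr_sumr; apply: eq_bigr => q _; rewrite mono_scale.
    by field; rewrite nat1r pnatr_eq0.
  apply: cder_congr (ltr01 : 0 < 1 :> R) _ d3 => h _.
  rewrite /cline add0r sE opprD addrA; congr (_ - _).
  apply: eq_bigr => j _; apply: eq_bigr => q _; rewrite mono_scale mxE exprS; ring.
- move=> t t01; apply: le_trans (nc_sum _ _ _) _; rewrite mulr_suml.
  apply: ler_sum => j _; rewrite ncM exprS mulrCA ler_pM ?nc_ge0 ?nm_coord//.
  have [_ C0 hC] := hp j.
  apply: le_trans (hC _ _) _.
    by rewrite (le_lt_trans (nt _ t01))// (lt_le_trans zr1).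
  by rewrite ler_wpM2l// lerXn2r ?nnegrE ?nm_ge0// nt.
Qed.

(** [taylor] may list an exponent several times, once for each order of differentiation; a leading
    monomial makes sense only after equal exponents are merged. *)
Lemma mpolyn_collect s : exists a : X -> R[i], exists2 l : seq X, uniq l &
  forall z, mpolyn s z = \sum_(m <- l) a m * mono m z.
Proof.
exists (fun m => \sum_(q <- s | q.2 == m) q.1), (undup (map snd s)).
  exact: undup_uniq.
move=> z; under eq_bigr => m _ do rewrite mulr_suml big_mkcond.
rewrite exchange_big/=; apply: eq_big_seq => q qs.
rewrite (bigD1_seq q.2) ?undup_uniq ?mem_undup ?map_f//= eqxx big1 ?addr0//.
by move=> m; rewrite eq_sym => /negPf->.
Qed.

End taylor_expansion.

(** * Weights that separate exponents *)

Section generic_weights.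
Variables (R : realType) (n : nat).
Notation X := {ffun 'I_n -> nat}.

Definition dotw (w : 'I_n -> R) (m : X) : R := \sum_i (m i)%:R * w i.

Lemma roots_finite (p : {poly R}) : p != 0 -> finite_set [set x | root p x].
Proof.
move=> p0; have [//|/(infinite_set_fset (size p))[B BA sB]] :=
  pselect (finite_set [set x | root p x]).
have := @max_poly_roots _ p (finmap.enum_fset B) p0; rewrite finmap.fset_uniq => /(_ _ isT).
rewrite ltnNge sB => h; have : all (root p) (finmap.enum_fset B) by apply/allP => x /BA.
by move/h.
Qed.

(* The weights are normalised powers of a number that is a root of no integer
   polynomial of degree less than n: only countably many numbers are excluded. *)
Lemma generic_weights : (0 < n)%N -> exists w : 'I_n -> R,
  [/\ forall i, 0 < w i, \sum_i w i = 1 & injective (dotw w)].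
Proof.
move=> n0.
pose P (q : X * X) : {poly R} :=
  \poly_(i < n) (if insub i is Some j then (q.1 j)%:R - (q.2 j)%:R else 0).
have PE q t : (P q).[t] = \sum_(i < n) ((q.1 i)%:R - (q.2 i)%:R) * t ^+ i.
  by rewrite horner_poly; apply: eq_bigr => i _; rewrite valK.
have P0 q : q.1 != q.2 -> P q != 0.
  apply: contra_neqN => /eqP h.
  apply/ffunP => i; apply/eqP.
  have := congr1 (fun p : {poly R} => p`_i) h.
  rewrite coef_poly ltn_ord valK coef0 => /eqP.
  by rewrite subr_eq0 eqr_nat.
pose bad := \bigcup_(q in [set q : X * X | q.1 != q.2]) [set x | root (P q) x].
have cbad : countable bad.
  by apply: bigcup_countable => // q /= hq; exact/finite_set_countable/roots_finite/P0.
have [tau [tau0 ntau]] : exists tau : R, 0 < tau /\ ~ bad tau.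
  apply: contrapT => h.
  have sub : (`]0, 1[%classic : set R) `<=` bad.
    move=> x /=; rewrite in_itv/= => /andP[x0 x1].
    by apply: contrapT => nb; apply: h; exists x.
  have := countable_lebesgue_measure0 (sub_countable (subset_card_le sub) cbad).
  by rewrite lebesgue_measure_itv/= lte_fin ltr01 sube0 => /eqP; rewrite eqe oner_eq0.
pose S := \sum_(i < n) tau ^+ i.
have S0 : 0 < S.
  rewrite /S (bigD1 (Ordinal n0))//= ltr_pwDl ?exprn_gt0// sumr_ge0// => i _.
  by rewrite exprn_ge0// ltW.
exists (fun i => tau ^+ i / S); split.
- by move=> i; rewrite divr_gt0// exprn_gt0.
- by rewrite -mulr_suml divff// gt_eqF.
move=> m m' e; apply/eqP; apply: contrapT => /negP mm'; apply: ntau.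
exists (m, m') => //=; rewrite /root PE/=; apply/eqP.
have E (k : X) : dotw (fun i => tau ^+ i / S) k * S = \sum_(i < n) (k i)%:R * tau ^+ i.
  by rewrite /dotw mulr_suml; apply: eq_bigr => i _; rewrite -mulrA divfK// gt_eqF.
under eq_bigr do rewrite mulrBl.
by rewrite sumrB -!E e subrr.
Qed.

End generic_weights.

Section exponential_comparison.
Variable R : realType.

Lemma expR_small (a e : R) : 0 < a -> 0 < e ->
  exists2 u0 : R, 0 <= u0 & forall u, u0 <= u -> expR (- (u * a)) <= e.
Proof.
move=> a0 e0; exists (e^-1 / a); first by rewrite divr_ge0 ?invr_ge0 ?ltW.
move=> u; rewrite ler_pdivrMr// => h; rewrite expRN -[e]invrK lef_pV2 ?posrE ?invr_gt0 ?expR_gt0//.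
by apply: le_trans (expR_ge1Dx _); lra.
Qed.

Lemma linear_bound (a D u0 : R) : (forall u, u0 <= u -> a * u <= D) -> a <= 0.
Proof.
move=> h; rewrite leNgt; apply/negP => a0.
have := h (Num.max u0 ((`|D| + 1) / a)); rewrite le_max lexx/= => /(_ isT).
apply/negP; rewrite -ltNge; apply: (@lt_le_trans _ _ (`|D| + 1)).
  by rewrite (le_lt_trans (ler_norm D))// ltrDl.
by rewrite mulrC -ler_pdivrMr// le_max lexx orbT.
Qed.

Lemma seq_gap (T : eqType) (L : seq T) (f : T -> R) (x : T) : x \in L ->
  exists y e, [/\ y \in L, f y <= f x, 0 < e,
    forall z, z \in L -> f y <= f z & forall z, z \in L -> f y < f z -> f y + e <= f z].
Proof.
move=> xL.
have [y [yL ymin]] : exists y, y \in L /\ forall z, z \in L -> f y <= f z.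
  elim: L x xL => // a L ih x _; case: L ih => [|b L] ih.
    by exists a; split=> [|z]; rewrite ?mem_seq1// => /eqP->.
  have [y [yL ymin]] := ih b (mem_head _ _).
  have [fay|fya] := leP (f a) (f y).
    exists a; rewrite mem_head; split => // z; rewrite in_cons => /orP[/eqP->//|zL].
    exact: le_trans fay (ymin _ zL).
  exists y; rewrite in_cons yL orbT; split => // z; rewrite in_cons => /orP[/eqP->|zL].
    exact: ltW.
  exact: ymin.
have [e e0 he] : exists2 e, 0 < e & forall z, z \in L -> f y < f z -> f y + e <= f z.
  clear xL yL ymin; elim: L => [|a L [e e0 he]]; first by exists 1.
  have [fay|fya] := leP (f a) (f y).
    exists e => // z; rewrite in_cons => /orP[/eqP->|zL]; last exact: he.
    by rewrite ltNge fay.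
  exists (Num.min e (f a - f y)); first by rewrite lt_min e0 subr_gt0.
  move=> z; rewrite in_cons -lerBrDl ge_min => /orP[/eqP->|zL] fz; first by rewrite lexx orbT.
  by rewrite lerBrDl he.
by exists y, e; split => //; exact: ymin.
Qed.

End exponential_comparison.

Section leading_monomial.
Variables (R : realType) (n : nat).
Notation E := 'rV[R[i]]_n.
Notation X := {ffun 'I_n -> nat}.
Implicit Types (s w : 'I_n -> R) (Z : E) (m : X) (u : R).

Lemma expR_dotw s m u :
  expR (- (u * dotw s m)) = \prod_i expR (- (u * s i)) ^+ m i.
Proof.
rewrite /dotw mulr_sumr -sumrN expR_sum; apply: eq_bigr => i _.
by rewrite -expRM_natl; congr expR; ring.
Qed.

Lemma mono_le s m u Z : (forall i, nc (Z 0 i) <= expR (- (u * s i))) ->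
  nc (mono m Z) <= expR (- (u * dotw s m)).
Proof.
move=> h; rewrite nc_mono expR_dotw; apply: ler_prod => i _.
by rewrite exprn_ge0 ?nc_ge0//= lerXn2r ?nnegrE ?nc_ge0 ?expR_ge0.
Qed.

Lemma mono_ge s m u Z : (forall i, expR (- (u * s i)) <= nc (Z 0 i)) ->
  expR (- (u * dotw s m)) <= nc (mono m Z).
Proof.
move=> h; rewrite nc_mono expR_dotw; apply: ler_prod => i _.
by rewrite exprn_ge0 ?expR_ge0//= lerXn2r ?nnegrE ?nc_ge0 ?expR_ge0.
Qed.

Lemma nm_decay s (wm u : R) Z : 0 <= u -> (forall i, wm <= s i) ->
  (forall i, nc (Z 0 i) <= expR (- (u * s i))) -> nm Z <= n%:R * expR (- (u * wm)).
Proof.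
move=> u0 ws h; rewrite mulr_natl -[X in _ *+ X]card_ord -sumr_const; apply: ler_sum => i _.
by apply: le_trans (h i) _; rewrite ler_expR lerN2 ler_wpM2l.
Qed.

Lemma nm_decay_small (wm r : R) : 0 < r -> 0 < wm -> exists2 u0 : R, 0 <= u0 &
  forall s u Z, u0 <= u -> (forall i, wm <= s i) ->
    (forall i, nc (Z 0 i) <= expR (- (u * s i))) -> nm Z < r.
Proof.
move=> r0 wm0; have e0 : 0 < r / n.+1%:R by rewrite divr_gt0.
have [u0 u00 small] := expR_small wm0 e0; exists u0 => // s u Z uu ws hZ.
apply: le_lt_trans (nm_decay (le_trans u00 uu) ws hZ) _.
apply: (@le_lt_trans _ _ (n%:R * (r / n.+1%:R))); first by rewrite ler_wpM2l ?small.
by rewrite mulrC -mulrA gtr_pMr// mulrC ltr_pdivrMr// mul1r ltr_nat.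
Qed.

Lemma decay_bound s (wm C nu r : R) (K : nat) (f : E -> R[i]) (a : X -> R[i]) (l : seq X) :
  0 <= C -> (forall i, wm <= s i) -> nu <= K%:R * wm ->
  (forall m, m \in l -> a m != 0 -> nu <= dotw s m) ->
  (forall Z, nm Z < r -> nc (f Z - \sum_(m <- l) a m * mono m Z) <= C * nm Z ^+ K) ->
  exists2 C', 0 <= C' & forall Z u, 0 <= u -> nm Z < r ->
    (forall i, nc (Z 0 i) <= expR (- (u * s i))) -> nc (f Z) <= C' * expR (- (u * nu)).
Proof.
move=> C0 ws nuK nul fC.
exists (\sum_(m <- l) nc (a m) + C * n%:R ^+ K).
  by rewrite addr_ge0 ?mulr_ge0 ?exprn_ge0// sumr_ge0// => m _; exact: nc_ge0.
move=> Z u u0 Zr hZ; rewrite -[f Z](subrK (\sum_(m <- l) a m * mono m Z)).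
apply: le_trans (ncD _ _) _; rewrite addrC mulrDl lerD//.
  apply: le_trans (nc_sum _ _ _) _; rewrite mulr_suml big_seq [leRHS]big_seq.
  apply: ler_sum => m ml; rewrite ncM; have [->|am] := eqVneq (a m) 0.
    by rewrite nc0 !mul0r.
  rewrite ler_wpM2l ?nc_ge0//; apply: le_trans (mono_le _ hZ) _.
  by rewrite ler_expR lerN2 ler_wpM2l// nul.
apply: le_trans (fC _ Zr) _; rewrite -mulrA ler_wpM2l//.
apply: (@le_trans _ _ ((n%:R * expR (- (u * wm))) ^+ K)).
  by rewrite lerXn2r ?nnegrE ?nm_ge0 ?mulr_ge0 ?expR_ge0// (nm_decay u0 ws hZ).
rewrite exprMn ler_wpM2l ?exprn_ge0// -expRM_natl ler_expR.
by rewrite mulrN lerN2 mulrCA ler_wpM2l.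
Qed.

End leading_monomial.

(** * Domination by the leading monomial *)

Section dominance.
Variables (R : realType) (n : nat).
Notation E := 'rV[R[i]]_n.
Notation X := {ffun 'I_n -> nat}.

Lemma le_div4 (x c g : R) : 0 < c -> x <= g / (4 * c) -> x * c <= g / 4.
Proof.
by move=> c0; rewrite ler_pdivlMr ?mulr_gt0// => h; rewrite ler_pdivlMr//; lra.
Qed.

(** On the curve |Z_i| = e^(-u s_i) the sum [S] is at most D e^(-2 u nu), while the coordinate [i1],
    whose weight is that of [w], gives the lower bound e^(-(u + B) / cc). The rates are compared as
    [u] grows. *)
Lemma ray_bound (w s : 'I_n -> R) (N : nat) (S : E -> R) (r cc B nu : R) (i1 : 'I_n)
    (G : 'I_N -> E -> R[i]) (C : 'I_N -> R) :
  0 < r -> 0 < cc -> (forall i, 0 < s i) -> s i1 = w i1 ->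
  (forall Z, S Z = \sum_k nc (G k Z) ^+ 2) ->
  (forall Z i t, nm Z < r -> expR (- (t * w i)) <= nc (Z 0 i) -> nc (Z 0 i) <= 1 ->
     expR (- ((t + B) / cc)) <= S Z) ->
  (forall k, 0 <= C k) ->
  (forall k Z u, 0 <= u -> nm Z < r ->
     (forall i, nc (Z 0 i) <= expR (- (u * s i))) -> nc (G k Z) <= C k * expR (- (u * nu))) ->
  2 * cc * nu <= 1.
Proof.
move=> r0 cc0 s0 si1 SE low C0 up.
have [wm wm0 [_ wms]] := fin_pos_lower_bound ltr01 s0.
have [u0 u00 small] := nm_decay_small n r0 wm0.
pose D := \sum_k C k ^+ 2 + 1.
have D0 : 0 < D by rewrite ltr_wpDl// sumr_ge0// => k _; rewrite exprn_ge0.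
have : 2 * nu - cc^-1 <= 0.
  apply: (@linear_bound _ _ (ln D + B / cc) u0) => u uu.
  have u_ge0 := le_trans u00 uu.
  pose Z : E := \row_i (expR (- (u * s i)))%:C%C.
  have ncZ i : nc (Z 0 i) = expR (- (u * s i)) by rewrite mxE nc_real ger0_norm ?expR_ge0.
  have nmZ : nm Z < r by apply: (small s u) => // i; rewrite ncZ.
  have l1 : expR (- ((u + B) / cc)) <= S Z.
    apply: (low Z i1) => //; first by rewrite ncZ si1.
    by rewrite ncZ -[leRHS]expR0 ler_expR oppr_le0 mulr_ge0// ltW.
  have l2 : S Z <= D * expR (- (2 * (u * nu))).
    rewrite SE mulrDl ler_wpDr ?mul1r ?expR_ge0// mulr_suml; apply: ler_sum => k _.
    have -> : expR (- (2 * (u * nu))) = expR (- (u * nu)) ^+ 2.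
      by rewrite -expRM_natl; congr expR; ring.
    rewrite -exprMn lerXn2r ?nnegrE ?nc_ge0 ?mulr_ge0 ?expR_ge0//.
    by apply: up => // i; rewrite ncZ.
  have := le_trans l1 l2.
  rewrite -{1}(lnK (x := D)) ?posrE// -expRD ler_expR mulrDl => h.
  by rewrite mulrBl; move: h; rewrite ![_ / cc]mulrC; lra.
rewrite subr_le0 => h.
by rewrite mulrAC -ler_pdivlMr ?mul1r// .
Qed.

Lemma eventually_le (a b D : R) : 0 < a -> exists u0 : R,
  forall u, u0 <= u -> D <= a * u.
Proof.
by move=> a0; exists (D / a) => u; rewrite ler_pdivrMr// mulrC.
Qed.

(** In contraposition: where [S] is too small although every |Z_i| is at most e^(-u w_i), some
    coordinate is smaller by a further factor e^(-u d). This gives the polydiscs covering a sublevel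
    set, one for each coordinate. *)
Lemma dominance (w : 'I_n -> R) (N : nat) (G : 'I_N -> E -> R[i]) (S : E -> R)
    (r cc B B' : R) :
  (1 < n)%N -> (forall i, 0 < w i) -> injective (dotw w) -> 0 < r -> 0 < cc ->
  (forall k, hol (G k) (bl 0 r)) -> (forall Z, S Z = \sum_k nc (G k Z) ^+ 2) ->
  (forall Z i t, nm Z < r -> expR (- (t * w i)) <= nc (Z 0 i) -> nc (Z 0 i) <= 1 ->
     expR (- ((t + B) / cc)) <= S Z) ->
  exists d u0 : R, 0 < d /\ forall u (Z : E), u0 <= u ->
    (forall i, expR (- (u * (w i + d))) <= nc (Z 0 i) <= expR (- (u * w i))) ->
    expR ((B' - u) / cc) <= S Z.
Proof.
move=> n1 w0 winj r0 cc0 hG SE low.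
pose j0 := Ordinal (ltn_trans (ltn0Sn 0) n1).
have [wm wm0 [_ wmw]] := fin_pos_lower_bound ltr01 w0.
(* The rate [K%:R * wm] is too large for [ray] below, so a monomial of smaller weight has to
   occur. *)
pose K := (Num.truncn (2 * cc * wm)^-1).+1.
have hK : 1 < 2 * cc * (K%:R * wm).
  have : (2 * cc * wm)^-1 < K%:R by exact: truncnS_gt.
  by rewrite -[ltLHS]mul1r ltr_pdivrMr ?mulr_gt0// mulrCA mulrA.
have /choice[p hp] : forall k, exists p : (X -> R[i]) * seq X * (R * R),
    [/\ uniq p.1.2, 0 < p.2.1, 0 <= p.2.2 & forall Z, nm Z < p.2.1 ->
       nc (G k Z - \sum_(m <- p.1.2) p.1.1 m * mono m Z) <= p.2.2 * nm Z ^+ K].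
  move=> k; have [s [r' [C [r'0 C0 fC]]]] := taylor K r0 (hG k).
  have [a [l ul al]] := mpolyn_collect s.
  by exists (a, l, (r', C)); split => //= Z Zr; rewrite -al; exact: fC.
have [|r1 r10 [r1r r1p]] := fin_pos_lower_bound (f := fun k => (p k).2.1) r0.
  by move=> k; case: (hp k).
pose L := [seq q <- [seq (k, m) | k <- enum 'I_N, m <- (p k).1.2] | (p q.1).1.1 q.2 != 0].
have memL k m : m \in (p k).1.2 -> (p k).1.1 m != 0 -> (k, m) \in L.
  move=> ml am; rewrite mem_filter am /=; apply/allpairsPdep; exists k, m.
  by rewrite mem_enum.
(* Used for [w] itself and for the perturbation of [w] in one coordinate. *)
have ray s nu i1 : (forall i, w i <= s i) -> s i1 = w i1 ->
    (forall q, q \in L -> nu <= dotw s q.2) -> nu <= K%:R * wm -> 2 * cc * nu <= 1.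
  move=> ws si1 nuL nuK.
  have /choice[C hC] : forall k, exists C, 0 <= C /\ forall Z u, 0 <= u -> nm Z < r1 ->
      (forall i, nc (Z 0 i) <= expR (- (u * s i))) -> nc (G k Z) <= C * expR (- (u * nu)).
    move=> k; have [ul r'0 C0 fC] := hp k.
    have [|m ml am|C' C'0 hC'] := @decay_bound _ _ s wm _ nu _ _ _ _ _ C0 _ nuK _ fC.
    - by move=> i; exact: le_trans (wmw i) (ws i).
    - exact: (nuL (k, m) (memL _ _ ml am)).
    - by exists C'; split => // Z u u0 Zr; apply: hC' => //; exact: lt_le_trans (r1p k).
  apply: (@ray_bound w s N S r1 cc B nu i1 G C) => //.
  - by move=> i; exact: lt_le_trans (ws i).
  - by move=> Z i t Zr; apply: low; exact: lt_le_trans r1r.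
  - by move=> k; case: (hC k).
  - by move=> k Z u; case: (hC k) => _; apply.
have [q0 q0L q0K] : exists2 q, q \in L & dotw w q.2 < K%:R * wm.
  apply: contrapT => h.
  have := ray w (K%:R * wm) j0 (fun=> lexx _) erefl _ (lexx _).
  rewrite leNgt hK => /(_ _)/negP; apply => // q qL.
  by rewrite leNgt; apply/negP => qK; apply: h; exists q.
have [[k m] [e [qL qq0 e0 qmin qgap]]] := seq_gap (fun q => dotw w q.2) q0L.
rewrite /= in qq0 qmin qgap; set mu := dotw w m in qq0 qmin qgap.
have muK : mu < K%:R * wm by exact: le_lt_trans q0K.
(* By injectivity of the weights, exponents in [L] other than [m] have strictly larger weight, even
   when they belong to another [k]. *)
have [eta [eta0 etaK etaL]] : exists eta, [/\ 0 < eta, mu + eta <= K%:R * wm &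
    forall q, q \in L -> q.2 != m -> mu + eta <= dotw w q.2].
  exists (Num.min e (K%:R * wm - mu)); split.
  - by rewrite lt_min e0 subr_gt0.
  - by rewrite -lerBrDl ge_min lexx orbT.
  - move=> q ql qm; rewrite -lerBrDl ge_min lerBrDl qgap// lt_neqAle qmin// andbT.
    by apply: contraNneq qm => /winj->.
have mu1 : 2 * cc * mu < 1.
  have [m0|[i0 mi0]] : (forall i, m i = 0%N) \/ exists i, (0 < m i)%N.
    have [i mi|h] := pickP (fun i => (0 < m i)%N); first by right; exists i.
    by left => i; apply/eqP; rewrite -leqn0 leqNgt h.
  - by rewrite /mu /dotw big1 ?mulr0// => i _; rewrite m0 mul0r.
  have [i1 i10] : exists i1, i1 != i0.
    have [->|] := eqVneq i0 j0; last by exists j0; rewrite eq_sym.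
    by exists (Ordinal n1).
  (* The weight of [m] rises by exactly [eta], so all weights in [L] become at least [mu + eta]. *)
  pose d0 := eta / ((m i0)%:R * w i0).
  have mw0 : 0 < (m i0)%:R * w i0 by rewrite mulr_gt0// ltr0n.
  have d00 : 0 < d0 by rewrite divr_gt0.
  pose s i := w i + d0 * w i * (i == i0)%:R.
  have sE m' : dotw s m' = dotw w m' + d0 * ((m' i0)%:R * w i0).
    rewrite /dotw /s; under eq_bigr => i _ do rewrite mulrDr.
    rewrite big_split/=; congr (_ + _).
    rewrite (bigD1 i0)//= eqxx big1 ?addr0; first by rewrite mulr1; ring.
    by move=> i /negPf->; rewrite !mulr0.
  have si1 : s i1 = w i1 by rewrite /s (negPf i10) mulr0 addr0.
  have h : 2 * cc * (mu + eta) <= 1.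
    apply: (ray s (mu + eta) i1) => //.
      by move=> i; rewrite lerDl mulr_ge0// mulr_ge0// ltW.
    move=> q ql; rewrite sE; have [->|qm] := eqVneq q.2 m.
      by rewrite -/mu divfK// gt_eqF.
    by apply: le_trans (etaL _ ql qm) _; rewrite lerDl mulr_ge0 ?(ltW d00)// mulr_ge0// ltW.
  by apply: lt_le_trans h; rewrite ltr_pM2l ?mulr_gt0// ltrDl.
have [kL am] : m \in (p k).1.2 /\ (p k).1.1 m != 0.
  move: qL; rewrite mem_filter /= => /andP[am /allpairsPdep[k' [m' [_ ml [ek em]]]]].
  by rewrite ek em in am *.
have [ul r'0 C0 fC] := hp k.
set a := (p k).1.1 in am fC; set l := (p k).1.2 in kL ul fC.
set C := (p k).2.2 in C0 fC; set r' := (p k).2.1 in r'0 fC.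
pose f2 Z := G k Z - a m * mono m Z.
have [C' C'0 hC'] : exists2 C', 0 <= C' & forall Z u, 0 <= u -> nm Z < r' ->
    (forall i, nc (Z 0 i) <= expR (- (u * w i))) -> nc (f2 Z) <= C' * expR (- (u * (mu + eta))).
  apply: (@decay_bound _ _ w wm C (mu + eta) r' K f2 a (rem m l)) => //.
    move=> m'; rewrite mem_rem_uniq// inE => /andP[mm' m'l] am'.
    by have := etaL _ (memL _ _ m'l am'); apply.
  move=> Z Zr; rewrite /f2 -addrA -opprD.
  have := fC Z Zr; rewrite (big_rem m kL)/=; exact.
pose M : R := (mdeg m)%:R.
pose g := 1 - 2 * cc * mu; have g0 : 0 < g by rewrite subr_gt0.
(* For the weights [w + d] the exponent [m] has weight [mu + d * M]. The bound [eta / 2] keeps it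
   below the remaining terms, the bound [g / (4 * cc)] keeps [2 * cc] times it below 1, and [M + 1]
   covers [M = 0]. *)
pose d := Num.min (eta / 2) (g / (4 * cc)) / (M + 1).
have M0 : 0 <= M by [].
have d0 : 0 < d by rewrite divr_gt0 ?lt_min ?divr_gt0 ?mulr_gt0// ltr_wpDl.
have dM : d * M <= Num.min (eta / 2) (g / (4 * cc)).
  rewrite /d mulrAC ler_pdivrMr ?ltr_wpDl// ler_wpM2l ?lerDl//.
  by rewrite le_min !divr_ge0 ?mulr_ge0// ltW.
have dwE : dotw (fun i => w i + d) m = mu + d * M.
  rewrite /dotw; under eq_bigr => i _ do rewrite mulrDr.
  by rewrite big_split/= -mulr_suml -natr_sum mulrC.
move: dM; rewrite le_min => /andP[dM1 dM2].
set mu' := mu + d * M in dwE.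
have mu'g : g / 2 / cc <= cc^-1 - 2 * mu'.
  rewrite ler_pdivrMr// [leRHS]mulrBl mulVf ?gt_eqF// /mu'.
  have : d * M * cc <= g / 4.
    exact: le_div4.
  rewrite /g; lra.
have a0 : 0 < nc (a m) / 2 by rewrite divr_gt0// nc_gt0.
have eta2 : 0 < eta / 2 by rewrite divr_gt0.
have aC : 0 < nc (a m) / 2 / (C' + 1) by rewrite divr_gt0// ltr_wpDl.
have [u1 u10 hu1] := expR_small eta2 aC.
have [u2 u20 hu2] := nm_decay_small n r'0 wm0.
have gc : 0 < g / 2 / cc by rewrite !divr_gt0.
(* For large [u] the strict gain in the rate absorbs the constants [B'] and [nc (a m) / 2]. *)
have [u3 hu3] := @eventually_le _ 0 (B' / cc - 2 * ln (nc (a m) / 2)) gc.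
exists d, (Num.max (Num.max u1 u2) u3); split => // u Z.
rewrite !ge_max => /andP[/andP[uu1 uu2] uu3] hZ.
have u0 : 0 <= u by exact: le_trans uu1.
have hZ1 i : nc (Z 0 i) <= expR (- (u * w i)) by case/andP: (hZ i).
have hZ2 i : expR (- (u * (w i + d))) <= nc (Z 0 i) by case/andP: (hZ i).
have nmZ : nm Z < r' by exact: (hu2 w u).
have low1 : expR (- (u * mu')) <= nc (mono m Z) by rewrite -dwE; exact: mono_ge.
have up1 : nc (f2 Z) <= nc (a m) / 2 * expR (- (u * mu')).
  apply: le_trans (hC' _ _ u0 nmZ hZ1) _.
  apply: (@le_trans _ _ (C' * (expR (- (u * mu')) * expR (- (u * (eta / 2)))))).
    rewrite ler_wpM2l// -expRD ler_expR -opprD lerN2 -mulrDr ler_wpM2l//.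
    by rewrite /mu'; lra.
  rewrite mulrCA mulrC ler_wpM2r ?expR_ge0//.
  apply: (@le_trans _ _ ((C' + 1) * (nc (a m) / 2 / (C' + 1)))).
    by rewrite ler_pM ?expR_ge0 ?lerDl ?hu1.
  by rewrite mulrC divfK// gt_eqF// ltr_wpDl.
have low2 : nc (a m) / 2 * expR (- (u * mu')) <= nc (G k Z).
  have e1 : nc (a m * mono m Z) <= nc (G k Z) + nc (f2 Z).
    rewrite (_ : a m * mono m Z = G k Z - f2 Z); first exact: ncB.
    by rewrite /f2 opprB addrC subrK.
  have e2 : nc (a m) * expR (- (u * mu')) <= nc (a m * mono m Z).
    by rewrite ncM ler_wpM2l ?nc_ge0.
  by lra.
apply: (@le_trans _ _ (nc (G k Z) ^+ 2)); last first.
  by rewrite SE (bigD1 k)//= lerDl sumr_ge0// => i _; rewrite exprn_ge0 ?nc_ge0.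
apply: (@le_trans _ _ ((nc (a m) / 2 * expR (- (u * mu'))) ^+ 2)); last first.
  by rewrite lerXn2r ?nnegrE ?nc_ge0// mulr_ge0 ?expR_ge0// ltW.
rewrite -{1}(lnK (x := nc (a m) / 2)) ?posrE// -expRD -expRM_natl ler_expR.
have h1 := hu3 _ uu3.
have h2 := ler_wpM2r u0 mu'g.
rewrite mulrBl [u / cc]mulrC; lra.
Qed.

End dominance.

(** * Volumes of Lipschitz images of polydiscs *)

Section lipschitz_images.
Variables (R : realType) (n : nat).
Notation E := 'rV[R[i]]_n.
Notation T := (measurableTypeR R).
Notation lam := (lebesgue_Cn R n).
Notation pull W := (@cvec R n @^-1` W : set ((n + n).-tuple T)).

Lemma finite_cover_bound (I : finType) (F : I -> set E) (b : I -> R) :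
  (forall i, exists U : set E, [/\ F i `<=` U, measurable (pull U) &
    (lam (pull U) <= (b i)%:E)%E]) ->
  exists U : set E, [/\ forall i, F i `<=` U, measurable (pull U) &
    (lam (pull U) <= (\sum_i b i)%:E)%E].
Proof.
move=> h; suff [U [FU mU bU]] : exists U : set E,
    [/\ forall i, i \in enum I -> F i `<=` U, measurable (pull U) &
       (lam (pull U) <= (\sum_(i <- enum I) b i)%:E)%E].
  exists U; split => //; last by move: bU; rewrite big_enum.
  by move=> i; apply: FU; rewrite mem_enum.
elim: (enum I) => [|i s [U [FU mU bU]]].
  exists set0; split => //; first by rewrite preimage_set0.
  by rewrite preimage_set0 measure0 big_nil.
have [U' [FU' mU' bU']] := h i; exists (U' `|` U); split.
- move=> j; rewrite in_cons => /orP[/eqP->|js] z Fz; first by left; exact: FU'.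
  by right; exact: (FU j).
- by rewrite preimage_setU; exact: measurableU.
rewrite preimage_setU big_cons EFinD.
by apply: le_trans (measureU2 _ mU' mU) _; exact: leeD.
Qed.

Lemma truncn_dist (x y : R) : 0 <= x -> 0 <= y -> Num.truncn x = Num.truncn y ->
  `|x - y| <= 1.
Proof.
move=> /truncn_itv/andP[x1 x2] /truncn_itv/andP[y1 y2] e; rewrite e in x1 x2.
by move: x2 y2; rewrite -natr1 => x2 y2; rewrite ler_distl; apply/andP; split; lra.
Qed.

Lemma cell_dist (x y rh e : R) : 0 < e -> `|x| <= rh -> `|y| <= rh ->
  Num.truncn ((x + rh) / e) = Num.truncn ((y + rh) / e) -> `|x - y| <= e.
Proof.
move=> e0; rewrite !ler_norml => /andP[x1 x2] /andP[y1 y2] h.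
have := truncn_dist _ _ h.
have -> : (x + rh) / e - (y + rh) / e = (x - y) / e by ring.
rewrite normrM (@gtr0_norm _ e^-1) ?invr_gt0// ler_pdivrMr// mul1r.
by rewrite -ler_norml; apply; rewrite divr_ge0// ?(ltW e0)//; lra.
Qed.

(* The box is cut into about [\prod_j (rh j / e) ^+ 2] cubes of side [e], and the
   image of each of them lies in a cube of side [O(e)]. *)
Lemma lipschitz_box (Lam : E -> E) (L : R) (rh : 'I_n -> R) :
  0 <= L -> (forall j, 0 < rh j) ->
  (forall Z Z' : E, (forall j, nc (Z 0 j) <= rh j) -> (forall j, nc (Z' 0 j) <= rh j) ->
     nm (Lam Z - Lam Z') <= L * nm (Z - Z')) ->
  exists U : set E, [/\ forall Z : E, (forall j, nc (Z 0 j) <= rh j) -> U (Lam Z),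
    measurable (pull U) &
    (lam (pull U) <= (\prod_(j < n) (6 * (2 * n%:R * L + 1) * rh j) ^+ 2)%:E)%E].
Proof.
(* The side [e] is at most every [rh j], so rounding up gives [(N j).+1 * e <= 3 * rh j]; with the
   side [2 * r'] of the image cubes this is the origin of the constant 6. *)
move=> L0 rh0 lip; have [e e0 [_ erh]] := fin_pos_lower_bound ltr01 rh0.
pose N j := Num.truncn (2 * rh j / e).
pose I := {dffun forall j : 'I_n, 'I_(N j).+1 * 'I_(N j).+1}.
pose idx j (x : R) := Num.truncn ((x + rh j) / e).
have idxN j x : `|x| <= rh j -> (idx j x <= N j)%N.
  move=> xj; apply: le_truncn; rewrite ler_pM2r ?invr_gt0//.
  by move: xj; rewrite ler_norml => /andP[x1 x2]; lra.
pose F (nu : I) := [set Lam Z | Z in [set Z : E | forall j, nc (Z 0 j) <= rh j /\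
  idx j (complex.Re (Z 0 j)) = (nu j).1 /\ idx j (complex.Im (Z 0 j)) = (nu j).2]].
(* Two points of a cell are at [nm]-distance at most [2 * n%:R * e]. The summand 1 makes the
   inclusion in an open cube strict, also for [L = 0]. *)
pose r' := (2 * n%:R * L + 1) * e.
have k0 : 0 < 2 * n%:R * L + 1 by rewrite ltr_wpDl// !mulr_ge0.
have r'0 : 0 < r' by rewrite mulr_gt0.
have [|U [FU mU bU]] := @finite_cover_bound I F (fun=> \prod_(j < n) (2 * r') ^+ 2).
  move=> nu; have [[y Fy]|Fn] := pselect (F nu !=set0); last first.
    exists set0; split.
    - by move=> z Fz; apply: Fn; exists z.
    - by rewrite preimage_set0.
    - by rewrite preimage_set0 measure0 lee_fin prodr_ge0// => j _; rewrite exprn_ge0// mulr_ge0// ltW.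
  exists (qbox y (fun=> r')); split; last 2 first.
  - exact: pull_qbox_measurable.
  - by rewrite lebesgue_qbox// => j; exact: ltW.
  case: Fy => Z' hZ' <- _ [Z hZ <-]; apply: qbox_nm.
  apply: (@le_lt_trans _ _ (L * nm (Z - Z'))).
    by apply: lip => j; [case: (hZ j)|case: (hZ' j)].
  apply: (@le_lt_trans _ _ (L * (n%:R * (2 * e)))).
    rewrite ler_wpM2l// mulr_natl -[X in _ *+ X]card_ord -sumr_const.
    apply: ler_sum => j _; apply: le_trans (nc_le_ReIm _) _.
    rewrite !mxE !(ReD, ReN, ImD, ImN) mulr_natl mulr2n.
    have [b1 [i1 i2]] := hZ j; have [b2 [i3 i4]] := hZ' j.
    apply: lerD; apply: (@cell_dist _ _ (rh j)) => //.
    - exact: le_trans (nc_Re _) b1.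
    - exact: le_trans (nc_Re _) b2.
    - by rewrite -/(idx _ _) i1 -i3.
    - exact: le_trans (nc_Im _) b1.
    - exact: le_trans (nc_Im _) b2.
    - by rewrite -/(idx _ _) i2 -i4.
  rewrite /r' (_ : L * _ = 2 * n%:R * L * e); last by ring.
  by rewrite [ltRHS]mulrDl mul1r ltrDl.
exists U; split => //.
  move=> Z hZ; pose nu : I := finfun (fun j : 'I_n =>
    (inord (idx j (complex.Re (Z 0 j))), inord (idx j (complex.Im (Z 0 j)))) :
      'I_(N j).+1 * 'I_(N j).+1).
  apply: (FU nu); exists Z => // j; rewrite /nu ffunE/=; split => //.
  by rewrite !inordK// ltnS; apply: idxN; [exact: le_trans (nc_Im _) (hZ j)|
    exact: le_trans (nc_Re _) (hZ j)].
apply: (le_trans bU); rewrite lee_fin sumr_const -[_ *+ _]mulr_natl.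
have -> : #|{: I}| = (\prod_j ((N j).+1 * (N j).+1))%N.
  rewrite card_dep_ffun foldrE big_map big_enum/=; apply: eq_bigr => j _.
  by rewrite card_prod card_ord.
rewrite natr_prod -big_split/=; apply: ler_prod => j _.
rewrite mulr_ge0 ?exprn_ge0//=; last by rewrite mulr_ge0// ltW.
have hN : (N j).+1%:R * e <= 3 * rh j.
  have t0 : 0 <= 2 * rh j / e by rewrite !mulr_ge0 ?invr_ge0 ?ltW.
  have := t0; rewrite -truncn_le ler_pdivlMr// -/(N j) -natr1 mulrDl mul1r => h.
  by have := erh j; lra.
rewrite natrM -expr2 -exprMn lerXn2r ?nnegrE//.
- by rewrite !mulr_ge0// ltW.
- by rewrite !mulr_ge0// ltW.
rewrite /r' (_ : _ * (2 * _) = 2 * (2 * n%:R * L + 1) * ((N j).+1%:R * e)); last by ring.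
rewrite (_ : 6 * _ * _ = 2 * (2 * n%:R * L + 1) * (3 * rh j)); last by ring.
by rewrite ler_wpM2l// mulr_ge0// ltW.
Qed.

End lipschitz_images.

(** * Comparison of the multiplier ideals *)

Section local_integrability.
Variables (R : realType) (n : nat) (M : complexManifold R n).
Notation E := 'rV[R[i]]_n.
Notation T := (measurableTypeR R).
Notation lam := (lebesgue_Cn R n).
Notation pull W := (@cvec R n @^-1` W : set ((n + n).-tuple T)).
Implicit Types (c : chart R n M) (p x : M).

Lemma phi0_not_integrable c0 x0 (w : 'I_n -> R) (rho : R) :
  atlas c0 -> chart_dom c0 x0 -> (forall i, 0 < w i) -> \sum_i w i = 1 -> 0 < rho ->
  ~ locally_integrable_near (fun x => weight (phi0 c0 x0 (fun i => (2 * w i)^-1) rho x)) x0.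
Proof.
move=> ac0 dx0 w0 w1 rho0 /(_ c0 ac0 dx0)[W [[oW Wx0] Wimg]].
have A0 i : 0 < (2 * w i)^-1 by rewrite invr_gt0 mulr_gt0.
(* The factor 1/2 allows for |z| <= |Re z| + |Im z|, and [- 1] for the shift in [Phi_le_ln]. As the
   weights have sum 1, the volumes are a constant times [expR (- 2 k)]. *)
pose rr (k : nat) j : R := rho / 2 * expR (- (k%:R * w j) - 1).
have rr0 k j : 0 < rr k j by rewrite mulr_gt0 ?expR_gt0// divr_gt0.
have /nbhs_nm[r r0 hr] : nbhs (c0 x0) W by exact: open_nbhs_nbhs.
have [wm wm0 [_ wmw]] := fin_pos_lower_bound ltr01 w0.
have rr0' : 0 < r / rho by rewrite divr_gt0.
have [u0 u00 small] := nm_decay_small n rr0' wm0.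
have BW (k : nat) z : ((Num.truncn u0).+1 <= k)%N -> qbox (c0 x0) (rr k) z ->
    W z /\ (phi0 c0 x0 (fun i => (2 * w i)^-1)%R rho (chart_inv c0 z) <= (- k%:R)%:E)%E.
  move=> k0k Bz.
  have ku : u0 <= k%:R by rewrite (le_trans (ltW (truncnS_gt u0)))// ler_nat.
  have zj j : nc (z 0 j - c0 x0 0 j) <= rho * expR (- (k%:R * w j) - 1).
    apply: le_trans (nc_le_ReIm _) _; have [/ltW h1 /ltW h2] := Bz j.
    by apply: le_trans (lerD h1 h2) _; rewrite -mulrDl -splitr.
  have Wz : W z.
    rewrite -(subrK (c0 x0) z) addrC; apply: hr.
    have : nm ((rho^-1)%:C%C *: (z - c0 x0)) < r / rho.
      apply: (small w k%:R) => // j; rewrite !mxE ncM nc_real gtr0_norm ?invr_gt0//.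
      rewrite mulrC ler_pdivrMr// mulrC; apply: le_trans (zj j) _.
      by rewrite ler_wpM2l ?(ltW rho0)// ler_expR; lra.
    by rewrite nmZ nc_real gtr0_norm ?invr_gt0// mulrC ltr_pM2r ?invr_gt0.
  split => //.
  have [x dx xz] := Wimg _ Wz; rewrite -xz chartK// /phi0 asboolT//.
  apply: (Phi_le_ln A0) => // i; rewrite invrK /sqc zmap_coord xz ncM nc_real.
  rewrite ger0_norm ?invr_ge0 ?(ltW rho0)//.
  have h : rho^-1 * nc (z 0 i - c0 x0 0 i) <= expR (- (k%:R * w i) - 1).
    by rewrite mulrC ler_pdivrMr// mulrC zj.
  apply: (@le_trans _ _ (expR (- (k%:R * w i) - 1) ^+ 2)).
    by rewrite lerXn2r ?nnegrE ?expR_ge0// mulr_ge0 ?nc_ge0// invr_ge0 ltW.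
  by rewrite -expRM_natl ler_expR; lra.
apply: (@weight_not_integrable _ _ W (phi0 c0 x0 _ rho \o chart_inv c0)
  (fun k => qbox (c0 x0) (rr k)) (\prod_(j < n) (rho * expR (- 1)) ^+ 2)
  (Num.truncn u0).+1) => //.
- by rewrite prodr_gt0// => j _; rewrite exprn_gt0// mulr_gt0// expR_gt0.
- by move=> k; exact: pull_qbox_measurable.
move=> k _; rewrite lebesgue_qbox; last by move=> j; exact: ltW.
rewrite lee_fin (_ : expR (- (2 * k%:R)) = \prod_(j < n) expR (- (k%:R * w j)) ^+ 2).
  rewrite -big_split/= le_eqVlt; apply/orP; left; apply/eqP; apply: eq_bigr => j _.
  by rewrite -exprMn /rr expRD; congr (_ ^+ 2); field.
under eq_bigr => j _ do rewrite -expRM_natl.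
rewrite -expR_sum; congr expR; under eq_bigr => j _ do rewrite mulrN mulrA.
by rewrite sumrN -mulr_sumr w1 mulr1.
Qed.

(** The chart is arbitrary, and the sublevel sets need only be covered by measurable sets of small
    volume. They are themselves open near [p], a quasi-plurisubharmonic function being locally the
    sum of an upper semicontinuous and a continuous one, so the weight is measurable. *)
Lemma integrable_near c p (phi : M -> \bar R) V (C q : R) (k0 : nat) :
  atlas c -> chart_dom c p -> quasi_psh phi -> open_nbhs p V -> 0 <= C -> 0 <= q < 1 ->
  (forall k, (k0 <= k)%N -> exists U : set E, [/\ measurable (pull U),
     (lam (pull U) <= (C * expR (- (2 * k%:R)) * q ^+ k)%:E)%E &
     forall x, V x -> chart_dom c x -> (phi x < (- k%:R)%:E)%E -> U (c x)]) ->
  exists W : set E, [/\ open_nbhs (c p) W, W `<=` c @` chart_dom c &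
    lam.-integrable (pull W) (fun t => weight (phi (chart_inv c (cvec t))))].
Proof.
move=> ac dp qphi [oV Vp] C0 q01 cov.
have [V' [psi [v [[oV' V'p] [psiP _] smv phiE]]]] := qphi p.
have [psiy psiusc _] := psiP c ac.
have vC z : cimg c V' z -> {for z, continuous (v \o chart_inv c)}.
  by move=> Uz; exact: (smv c ac 0%N).1.
have oVV : open (V `&` V') by exact: openI.
have /nbhs_nm[r r0 hr] : nbhs (c p) (cimg c (V `&` V')) by exact: near_cimg.
pose W : set E := [set z | nm (z - c p) < r].
have oW : open W.
  rewrite openE => z Wz; apply/nbhs_nm.
  exact: (@bl_open _ _ (c p) r z Wz).
have WV z : W z -> exists x, [/\ V x, V' x, chart_dom c x & c x = z].
  move=> Wz; have [|x [[Vx V'x] dx] xz] := hr (z - c p); first exact: Wz.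
  by exists x; split => //; rewrite xz addrC subrK.
have WU z : W z -> cimg c V' z by move=> /WV[x [_ V'x dx <-]]; exists x.
have phz z : W z -> phi (chart_inv c z) = (psi (chart_inv c z) + (v (chart_inv c z))%:E)%E.
  by move=> /WU/cimg_inv[V'z _]; exact: phiE.
have usc z (b : R) : W z -> (phi (chart_inv c z) < b%:E)%E ->
    \forall y \near z, (phi (chart_inv c y) < b%:E)%E.
  move=> Wz; rewrite phz// => hb.
  have [b' pb' b'b] : exists2 b' : R, (psi (chart_inv c z) < b'%:E)%E &
      b' + v (chart_inv c z) < b.
    have := psiy z (WU _ Wz); move: hb; rewrite /=.
    case: (psi _) => [s| |] // hs _.
      exists ((s + (b - v (chart_inv c z))) / 2).
        by move: hs; rewrite -EFinD !lte_fin; lra.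
      by move: hs; rewrite -EFinD lte_fin; lra.
    by exists (b - v (chart_inv c z) - 1); [exact: ltNyr|lra].
  have /nbhs_nm[r1 r10 h1] := psiusc z b' (WU _ Wz) pb'.
  have e0 : 0 < (b - b' - v (chart_inv c z)) / 2 by lra.
  have [r2 r20 h2] := (continuous_nm _ _).1 (vC z (WU _ Wz)) _ e0.
  have [r3 r30 h3] := @bl_open _ _ (c p) r z Wz.
  apply/nbhs_nm; exists (Num.min r1 (Num.min r2 r3)); first by rewrite !lt_min r10 r20.
  move=> h; rewrite !lt_min => /andP[hr1 /andP[hr2 hr3]].
  rewrite phz; last exact: h3.
  have := h2 _ hr2; rewrite /= ler_norml => /andP[_ v2].
  have := h1 _ hr1; rewrite /=; case: (psi _) => [s| |] //; last by move=> _; exact: ltNyr.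
  by rewrite -EFinD !lte_fin; lra.
exists W; split.
- by split => //; rewrite /W /= subrr nm0.
- by move=> z /WV[x [_ _ dx <-]]; exists x.
apply: (@weight_integrable _ _ W (phi \o chart_inv c) (c p) r C q k0) => //.
- by move=> z Wz; exact: qbox_nm.
- exact: ltW.
- by move=> z Wz; rewrite /= phz// lte_add_pinfty ?ltry//; exact: psiy (WU _ Wz).
move=> k k0k; have [U [mU bU hU]] := cov k k0k.
apply: le_trans bU; apply: le_measure; rewrite ?inE//.
  by apply: pull_measurable; exact: (@usc_open _ _ W (phi \o chart_inv c) oW usc).
move=> t [/= /WV[x [Vx V'x dx xt]]]; rewrite -xt chartK// => hx; exact: hU.
Qed.

End local_integrability.

Section rescaling.
Variables (R : realType) (n : nat).
Notation E := 'rV[R[i]]_n.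

Lemma hol_affine (f : E -> R[i]) (U : E -> Prop) (a : E) (k : R[i]) :
  hol f U -> hol (fun Z => f (a + k *: Z)) (fun Z => U (a + k *: Z)).
Proof.
move=> hf Z UZ; have [df cf] := hf _ UZ; split.
  move=> w; have [d hd] := df (k *: w); exists d.
  apply: cder_congr (ltr01 : 0 < 1 :> R) _ hd => h _.
  by rewrite /cline scalerDr scalerA mulrC -scalerA addrA.
move=> e e0; have [r r0 hr] := cf e e0.
exists (r / (nc k + 1)); first by rewrite divr_gt0// ltr_wpDl ?nc_ge0.
move=> h; rewrite ltr_pdivlMr ?ltr_wpDl ?nc_ge0// => hh.
rewrite scalerDr addrA; apply: hr; rewrite nmZ.
by apply: le_lt_trans hh; rewrite mulrC ler_wpM2l ?nm_ge0// lerDl.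
Qed.

Lemma hol_map_lipschitz (Lam : E -> E) (r : R) : 0 < r ->
  (forall j, hol (fun Z => Lam Z 0 j) (bl 0 r)) ->
  exists L r' : R, [/\ 0 <= L, 0 < r' & forall Z Z', nm Z < r' -> nm Z' < r' ->
    nm (Lam Z - Lam Z') <= L * nm (Z - Z')].
Proof.
move=> r0 hL.
have /choice[p hp] : forall j, exists p : R * R, [/\ 0 <= p.1, 0 < p.2 &
    forall Z Z', nm Z < p.2 -> nm Z' < p.2 ->
      nc (Lam Z 0 j - Lam Z' 0 j) <= p.1 * nm (Z - Z')].
  move=> j; have [s [C [s0 C0] hC]] := hol_bounded (@bl_open _ _ 0 r) (hL j) (bl_center 0 r0).
  exists (8 * C / s, s / 2) => /=; split; rewrite ?divr_ge0 ?divr_gt0 ?mulr_ge0 ?(ltW s0)//.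
  move=> Z Z' Zs Z's; apply: (@hol_lipschitz _ _ (fun Z => Lam Z 0 j) 0 s C) => //.
  - by apply: hol_sub (hL j) => z /hC[].
  - by move=> z /hC[].
  - by rewrite subr0.
  - by rewrite subr0.
have [|r1 r10 [_ r1p]] := fin_pos_lower_bound (f := fun j => (p j).2) r0.
  by move=> j; case: (hp j).
exists (\sum_j (p j).1), r1; split => //.
  by apply: sumr_ge0 => j _; case: (hp j).
move=> Z Z' hZ hZ'; rewrite mulr_suml; apply: ler_sum => j _.
by rewrite !mxE; have [_ _] := hp j; apply; exact: lt_le_trans (r1p j).
Qed.

End rescaling.

(** * Functions with logarithmic poles above the model *)

Section logarithmic_poles.
Variables (R : realType) (n : nat) (M : complexManifold R n).
Notation E := 'rV[R[i]]_n.
Implicit Types (c : chart R n M) (x : M).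

(** The [g k] are bounded near [x0], so the logarithm is bounded above and a nonpositive multiple of
    it is bounded below. *)
Lemma nonpositive_log_bounded c0 x0 V (cc B : R) N (g : 'I_N -> M -> R[i]) (b : M -> R) :
  atlas c0 -> chart_dom c0 x0 -> open_nbhs x0 V -> cc <= 0 ->
  (forall k, holomorphic_on V (g k)) -> (forall x, V x -> `|b x| <= B) ->
  exists V' (B' : R), open_nbhs x0 V' /\ forall x, V' x -> V x /\
    (B'%:E <= cc%:E * lne (\sum_(k < N) nc (g k x) ^+ 2)%R%:E + (b x)%:E)%E.
Proof.
move=> ac0 dx0 [oV Vx0] cc0 hg bB.
have Ux0 : cimg c0 V (c0 x0) by exists x0.
have /choice[p hp] : forall k, exists p : R * R, [/\ 0 < p.1, 0 <= p.2 &
    forall y, bl (c0 x0) p.1 y -> nc (g k (chart_inv c0 y)) <= p.2].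
  move=> k; have [s [C [s0 C0] hC]] :=
    hol_bounded (cimg_uopen oV) (holomorphic_on_hol ac0 (hg k)) Ux0.
  by exists (s, C); split => // y /hC[].
have [|r r0 [_ rp]] := fin_pos_lower_bound (f := fun k => (p k).1) (ltr01 : 0 < 1 :> R).
  by move=> k; case: (hp k).
pose S := \sum_k (p k).2 ^+ 2 + 1.
have S0 : 0 < S by rewrite ltr_wpDl// sumr_ge0// => k _; rewrite exprn_ge0//; case: (hp k).
have N1 : nbhs (c0 x0) [set z | nm (z - c0 x0) < r].
  by apply/nbhs_nm; exists r => // h; rewrite /= addrAC subrr add0r.
have N2 : nbhs x0 [set x | nm (c0 x - c0 x0) < r] := chart_continuous dx0 N1.
have N3 : nbhs x0 (V `&` chart_dom c0).
  by apply: open_nbhs_nbhs; split => //; apply: openI => //; exact: chart_dom_open.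
have : nbhs x0 ([set x | nm (c0 x - c0 x0) < r] `&` (V `&` chart_dom c0)) by exact: filterI.
rewrite nbhsE => -[V' oV' sV'].
exists V', (cc * ln S - B); split => // x /sV'[xr [Vx dx]]; split => //.
have sS : \sum_(k < N) nc (g k x) ^+ 2 <= S.
  apply: (@le_trans _ _ (\sum_k (p k).2 ^+ 2)); last by rewrite lerDl.
  apply: ler_sum => k _; have [s0 C0 hC] := hp k.
  rewrite lerXn2r ?nnegrE ?nc_ge0//.
  have := hC (c0 x); rewrite chartK//; apply.
  exact: lt_le_trans xr (rp k).
have b1 : - B <= b x by have := bB x Vx; rewrite ler_norml => /andP[].
set s := \sum_(k < N) _ in sS *.
have s0 : 0 <= s by rewrite sumr_ge0// => k _; rewrite exprn_ge0 ?nc_ge0.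
have [->|ccn] := eqVneq cc 0; first by rewrite mul0r mul0e add0e sub0r lee_fin.
have cc0' : cc < 0 by rewrite lt_neqAle ccn.
have [sz|sn] := eqVneq s 0.
  by rewrite sz le0_lneNy// lt0_muleNy ?lte_fin// addye// leey.
have s0' : 0 < s by rewrite lt_neqAle eq_sym sn.
rewrite lne_EFin// -EFinM -EFinD lee_fin lerD// ler_nM2l//.
by rewrite ler_ln ?posrE.
Qed.

End logarithmic_poles.

Section sublevel_cover.
Variables (R : realType) (n : nat) (M : complexManifold R n).
Notation E := 'rV[R[i]]_n.
Notation T := (measurableTypeR R).
Notation lam := (lebesgue_Cn R n).
Notation pull W := (@cvec R n @^-1` W : set ((n + n).-tuple T)).
Implicit Types (c : chart R n M) (x : M).

(** Since (2 w_i)^-1 ln |z_i|^2 = ln |z_i| / w_i, the sublevel set at [- t] lies in the polydisc of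
    radii e^(-t w_i). *)
Lemma Phi_lt_coord (w : 'I_n -> R) (Z : E) (t : R) i : (forall i, 0 < w i) -> 0 <= t ->
  (Phi (fun i => (2 * w i)^-1)%R Z < (- t)%:E)%E -> nc (Z 0 i) <= expR (- (t * w i)).
Proof.
move=> w0 t0 h; have A0 j : 0 < (2 * w j)^-1 by rewrite invr_gt0 mulr_gt0.
have [z0|z0] := eqVneq (nc (Z 0 i)) 0; first by rewrite z0 expR_ge0.
have {}z0 : 0 < nc (Z 0 i) by rewrite lt_neqAle eq_sym z0 nc_ge0.
have [z1|z1] := leP (nc (Z 0 i)) 1; last first.
  move: h; rewrite (Phi_eq0 A0 (i := i)) ?lte_fin; last by rewrite /sqc exprn_ege1// ltW.
  by move=> ?; lra.
have s01 : 0 < sqc Z i <= 1 by rewrite /sqc exprn_gt0// exprn_ile1// ltW.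
have := le_lt_trans (Phi_ge_ln A0 s01) h; rewrite lte_fin /sqc lnXn// => h1.
rewrite -[leLHS]lnK ?posrE// ler_expR.
have := ltW h1; rewrite -(ler_pM2l (x := 2 * w i)) ?mulr_gt0//.
rewrite mulrA mulfV ?gt_eqF ?mulr_gt0// mul1r mulr2n.
lra.
Qed.

Lemma Phi_ge_coord (w : 'I_n -> R) (Z : E) (t : R) i : (forall i, 0 < w i) ->
  expR (- (t * w i)) <= nc (Z 0 i) -> nc (Z 0 i) <= 1 ->
  ((- t)%:E <= Phi (fun i => (2 * w i)^-1)%R Z)%E.
Proof.
move=> w0 h z1; have A0 j : 0 < (2 * w j)^-1 by rewrite invr_gt0 mulr_gt0.
have z0 : 0 < nc (Z 0 i) by apply: lt_le_trans h; exact: expR_gt0.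
have s01 : 0 < sqc Z i <= 1 by rewrite /sqc exprn_gt0// exprn_ile1// ltW.
apply: le_trans (Phi_ge_ln A0 s01); rewrite lee_fin /sqc lnXn//.
rewrite -(ler_pM2l (x := 2 * w i)) ?mulr_gt0//.
rewrite mulrA mulfV ?gt_eqF ?mulr_gt0// mul1r mulr2n.
have : - (t * w i) <= ln (nc (Z 0 i)) by rewrite -ler_expR lnK ?posrE.
lra.
Qed.

Lemma log_value (cc s bb t : R) : 0 < cc ->
  ((- t)%:E <= cc%:E * lne s%:E + bb%:E)%E -> 0 < s /\ - t - bb <= cc * ln s.
Proof.
move=> cc0; have [s0|s0] := leP s 0.
  by rewrite le0_lneNy ?lee_fin// gt0_muleNy ?lte_fin.
by rewrite lne_EFin// -EFinM -EFinD lee_fin lerBlDr.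
Qed.

(** The exponents [w j], with [d] added for [j = i], have sum [1 + d]; the excess is the origin of
    the ratio [expR (- (2 * d))]. *)
Lemma box_cover_volume (w : 'I_n -> R) (d L : R) k i : \sum_j w j = 1 ->
  \prod_(j < n) (6 * (2 * n%:R * L + 1) *
    expR (- (k%:R * (w j + d * (j == i)%:R)))) ^+ 2 =
  ((6 * (2 * n%:R * L + 1)) ^+ 2) ^+ n * expR (- (2 * k%:R)) * expR (- (2 * d)) ^+ k.
Proof.
move=> w1; under eq_bigr => j _ do rewrite exprMn -expRM_natl.
rewrite big_split/= prodr_const card_ord -[RHS]mulrA; congr (_ * _).
rewrite -expR_sum -expRM_natl -expRD; congr expR.
under eq_bigr => j _ do rewrite mulrN mulrA mulrDr.
rewrite sumrN big_split/= -mulr_sumr w1 (bigD1 i)//= eqxx big1 ?addr0.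
  by rewrite !mulr1; ring.
by move=> j /negPf->; rewrite !mulr0.
Qed.

(** The leading monomial is found in the rescaled coordinates of [c0], where [phi0] is explicit,
    while volumes are wanted in the chart [c]. The transition map is Lipschitz near the pole and
    carries the polydiscs over at the cost of a constant factor. *)
Lemma positive_log_cover c0 c x0 (w : 'I_n -> R) (rho : R) V (cc B : R) N
    (g : 'I_N -> M -> R[i]) (b : M -> R) (phi : M -> \bar R) :
  (1 < n)%N -> atlas c0 -> atlas c -> chart_dom c0 x0 -> chart_dom c x0 -> 0 < rho ->
  (forall i, 0 < w i) -> \sum_i w i = 1 -> injective (dotw w) ->
  open_nbhs x0 V -> 0 < cc ->
  (forall k, holomorphic_on V (g k)) -> (forall x, V x -> `|b x| <= B) ->
  (forall x, V x -> phi x =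
     (cc%:E * lne (\sum_(k < N) nc (g k x) ^+ 2)%R%:E + (b x)%:E)%E) ->
  (forall x, (phi0 c0 x0 (fun i => (2 * w i)^-1)%R rho x <= phi x)%E) ->
  exists V' (C q : R) (k0 : nat), [/\ open_nbhs x0 V', 0 <= C, 0 <= q < 1 &
    forall k, (k0 <= k)%N -> exists U : set E, [/\ measurable (pull U),
     (lam (pull U) <= (C * expR (- (2 * k%:R)) * q ^+ k)%:E)%E &
     forall x, V' x -> chart_dom c x -> (phi x < (- k%:R)%:E)%E -> U (c x)]].
Proof.
move=> n1 ac0 ac dx0 dcx0 rho0 w0 w1 winj [oV Vx0] cc0 hg bB phiE phi_ge.
have oVc : open (V `&` chart_dom c) by apply: openI => //; exact: chart_dom_open.
pose a := c0 x0.
pose P (Z : E) := a + rho%:C%C *: Z.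
pose Um := cimg c0 (V `&` chart_dom c).
have /nbhs_nm[r1 r10 hr1] : nbhs a Um by exact: near_cimg.
pose r := r1 / rho; have r0 : 0 < r by rewrite divr_gt0.
have PU Z : nm Z < r -> Um (P Z).
  by rewrite ltr_pdivlMr// => h; apply: hr1; rewrite nmZ nc_real gtr0_norm// mulrC.
pose Q Z := chart_inv c0 (P Z).
have QK Z : nm Z < r -> [/\ V (Q Z), chart_dom c (Q Z), chart_dom c0 (Q Z) & c0 (Q Z) = P Z].
  by move=> /PU Uz; have [[? ?] ?] := cimg_inv Uz; split => //; exact: cimgK Uz.
have rhoC : rho%:C%C != 0 :> R[i] by rewrite -nc_gt0 nc_real normr_gt0 gt_eqF.
have rhoV : (rho^-1)%:C%C * rho%:C%C = 1 :> R[i].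
  by rewrite -rmorphM/= mulVf ?gt_eqF.
have zQ Z : nm Z < r -> zmap c0 x0 rho (Q Z) = Z.
  move=> /QK[_ _ _ e]; rewrite /zmap e /P addrAC subrr add0r scalerA.
  by rewrite rhoV scale1r.
have Qz x : chart_dom c0 x -> Q (zmap c0 x0 rho x) = x.
  move=> dx; rewrite /Q /P /zmap scalerA mulrC rhoV scale1r addrC subrK.
  exact: chartK.
pose G k Z := g k (Q Z).
pose S Z : R := \sum_k nc (G k Z) ^+ 2.
have hG k : hol (G k) (bl 0 r).
  have := @hol_affine _ _ _ _ a rho%:C%C (holomorphic_on_hol ac0 (hg k)).
  apply: hol_sub => Z; rewrite /bl subr0 => /PU[x [[Vx _] dx] xZ].
  by exists x.
have low Z i t : nm Z < r -> expR (- (t * w i)) <= nc (Z 0 i) -> nc (Z 0 i) <= 1 ->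
    expR (- ((t + B) / cc)) <= S Z.
  move=> Zr h1 h2; have [VQ _ dQ _] := QK Z Zr.
  have : ((- t)%:E <= phi (Q Z))%E.
    apply: le_trans (Phi_ge_coord w0 h1 h2) _.
    by have := phi_ge (Q Z); rewrite /phi0 asboolT// zQ.
  rewrite phiE// => /(log_value cc0)[s0 hs].
  rewrite -[leRHS]lnK ?posrE// ler_expR -mulNr ler_pdivrMr// mulrC.
  have := bB _ VQ; rewrite ler_norml => /andP[_ b1].
  by move: hs; rewrite -/(S Z); lra.
(* With [B' = B] the conclusion at [u = k] gives [- k <= phi], because [b] is at least [- B]. *)
have [d [u0 [d0 dom]]] := @dominance _ _ w N G S r cc B B n1 w0 winj r0 cc0 hG
  (fun=> erefl) low.
have hL j : hol (fun Z => c (Q Z) 0 j) (bl 0 r).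
  have := @hol_affine _ _ _ _ a rho%:C%C (transition_hol j ac0 ac).
  apply: hol_sub => Z; rewrite /bl subr0 => /PU[x [[_ dcx] dx] xZ].
  by exists x.
have [L [r2 [L0 r20 lip]]] := hol_map_lipschitz (Lam := c \o Q) r0 hL.
have [wm wm0 [_ wmw]] := fin_pos_lower_bound ltr01 w0.
have [u1 u10 small] := nm_decay_small n r20 wm0.
have N1 : nbhs x0 (V `&` chart_dom c0).
  by apply: open_nbhs_nbhs; split => //; apply: openI => //; exact: chart_dom_open.
move: N1; rewrite nbhsE => -[V' oV' sV'].
pose C := n%:R * ((6 * (2 * n%:R * L + 1)) ^+ 2) ^+ n.
exists V', C, (expR (- (2 * d))), (Num.truncn (Num.max u0 u1)).+1; split => //.
- by rewrite mulr_ge0// exprn_ge0// sqr_ge0.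
- by rewrite expR_ge0 -[ltRHS]expR0 ltr_expR oppr_lt0 mulr_gt0.
move=> k k0k.
have /andP[ku0 ku1] : (u0 <= k%:R) && (u1 <= k%:R).
  by rewrite -ge_max (le_trans (ltW (truncnS_gt _)))// ler_nat.
pose rh i j := expR (- (k%:R * (w j + d * (j == i)%:R))).
have rh0 i j : 0 < rh i j by exact: expR_gt0.
have rhr i (Z : E) : (forall j, nc (Z 0 j) <= rh i j) -> nm Z < r2.
  move=> hZ; apply: (small (fun j => w j + d * (j == i)%:R) k%:R) => // j.
  by rewrite (le_trans (wmw j))// lerDl mulr_ge0// ltW.
have [|U [FU mU bU]] := @finite_cover_bound R n 'I_n
  (fun i => [set (c \o Q) Z | Z in [set Z : E | forall j, nc (Z 0 j) <= rh i j]])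
  (fun=> ((6 * (2 * n%:R * L + 1)) ^+ 2) ^+ n * expR (- (2 * k%:R)) * expR (- (2 * d)) ^+ k).
  move=> i.
  have [|U [hU mU bU]] := @lipschitz_box R n (c \o Q) L (rh i) L0 (rh0 i).
    by move=> Z Z' /rhr h /rhr h'; exact: lip.
  exists U; split => //; first by move=> _ [Z hZ <-]; exact: hU.
  by apply: le_trans bU _; rewrite /rh box_cover_volume.
exists U; split => //.
  by apply: le_trans bU _; rewrite sumr_const card_ord -[_ *+ n]mulr_natl /C !mulrA.
move=> x /sV'[Vx dx] dcx phix; set Z := zmap c0 x0 rho x.
have hZ1 j : nc (Z 0 j) <= expR (- (k%:R * w j)).
  apply: Phi_lt_coord => //; apply: le_lt_trans phix.
  by have := phi_ge x; rewrite /phi0 asboolT.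
have [i hi] : exists i, nc (Z 0 i) <= expR (- (k%:R * (w i + d))).
  apply: contrapT => h.
  have : expR ((B - k%:R) / cc) <= S Z.
    apply: (dom k%:R) => // i; rewrite hZ1 andbT leNgt; apply/negP => /ltW hi.
    by apply: h; exists i.
  rewrite /S /G Qz//; move: phix; rewrite phiE//.
  set s := \sum_(k < N) _ => phix hs.
  have s0 : 0 < s by apply: lt_le_trans hs; exact: expR_gt0.
  move: phix; rewrite lne_EFin// -EFinM -EFinD lte_fin.
  move: hs; rewrite -{1}(lnK (x := s)) ?posrE// ler_expR ler_pdivrMr// mulrC.
  by have := bB x Vx; rewrite ler_norml => /andP[b1 _]; lra.
apply: (FU i); exists Z; last by rewrite /= Qz.
move=> j; rewrite /rh; case: eqVneq => [->|ji]; first by rewrite mulr1.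
by rewrite mulr0 addr0.
Qed.

End sublevel_cover.

Section multiplier_ideals.
Variables (R : realType) (n : nat) (M : complexManifold R n).
Notation E := 'rV[R[i]]_n.
Implicit Types (c : chart R n M) (x p : M).

Lemma bounded_below_integrable c p (phi : M -> \bar R) V (B : R) :
  atlas c -> chart_dom c p -> quasi_psh phi -> open_nbhs p V ->
  (forall x, V x -> (B%:E <= phi x)%E) ->
  exists W : set E, [/\ open_nbhs (c p) W, W `<=` c @` chart_dom c &
    (lebesgue_Cn R n).-integrable (@cvec R n @^-1` W)
      (fun t => weight (phi (chart_inv c (cvec t))))].
Proof.
move=> ac dp qphi oV phiB.
apply: (@integrable_near _ _ M c p phi V 0 0 (Num.truncn `|B|).+1) => //.
  by rewrite lexx ltr01.
move=> k hk; exists set0; split.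
- by rewrite preimage_set0.
- by rewrite preimage_set0 measure0 !mul0r.
move=> x Vx _ hx; have := le_lt_trans (phiB x Vx) hx; rewrite lte_fin ltNge => /negP[].
rewrite lerNl (le_trans (ler_norm _))// normrN (le_trans (ltW (truncnS_gt _)))//.
by rewrite ler_nat.
Qed.

(** The weight of [phiA] is integrable near every point: away from [x0] it inherits a lower bound
    from [phi0], and at [x0] either the coefficient of the logarithm is nonpositive and [phiA] is
    bounded below, or [positive_log_cover] applies. *)
Lemma no_log_poles_minorant c0 x0 (w : 'I_n -> R) (rho : R) (phiA : M -> \bar R) :
  (1 < n)%N -> atlas c0 -> chart_dom c0 x0 -> 0 < rho ->
  (forall i, 0 < w i) -> \sum_i w i = 1 -> injective (dotw w) ->
  (forall z : E, (forall j, `|complex.Re (z 0 j - c0 x0 0 j)| <= rho /\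
     `|complex.Im (z 0 j - c0 x0 0 j)| <= rho) -> (c0 @` chart_dom c0) z) ->
  quasi_psh phiA -> log_poles phiA ->
  (forall x, (phi0 c0 x0 (fun i => (2 * w i)^-1)%R rho x <= phiA x)%E) ->
  multiplier_ideal phiA <> multiplier_ideal (phi0 c0 x0 (fun i => (2 * w i)^-1) rho).
Proof.
move=> n1 ac0 dx0 rho0 w0 w1 winj sq qA lA phi_ge.
have n0 : (0 < n)%N by exact: ltnW.
have A0 i : 0 < (2 * w i)^-1 by rewrite invr_gt0 mulr_gt0.
set phi := phi0 c0 x0 _ rho in phi_ge *.
have intA p c : atlas c -> chart_dom c p -> exists W : set E,
    [/\ open_nbhs (c p) W, W `<=` c @` chart_dom c &
    (lebesgue_Cn R n).-integrable (@cvec R n @^-1` W)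
      (fun t => weight (phiA (chart_inv c (cvec t))))].
  move=> ac dp; have [px0|px0] := pselect (p = x0); last first.
    have [V [B [oV hV]]] := phi0_locally_bounded ac0 dx0 A0 rho0 sq px0.
    apply: bounded_below_integrable ac dp qA oV _ => x Vx.
    exact: le_trans (hV x Vx) (phi_ge x).
  rewrite px0 in dp *.
  have [V [cc [N [g [b [oV hg [B hb] phiE]]]]]] := lA x0.
  have [cc0|cc0] := leP cc 0.
    have [V' [B' [oV' hV']]] := nonpositive_log_bounded ac0 dx0 oV cc0 hg hb.
    apply: bounded_below_integrable ac dp qA oV' _ => x /hV'[Vx].
    by move=> h; rewrite phiE; [exact: h|exact: Vx].
  have [V' [C [q [k0 [oV' C0 q01 cov]]]]] := positive_log_cover n1 ac0 ac dx0 dp rho0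
    w0 w1 winj oV cc0 hg hb phiE phi_ge.
  exact: integrable_near ac dp qA oV' C0 q01 cov.
move=> e; have : multiplier_ideal phiA setT (fun=> 1).
  split; first exact: openT.
    by move=> c ac x _ dx; exact: differentiable_cst.
  by move=> p _ c ac dp; exact: intA.
rewrite e => -[_ _ /(_ x0 I)].
exact: phi0_not_integrable ac0 dx0 w0 w1 rho0.
Qed.

Lemma polysquare_in_chart c x : chart_dom c x -> exists2 rho : R, 0 < rho &
  forall z : E, (forall j, `|complex.Re (z 0 j - c x 0 j)| <= rho /\
     `|complex.Im (z 0 j - c x 0 j)| <= rho) -> (c @` chart_dom c) z.
Proof.
move=> dx; have /nbhs_nm[r r0 hr] : nbhs (c x) (c @` chart_dom c).
  by apply: open_nbhs_nbhs; split; [exact: chart_img_open|exists x].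
exists (r / n.+1%:R / 2); first by rewrite !divr_gt0.
move=> z hz; rewrite -(subrK (c x) z) addrC; apply: hr.
apply: (@le_lt_trans _ _ (\sum_(j < n) r / n.+1%:R)).
  apply: ler_sum => j _; rewrite !mxE; apply: le_trans (nc_le_ReIm _) _.
  by rewrite [leRHS]splitr; have [h1 h2] := hz j; exact: lerD.
rewrite sumr_const card_ord -[_ *+ n]mulr_natr mulrAC ltr_pdivrMr ?ltr0n//.
by rewrite ltr_pM2l// ltr_nat.
Qed.

End multiplier_ideals.

Theorem mainTheorem2 (R : realType) (n : nat) (M : complexManifold R n)
    (dimM : (2 <= n)%N) :
  exists phi : M -> \bar R,
    [/\ quasi_psh phi,
        ~ (exists phiA : M -> \bar R,
            [/\ quasi_psh phiA, log_poles phiA,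
                forall x, (phi x <= phiA x)%E &
                multiplier_ideal phiA = multiplier_ideal phi]) &
        ~ (exists phiA : nat -> M -> \bar R,
            [/\ forall j, quasi_psh (phiA j) /\ log_poles (phiA j),
                forall j, multiplier_ideal (phiA j) = multiplier_ideal phi,
                forall j x, (phiA j.+1 x <= phiA j x)%E &
                forall x, phiA j x @[j --> \oo] --> phi x])].
Proof.
have n0 : (0 < n)%N by exact: ltnW.
have [x0 _] := @manifold_nonempty _ _ M.
have [c0 ac0 dx0] := atlas_cover x0.
have [rho rho0 sq] := polysquare_in_chart dx0.
have [w [w0 w1 winj]] := generic_weights R n0.
have A0 i : 0 < (2 * w i)^-1 by rewrite invr_gt0 mulr_gt0.
pose phi := phi0 c0 x0 (fun i => (2 * w i)^-1) rho.
have no phiA : quasi_psh phiA -> log_poles phiA -> (forall x, (phi x <= phiA x)%E) ->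
    multiplier_ideal phiA <> multiplier_ideal phi.
  exact: no_log_poles_minorant.
exists phi; split.
- exact: phi0_quasi_psh.
- by move=> [phiA [qA lA geA eA]]; exact: no eA.
move=> [phiA [qlA eA decA cvgA]].
(* A decreasing sequence lies above its limit, so its first member already contradicts [no]. *)
apply: (no (phiA 0)) (eA 0); [by case: (qlA 0)|by case: (qlA 0)|].
move=> x; have cv := cvgA x.
have dec : {homo (fun j => phiA j x) : m k / (m <= k)%N >-> (k <= m)%E}.
  by apply/nonincreasing_seqP => j; exact: decA.
rewrite -(cvg_lim _ cv)//.
by apply: lime_le; [exact: cvgP cv|apply: nearW => j; exact: dec].
Qed.
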